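(* Let $X=X(\mathbb T)$ be a Banach lattice satisfying Assumption A, and let $r,s\in\mathbb N$ with $2r\ge s$. Let $(G_n)_{n\in\mathbb N}$ be linear sampling operators with $G_nf\in\mathcal T_n$ for all $f\in X$, $n\in\mathbb N$ (i.e. $G_n:X_n\to\mathcal T_n$), for which there are constants $K_1,K_3>0$ such that for all $n\in\mathbb N$ $$\|G_nf\|_X\le K_1\|f\|_{X_n}\ \ (f\in X),\qquad \|T-G_nT\|_X\le K_3n^{-s}\|T^{(s)}\|_X\ \ (T\in\mathcal T_n).$$ Put $R_s(f,h)_{X_n}:=\|f-G_nf\|_X+\|f-G_nf\|_{X_n}+h^s\|(G_nf)^{(s)}\|_X$. Then for all $f\in X$ and $n\in\mathbb N$ $$R_s(f,1/n)_{X_n}\asymp\|(I-A_{\gamma/n})^rf\|_{X_n}+\|(I-\dot A_{\gamma/n})^sf\|_X,$$ where $\asymp$ denotes a two-sided inequality with positive constants independent of $f$ and $n$.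
   Context: $\mathbb T$ is the unit circle identified with $[-\pi,\pi)$ (functions on $\mathbb T$ are $2\pi$-periodic), with normalized Lebesgue measure $\mu$. A Banach lattice $X=X(\mathbb T)$ is a Banach space of measurable functions on $\mathbb T$ such that: 1) if $f$ is measurable, $g\in X$ and $|f|\le|g|$, then $f\in X$ and $\|f\|_X\le\|g\|_X$; 2) if $f_n\in X$, $\sup_n\|f_n\|_X<\infty$ and $0\le f_n\uparrow f$, then $f\in X$ and $\|f_n\|_X\to\|f\|_X$; 3) for every measurable $E$ with $\mu(E)<\infty$, $\chi_E\in X$ and there is $c_E>0$ with $\int_E|f|\,d\mu\le c_E\|f\|_X$. Functions in $X$ are regarded as finite-valued and defined at every point, not as equivalence classes. Steklov averages: $A_hf(x)=\frac1h\int_{x-h/2}^{x+h/2}f(t)\,dt$ and $\dot A_hf(x)=A_hf(x+\tfrac h2)$ for $h>0$; $I$ is the identity. Assumption A: $A_hf\in X$ for all $f\in X$, $h>0$, and $\sup_{h>0,\,\|f\|_X\le1}\|A_hf\|_X<\infty$. $\mathcal T_n$ is the set of trigonometric polynomials of degree at most $n$. $(\Phi_n)$ are linear subspaces of $X$ with $\Phi_m\subset\Phi_n$ for $m\le n$, $\Phi_0=\{0\}$, satisfying $\|\varphi^{(q)}\|_X\le(Bn)^q\|\varphi\|_X$ for all $q\in\mathbb N$, $\varphi\in\Phi_n$, with a constant $B=B_X>0$. (If $X$ is translation-invariant, spline spaces of smoothness $s$ are also admitted, with this inequality required only for $q\le s$.) Sampling operators: $G_nf(x)=\sum_{k=1}^{m_n}f(x_{k,n})\varphi_{k,n}(x)$,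 $n\in\mathbb N$, where $\varphi_{k,n}\in\Phi_n$ are $2\pi$-periodic and $x_k=x_{k,n}\in\mathbb T$ are nodes such that for some fixed $\gamma,\gamma'>0$, $\frac{\gamma}{n}\le x_{k+1,n}-x_{k,n}\le\frac{\gamma'}{n}$ for $k=1,\dots,m_n$, with $x_{m_n+1,n}=2\pi+x_{1,n}$. The constant $\gamma$ in the claim is this one. The discrete semi-norm is $\|f\|_{X_n}=\big\|\sum_{k=1}^{m_n}|f(x_k)|\chi_{[x_k,x_{k+1})}\big\|_X$. *)

(* Defs.v *)
From HB Require Import structures.
From mathcomp Require Import all_boot all_order all_algebra.
From mathcomp Require Import all_classical all_reals all_analysis.

Set Implicit Arguments.
Unset Strict Implicit.
Unset Printing Implicit Defensive.

Import Order.TTheory GRing.Theory Num.Theory.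
Import numFieldNormedType.Exports.

Local Open Scope classical_set_scope.
Local Open Scope ring_scope.

(* The real line with its Lebesgue (not just Borel) measurable sets; as a type
   it is convertible to R. *)
Notation lebR R := (caratheodory_type ((wlength (@idfun R))^*)%mu).

Section circle_measure.
Variable R : realType.

Definition circle : set (lebR R) := `[- (pi : R), pi[%classic.

Lemma measurable_circle : measurable circle.
Proof. by apply: sub_caratheodory; exact: measurable_itv. Qed.

Lemma inv2pi_ge0 : 0 <= ((pi : R) *+ 2)^-1.
Proof. by rewrite invr_ge0 mulrn_wge0// pi_ge0. Qed.

Definition circle_measure : set (lebR R) -> \bar R :=
  mscale (NngNum inv2pi_ge0)
    (mrestr (@completed_lebesgue_measure R) measurable_circle).
HB.instance Definition _ := Measure.on circle_measure.

End circle_measure.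
Arguments circle {R}.
Arguments circle_measure {R}.

(* Functions on the circle are 2 pi-periodic functions on R. *)
Definition circle_fun (R : realType) (f : R -> R) : Prop :=
  periodic f (pi *+ 2) /\ measurable_fun setT (f : lebR R -> R).

(* The 2 pi-periodic set which E represents modulo 2 pi. *)
Definition periodize (R : realType) (E : set R) : set R :=
  [set x | exists j : int, E (x + (pi *+ 2) *~ j)].

(* The elements are functions, not classes: equality in X is equality almost
   everywhere, hence the almost-everywhere relations in the axioms, and every
   measurable function that is a.e. equal to an element of X is in X.  The
   values of [bl_norm] outside the carrier carry no meaning. *)
Record banach_lattice (R : realType) := BanachLattice {
  bl_carrier :> (R -> R) -> Prop;
  bl_norm : (R -> R) -> R;
  bl_circle : forall f, bl_carrier f -> circle_fun f;
  bl_zero : bl_carrier (fun=> 0);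
  bl_add : forall f g, bl_carrier f -> bl_carrier g -> bl_carrier (f \+ g);
  bl_scale : forall c f, bl_carrier f -> bl_carrier (fun x => c * f x);
  bl_norm_ge0 : forall f, bl_carrier f -> 0 <= bl_norm f;
  bl_norm_eq0 : forall f, bl_carrier f -> bl_norm f = 0 ->
    {ae circle_measure, forall x, f x = 0};
  bl_norm_scale : forall c f, bl_carrier f ->
    bl_norm (fun x => c * f x) = `|c| * bl_norm f;
  bl_norm_add : forall f g, bl_carrier f -> bl_carrier g ->
    bl_norm (f \+ g) <= bl_norm f + bl_norm g;
  bl_complete : forall u : nat -> R -> R, (forall n, bl_carrier (u n)) ->
    (forall e : R, 0 < e -> exists n0 : nat, forall i j,
       (n0 <= i)%N -> (n0 <= j)%N -> bl_norm (u i \- u j) < e) ->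
    exists2 f, bl_carrier f & (fun n => bl_norm (u n \- f)) @ \oo --> (0 : R);
  bl_ideal : forall f g, circle_fun f -> bl_carrier g ->
    {ae circle_measure, forall x, `|f x| <= `|g x|} ->
    bl_carrier f /\ bl_norm f <= bl_norm g;
  bl_fatou : forall (u : nat -> R -> R) (f : R -> R), circle_fun f ->
    (forall n, bl_carrier (u n)) ->
    (exists M : R, forall n, bl_norm (u n) <= M) ->
    {ae circle_measure, forall x,
      [/\ forall n, 0 <= u n x, forall n, u n x <= u n.+1 x &
          (fun n => u n x) @ \oo --> f x]} ->
    bl_carrier f /\ (fun n => bl_norm (u n)) @ \oo --> bl_norm f;
  bl_indic : forall E : set (lebR R), measurable E -> E `<=` circle ->
    (circle_measure E < +oo)%E ->
    bl_carrier (\1_(periodize E) : R -> R) /\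
    exists2 c : R, 0 < c & forall f, bl_carrier f ->
      (\int[circle_measure]_(x in E) `|f x|%:E <= (c * bl_norm f)%:E)%E
}.

Section definitions.
Context {R : realType}.
Implicit Types (X : banach_lattice R) (f phi : R -> R) (h : R).

Definition steklov h f : R -> R := fun x =>
  h^-1 * \int[@completed_lebesgue_measure R]_(t in `[x - h / 2, x + h / 2]) f t.

Definition steklov_dot h f : R -> R := fun x => steklov h f (x + h / 2).

Definition iter_diff (A : (R -> R) -> R -> R) (r : nat) f : R -> R :=
  iter r (fun g => g \- A g) f.

Definition assumptionA X : Prop :=
  (forall f h, X f -> 0 < h -> X (steklov h f)) /\
  exists C : R, forall f h, X f -> 0 < h -> bl_norm X f <= 1 ->
    bl_norm X (steklov h f) <= C.

Definition trigpoly (n : nat) : set (R -> R) :=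
  [set f | exists a b : nat -> R, f = fun x =>
     \sum_(k < n.+1) (a k * cos (k%:R * x) + b k * sin (k%:R * x))].

Definition bernstein_spaces X (Phi : nat -> set (R -> R)) : Prop :=
  [/\ forall n, [/\ forall f, Phi n f -> X f,
        Phi n (fun=> 0),
        forall f g, Phi n f -> Phi n g -> Phi n (f \+ g) &
        forall c f, Phi n f -> Phi n (fun x => c * f x)],
      forall k n, (k <= n)%N -> Phi k `<=` Phi n,
      Phi 0%N = [set (fun=> 0)] &
      exists2 B : R, 0 < B & forall n phi, Phi n phi -> forall q,
        [/\ forall x, derivable (derive1n q phi) x 1,
            X (derive1n q phi) &
            bl_norm X (derive1n q phi) <= (B * n%:R) ^+ q * bl_norm X phi]].

(* For given n, the nodes are [x n 1 < ... < x n (m n)], and [x n (m n).+1] is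
   the first one shifted by a period. *)
Definition sampling_nodes (g g' : R) (m : nat -> nat) (x : nat -> nat -> R) :
    Prop :=
  forall n, (0 < n)%N ->
  x n (m n).+1 = pi *+ 2 + x n 1%N /\
  forall k, (1 <= k <= m n)%N ->
    - pi <= x n k < pi /\ g / n%:R <= x n k.+1 - x n k <= g' / n%:R.

Definition sampling_op (m : nat -> nat) (x : nat -> nat -> R)
    (phi : nat -> nat -> R -> R) (n : nat) f : R -> R := fun y =>
  \sum_(1 <= k < (m n).+1) f (x n k) * phi n k y.

Definition discrete_norm X (m : nat -> nat) (x : nat -> nat -> R) (n : nat) f
    : R :=
  bl_norm X (fun y => \sum_(1 <= k < (m n).+1)
    `|f (x n k)| * \1_(periodize `[x n k, x n k.+1[%classic) y).

Definition realization X (m : nat -> nat) (x : nat -> nat -> R)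
    (phi : nat -> nat -> R -> R) (s n : nat) f h : R :=
  let Gf := sampling_op m x phi n f in
  bl_norm X (f \- Gf) + discrete_norm X m x n (f \- Gf) +
  h ^+ s * bl_norm X (derive1n s Gf).

End definitions.

(* Main.v *)
Require Import Defs.
From HB Require Import structures.
From mathcomp Require Import all_boot all_order all_algebra.
From mathcomp Require Import all_classical all_reals all_analysis.
From mathcomp Require Import measurable_realfun ring lra zify.

Set Implicit Arguments.
Unset Strict Implicit.
Unset Printing Implicit Defensive.

Import Order.TTheory GRing.Theory Num.Theory.
Import numFieldNormedType.Exports.

Local Open Scope classical_set_scope.
Local Open Scope ring_scope.

(** Let [h = g / n], let [A] be the centred and [B] the forward average with
    step [h], and write [|f|_n] for the discrete norm.  The quantity to compare
    with the realization is [e + w], where [e = |(I - A)^r f|_n] and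
    [w = ||(I - B)^s f||].

    The lattice [X] need not be translation invariant, so that averages over
    shifted copies of a function cannot be estimated by Minkowski's inequality.
    What replaces it is the window [win a u x], the integral of [|u|] over
    [[x - a, x + a]].  A window is [2 a] times a Steklov average, so its norm is
    at most [2 a C ||u||] ([nx_win]), and moving its centre costs no more than
    an enlargement of its radius ([win_mono]).  Hence an operator is bounded as
    soon as its values are dominated pointwise by windows ([nx_le_win]); this is
    applied to averages, to convolutions with kernels of sufficient decay
    (summing over dyadic radii) and to sampled values, whose nodes lie within
    [g' / n] of every point of their cell ([discrete_norm_win]).

    The realization bounds the moduli ([modulus_le]).  With [T = G_n f] both
    differences split into a difference of [f - T], bounded by the norms of
    [f - T], and a difference of the smooth function [T], bounded by
    [n^-s ||T^(s)||]: a centred difference gains two derivatives at each step,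
    hence the hypothesis [s <= 2 r] ([steklov_diff_le]).

    The moduli bound the realization ([le_modulus]).  By [trig_approx] some
    trigonometric polynomial [T] of degree [n] satisfies
    [||f - T|| + n^-s ||T^(s)|| <= K w].  The discrete norm of [f - T] is at most
    [e], plus the discrete norm of [(I - A)^r T], plus that of
    [(f - T) - (I - A)^r (f - T)], which involves only averages of [f - T]
    and is therefore bounded by [||f - T||] ([discrete_norm_diff_sub]).
    The polynomial [P = T - G_n f = (T - G_n T) - G_n (f - T)] is then small in
    norm by the two hypotheses on [G_n], and Bernstein's inequality in [X]
    ([bernstein]) bounds its discrete norm and its derivatives.

    The approximation [trig_approx] is a smooth approximation
    ([smooth_approx]) followed by a Jackson kernel.  The identity
    [1 = X^(2 s) P(X) + (1 - X)^s Q(X)] suggests the approximant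
    [B^(2 s) P(B) f]; its [s]-th derivative is [h^-s] times a power of
    [D = (S - 1) B], where [S] is the shift by [h], and the question becomes
    whether [||D f|| <= K ||f - B f||] ([nx_dl_le]).  This is the main step.
    Let [v = f - B f].  A Taylor expansion of [F = B^(N + 2) f] relates
    [h F' = B^N D f], [F(x + h) - F(x) = B^(N + 1) D f] and [F - B F], which is
    [B^(N + 2) v], up to a remainder in [h^3 F''']; since [D f - B D f = D v],
    it follows that [D f] is bounded by [v] and the remainder.  The remainder is
    a second difference of half-step averages of [D f] itself, but averaged over
    [N] steps: its weights are the coefficients of
    [(X - 1)^2 ((1 + X) / 2)^N], so small that for [N] large its norm is at most
    half of [||D f||] ([second_diff_le], [central_small]), and it is absorbed. *)

(** * Translation invariance of Lebesgue measure *)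

Section translation.
Context {R : realType}.
Notation outer := ((wlength (@idfun R))^*)%mu.
Notation clm := (@completed_lebesgue_measure R).
Notation shift c := (fun x : R => x + c).

(** A cover of [A] by half-open intervals translates to a cover of the same
    total length. *)
Lemma outer_translation_le (c : R) (A : set R) :
  (outer (shift c @^-1` A) <= outer A)%E.
Proof.
apply: le_ereal_inf_tmp => _ [B [mB AB] <-].
apply: ereal_inf_lbound; exists (fun k => shift c @^-1` B k).
  split => [k|x /AB [k _ Bk]]; last by exists k.
  have [[a b] _ <-] := mB k.
  exists (a - c, b - c) => //=.
  by apply/seteqP; split => y /=; rewrite !in_itv/= ltrBlDr lerBrDr.
apply: eq_eseriesr => k _ /=.
have [[a b] _ /= <-] := mB k.
have -> : shift c @^-1` `]a, b] = `]a - c, b - c]%classic.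
  by apply/seteqP; split => y /=; rewrite !in_itv/= ltrBlDr lerBrDr.
have [ab|ba] := leP a b.
  rewrite !wlength_itv_bnd ?lerD2r//=; congr EFin; lra.
by rewrite !set_itv_ge// bnd_simp -leNgt ?lerD2r// ltW.
Qed.

Lemma outer_translation (c : R) (A : set R) :
  outer (shift c @^-1` A) = outer A.
Proof.
apply/eqP; rewrite eq_le outer_translation_le/=.
have := outer_translation_le (- c) (shift c @^-1` A).
by congr (_ <= _)%E; congr (outer _); apply/seteqP; split => x /=; rewrite subrK.
Qed.

Lemma measurable_translation (c : R) :
  measurable_fun setT (shift c : lebR R -> lebR R).
Proof.
move=> _ A mA; rewrite setTI.
suff : outer.-caratheodory (shift c @^-1` A) by [].
have {}mA : outer.-caratheodory A by [].
move=> Y.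
have h : shift c @^-1` (shift (- c) @^-1` Y) = Y.
  by apply/seteqP; split => x /=; rewrite addrK.
rewrite -[in LHS]h outer_translation.
have -> : Y `&` shift c @^-1` A = shift c @^-1` (shift (- c) @^-1` Y `&` A).
  by rewrite preimage_setI h.
have -> : Y `&` ~` (shift c @^-1` A) =
    shift c @^-1` (shift (- c) @^-1` Y `&` ~` A).
  by rewrite preimage_setI h.
by rewrite !(outer_translation c); exact: mA.
Qed.

End translation.

(** * Primitives of locally integrable functions *)

Section primitive.
Context {R : realType}.
Notation clm := (@completed_lebesgue_measure R).
Implicit Types (f g u v : R -> R) (a b c : R).

Lemma measurable_leb_itv (i : interval R) : measurable ([set` i] : set (lebR R)).
Proof. by apply: sub_caratheodory; exact: measurable_itv. Qed.

Lemma measurable_borel_leb (A : set R) :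
  measurable (A : set (measurableTypeR R)) -> measurable (A : set (lebR R)).
Proof. exact: sub_caratheodory. Qed.

Lemma clm_itvcc a b : a <= b -> clm `[a, b]%classic = (b - a)%:E.
Proof.
move=> ab; transitivity (@lebesgue_measure R `[a, b]%classic) => //.
rewrite lebesgue_measure_itv/= lte_fin; by case: ltgtP ab => // ->; rewrite subrr.
Qed.

Lemma clm_set1 a : clm [set a] = 0%E.
Proof. by rewrite -set_itv1 clm_itvcc// subrr. Qed.

Definition locint f :=
  forall a b, clm.-integrable (`[a, b]%classic : set (lebR R)) (EFin \o f).

Fact prim_key : unit. Proof. exact: tt. Qed.

(** The integral from 0 to [x] with its orientation: one of the two terms
    always vanishes.  The definition is locked so that conversion never
    unfolds an integral. *)
Definition prim f x := locked_with prim_key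
  (\int[clm]_(t in (`[0, x]%classic : set (lebR R))) f t -
   \int[clm]_(t in (`[x, 0]%classic : set (lebR R))) f t).

Lemma primE f x : prim f x =
  \int[clm]_(t in (`[0, x]%classic : set (lebR R))) f t -
  \int[clm]_(t in (`[x, 0]%classic : set (lebR R))) f t.
Proof. exact: locked_withE. Qed.

Let int1 f a : \int[clm]_(t in ([set a] : set (lebR R))) f t = 0.
Proof.
have m1 : measurable ([set a] : set (lebR R)).
  by rewrite -set_itv1; exact: measurable_leb_itv.
rewrite (@eq_Rintegral _ _ _ _ _ (cst (f a))); last by move=> x; rewrite inE => ->.
by rewrite Rintegral_cst//= clm_set1 mulr0.
Qed.

Lemma int_chasles f a b c : locint f -> a <= b -> b <= c ->
  \int[clm]_(t in (`[a, c]%classic : set (lebR R))) f t =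
  \int[clm]_(t in (`[a, b]%classic : set (lebR R))) f t +
  \int[clm]_(t in (`[b, c]%classic : set (lebR R))) f t.
Proof.
move=> lf ab bc.
have h : forall x y, x <= y ->
  \int[clm]_(t in (`[x, y]%classic : set (lebR R))) f t =
  \int[clm]_(t in (`]x, y]%classic : set (lebR R))) f t.
  move=> x y xy.
  have e : `[x, y]%classic = ([set x] `|` `]x, y]%classic : set R).
    by rewrite -set_itv1 -itv_bndbnd_setU ?bnd_simp.
  rewrite e Rintegral_setU ?int1 ?add0r//.
  - by rewrite -set_itv1; exact: measurable_leb_itv.
  - exact: measurable_leb_itv.
  - by have := lf x y; rewrite e.
  - by apply/disj_setPS => z [/= ->]; rewrite in_itv/= ltxx.
have e : `[a, c]%classic = (`[a, b] `|` `]b, c] : set R).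
  by rewrite -itv_bndbnd_setU ?bnd_simp.
rewrite e Rintegral_setU ?(h b c)//; try exact: measurable_leb_itv.
- by have := lf a c; rewrite e.
- apply/disj_setPS => z [/=]; rewrite !in_itv/= => /andP[_ zb] /andP[].
  by rewrite ltNge zb.
Qed.

Lemma int_prim f a b : locint f -> a <= b ->
  \int[clm]_(t in (`[a, b]%classic : set (lebR R))) f t = prim f b - prim f a.
Proof.
move=> lf ab; rewrite !primE.
have e0 x y : y <= x ->
    \int[clm]_(t in (`[x, y]%classic : set (lebR R))) f t = 0.
  rewrite le_eqVlt => /predU1P[->|yx]; first by rewrite set_itv1 int1.
  by rewrite set_itv_ge ?Rintegral_set0// bnd_simp -ltNge.
have [a0|a0] := leP 0 a.
  by rewrite (e0 a 0)// (e0 b 0) ?(le_trans a0)// (@int_chasles f 0 a b)//; ring.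
have [b0|b0] := leP 0 b.
  rewrite (e0 0 a) ?(ltW a0)// (e0 b 0)//.
  by rewrite (@int_chasles f a 0 b)// ?(ltW a0)//; ring.
rewrite (e0 0 a) ?(ltW a0)// (e0 0 b) ?(ltW b0)//.
by rewrite (@int_chasles f a b 0)// ?(ltW b0)//; ring.
Qed.

Lemma locintZ c f : locint f -> locint (fun x => c * f x).
Proof.
move=> lf a b.
have -> : EFin \o (fun x => c * f x) = (fun x => c%:E * (EFin \o f) x)%E by [].
by apply: integrableZl => //; exact: measurable_leb_itv.
Qed.

Lemma locint_abs f : locint f -> locint (fun x => `|f x|).
Proof. by move=> lf a b; exact: integrable_abse (lf a b). Qed.

Lemma primD f g x : locint f -> locint g ->
  prim (f \+ g) x = prim f x + prim g x.
Proof.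
move=> lf lg; rewrite !primE !RintegralD//; try exact: measurable_leb_itv.
by ring.
Qed.

Lemma primZ c f x : locint f -> prim (fun y => c * f y) x = c * prim f x.
Proof.
move=> lf; rewrite !primE !RintegralZl//; try exact: measurable_leb_itv.
by ring.
Qed.

Lemma prim_mono f g a b : locint f -> locint g -> a <= b ->
  (forall t, a <= t <= b -> f t <= g t) ->
  prim f b - prim f a <= prim g b - prim g a.
Proof.
move=> lf lg ab fg; rewrite -!int_prim//; apply: le_Rintegral => //.
exact: measurable_leb_itv.
Qed.

Lemma prim_abs f a b : locint f -> a <= b ->
  `|prim f b - prim f a| <= prim (fun x => `|f x|) b - prim (fun x => `|f x|) a.
Proof.
move=> lf ab; rewrite -!int_prim//; last exact: locint_abs.
by apply: le_normr_Rintegral => //; exact: measurable_leb_itv.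
Qed.

Lemma locint_cst c : locint (fun=> c).
Proof.
move=> a b; apply/integrableP; split; first exact/measurable_EFinP.
rewrite integral_cst/=; last exact: measurable_leb_itv.
have [ab|ba] := leP a b; first by rewrite clm_itvcc// -EFinM ltry.
by rewrite set_itv_ge ?measure0 ?mule0// bnd_simp -ltNge.
Qed.

Lemma prim_cst c a b : a <= b -> prim (fun=> c) b - prim (fun=> c) a = c * (b - a).
Proof.
move=> ab; rewrite -int_prim//; last exact: locint_cst.
rewrite Rintegral_cst//; last exact: measurable_leb_itv.
by rewrite /= clm_itvcc.
Qed.

End primitive.

Section calculus.
Context {R : realType}.
Notation clm := (@completed_lebesgue_measure R).
Implicit Types (f g u v : R -> R) (a b c : R).

Lemma leb_measurable_continuous u :
  continuous u -> measurable_fun setT (u : lebR R -> R).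
Proof.
move=> cu _ B mB; apply: measurable_borel_leb.
exact: (continuous_measurable_fun cu).
Qed.

Lemma bounded_on_segment u a b : continuous u ->
  exists M : R, forall t : R, a <= t <= b -> `|u t| <= M.
Proof.
move=> cu; have [ab|ba] := leP a b; last first.
  by exists 0 => t /andP[at_ tb]; have := le_lt_trans (le_trans at_ tb) ba; rewrite ltxx.
have cn : continuous (fun x => `|u x|).
  by move=> x; apply: (@continuous_comp _ _ _ u Num.norm);
    [exact: cu | exact: norm_continuous].
have [c _ h] := EVT_max ab (continuous_subspaceT cn).
by exists (`|u c|) => t tab; apply: h; rewrite in_itv.
Qed.

Lemma locint_bounded u : measurable_fun setT (u : lebR R -> R) ->
  (forall a b, exists M : R, forall t : R, a <= t <= b -> `|u t| <= M) -> locint u.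
Proof.
move=> mu bu a b; have [M hM] := bu a b.
apply: (le_integrable _ _ _ (locint_cst `|M| a b)).
- exact: measurable_leb_itv.
- by apply/measurable_EFinP; exact: measurable_funTS.
- move=> t /=; rewrite in_itv/= => /hM h; rewrite lee_fin normr_id.
  exact: le_trans h (ler_norm M).
Qed.

Lemma locint_continuous u : continuous u -> locint u.
Proof.
move=> cu; apply: locint_bounded => [|a b]; first exact: leb_measurable_continuous.
exact: bounded_on_segment.
Qed.

(** Absolute continuity of the integral, on the interval of radius 1 about the
    point. *)
Lemma prim_continuous f : locint f -> continuous (prim f).
Proof.
move=> lf x; apply/cvgrPdist_lt => e e0.
pose D : set (lebR R) := `[x - 1, x + 1]%classic.
have mD : measurable D by exact: measurable_leb_itv.
have ig : clm.-integrable setT (EFin \o (f \_ D)).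
  by rewrite -restrict_EFin; apply/integrable_restrict => //; rewrite setTI; exact: lf.
have [d [d0 hd]] := integral_normr_continuous ig e0.
have key y z : x - 1 <= y -> y <= z -> z <= x + 1 -> z - y < d ->
    `|prim f z - prim f y| < e.
  move=> xy yz zx zyd; apply: le_lt_trans (prim_abs lf yz) _.
  rewrite -int_prim//; last exact: locint_abs.
  have yzd : (clm `[y, z]%classic < d%:E)%E by rewrite clm_itvcc// lte_fin.
  apply: le_lt_trans (hd _ (measurable_leb_itv _) yzd).
  rewrite le_eqVlt; apply/orP; left; apply/eqP.
  apply: eq_Rintegral => t; rewrite inE/= in_itv/= => /andP[yt tz].
  rewrite patchE mem_set// /D/= in_itv/=.
  by rewrite (le_trans xy)//= (le_trans tz).
apply/nbhs_ballP; exists (Num.min 1 d) => /=; first by rewrite lt_min ltr01 d0.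
move=> y; rewrite /ball/= lt_min => /andP[].
have [xy|yx] := leP x y.
  rewrite distrC ger0_norm ?subr_ge0// => h1 h2; rewrite distrC.
  by apply: key => //; lra.
rewrite gtr0_norm ?subr_gt0// => h1 h2.
by apply: key => //; lra.
Qed.

Lemma is_derive_prim u x : continuous u -> is_derive x (1 : R) (prim u) (u x).
Proof.
move=> cu; have lu := locint_continuous cu.
have cvg_u : h^-1 *: ((prim u \o shift x) (h *: (1 : R)) - prim u x) @[h --> 0^']
    --> u x.
  apply/cvgrPdist_le => e e0.
  have /cvgrPdist_le/(_ e e0)/nbhs_ballP[d /= d0 hd] := cu x.
  have key y z : x - d < y -> y < z -> z < x + d ->
      `|(z - y) * u x - (prim u z - prim u y)| <= e * (z - y).
    move=> xy yz zx.
    have hu t : y <= t <= z -> u x - e <= u t <= u x + e.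
      move=> /andP[yt tz]; rewrite -ler_distlC; apply: hd.
      by rewrite /ball/= ltr_distlC; lra.
    have h1 : (u x - e) * (z - y) <= prim u z - prim u y.
      rewrite -(prim_cst _ (ltW yz)); apply: prim_mono => //; [exact: locint_cst|exact: ltW|].
      by move=> t /hu/andP[].
    have h2 : prim u z - prim u y <= (u x + e) * (z - y).
      rewrite -(prim_cst _ (ltW yz)); apply: prim_mono => //; [exact: locint_cst|exact: ltW|].
      by move=> t /hu/andP[].
    by rewrite ler_distl; lra.
  apply/nbhs_ballP; exists d => //= h; rewrite /ball/= sub0r normrN => hd' h0.
  rewrite /= -[_ *: 1]/(h * 1) mulr1 -[_ *: _]/(h^-1 * _).
  have -> : u x - h^-1 * (prim u (h + x) - prim u x) =
      h^-1 * (h * u x - (prim u (h + x) - prim u x)) by field.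
  rewrite normrM normfV ler_pdivrMl ?normr_gt0// [`|h| * e]mulrC.
  move: hd'; have [h0'|h0'] := ltP 0 h.
    rewrite (gtr0_norm h0') => hd'.
    have := @key x (h + x) ltac:(lra) ltac:(lra) ltac:(lra).
    by rewrite addrK.
  rewrite (ler0_norm h0') => hd'.
  have h0'' : h < 0 by rewrite lt_neqAle h0.
  have := @key (h + x) x ltac:(lra) ltac:(lra) ltac:(lra).
  have -> : x - (h + x) = - h by ring.
  by rewrite -normrN; congr (`|_| <= _); ring.
split; last by apply/cvg_lim => //; exact: cvg_u.
by apply/cvg_ex; exists (u x); exact: cvg_u.
Qed.

End calculus.

(** * Derivatives and primitives *)

Section derivatives.
Context {R : realType}.
Implicit Types (f g u v : R -> R) (a b c : R).

(** The derivative as a relation, which needs no proof of differentiability to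
    name the derivative. *)
Definition dv u v := forall x : R, is_derive x (1 : R) u (v x).

Lemma dv_continuous u v : dv u v -> continuous u.
Proof.
move=> h x; apply: differentiable_continuous; apply/derivable1_diffP.
by have [] := h x.
Qed.

Lemma dv_ext u v w : dv u v -> v =1 w -> dv u w.
Proof. by move=> h e x; rewrite -e. Qed.

Lemma dvD u u' v v' : dv u u' -> dv v v' ->
  dv (fun x => u x + v x) (fun x => u' x + v' x).
Proof. by move=> h k x; apply: (@is_deriveD _ _ _ u v x 1); [exact: h|exact: k]. Qed.

Lemma dvB u u' v v' : dv u u' -> dv v v' ->
  dv (fun x => u x - v x) (fun x => u' x - v' x).
Proof. by move=> h k x; apply: (@is_deriveB _ _ _ u v x 1); [exact: h|exact: k]. Qed.

Lemma dv_cst c : dv (fun=> c) (fun=> 0).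
Proof. by move=> x; exact: is_derive_cst. Qed.

Lemma dv_id : dv (fun x => x) (fun=> 1).
Proof. by move=> x; exact: is_derive_id. Qed.

Lemma dvM u u' v v' : dv u u' -> dv v v' ->
  dv (fun x => u x * v x) (fun x => u' x * v x + u x * v' x).
Proof.
move=> h k x; have := @is_deriveM _ _ u v x 1 _ _ (h x) (k x).
by move/is_derive_eq; apply; rewrite /GRing.scale/=; ring.
Qed.

Lemma dvZ c u u' : dv u u' -> dv (fun x => c * u x) (fun x => c * u' x).
Proof.
move=> h; apply: dv_ext (dvM (dv_cst c) h) _ => x.
by rewrite mul0r add0r.
Qed.

Lemma dv_comp u u' v v' : dv u u' -> dv v v' ->
  dv (fun x => u (v x)) (fun x => u' (v x) * v' x).
Proof. by move=> h k x; apply: is_derive1_comp; [exact: h|exact: k]. Qed.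

Lemma dv_shift c u u' : dv u u' -> dv (fun x => u (x + c)) (fun x => u' (x + c)).
Proof.
move=> h; apply: dv_ext (dv_comp h (dvD dv_id (dv_cst c))) _ => x.
by rewrite addr0 mulr1.
Qed.

Lemma dv_derive1 u v : dv u v -> derive1 u = v.
Proof.
by move=> h; apply/funext => x; rewrite derive1E (@derive_val _ _ _ _ _ _ _ (h x)).
Qed.

Lemma dv_inj u v w a b : dv u w -> dv v w -> u b - u a = v b - v a.
Proof.
move=> h k; have d : dv (fun x => u x - v x) (fun=> 0).
  by apply: dv_ext (dvB h k) _ => x; rewrite subrr.
have := @is_derive_0_is_cst R _ a b d => /= e; lra.
Qed.

Lemma dv_prim u : continuous u -> dv (prim u) u.
Proof. by move=> cu x; exact: is_derive_prim. Qed.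

Lemma prim_dv u v a b : dv u v -> continuous v -> prim v b - prim v a = u b - u a.
Proof. by move=> h cv; apply: dv_inj; [exact: dv_prim|]. Qed.

Lemma dv_le u v a b (M : R) : dv u v -> a <= b ->
  (forall t, a <= t <= b -> `|v t| <= M) -> `|u b - u a| <= M * (b - a).
Proof.
move=> h ab hM.
have [c + ->] := MVT_segment ab (fun x _ => h x) (continuous_subspaceT (dv_continuous h)).
rewrite in_itv/= => /hM hc; rewrite normrM (ger0_norm (x := b - a)) ?subr_ge0//.
by rewrite ler_wpM2r// subr_ge0.
Qed.

Lemma continuous_abs u : continuous u -> continuous (fun x => `|u x|).
Proof.
by move=> cu x; apply: (@continuous_comp _ _ _ u Num.norm);
  [exact: cu | exact: norm_continuous].
Qed.

Lemma cont_shift c u : continuous u -> continuous (fun x => u (x + c)).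
Proof.
move=> cu x; apply: (@continuous_comp _ _ _ (fun x => x + c) u); last exact: cu.
by apply: cvgD; [exact: cvg_id|exact: cvg_cst].
Qed.

Lemma dv_prim_abs u v a b : dv u v -> continuous v -> a <= b ->
  `|u b - u a| <= prim (fun x => `|v x|) b - prim (fun x => `|v x|) a.
Proof.
by move=> h cv ab; rewrite -(prim_dv _ _ h)// prim_abs//; exact: locint_continuous.
Qed.

Lemma prim_ge0 f a b : locint f -> (forall x, 0 <= f x) -> a <= b ->
  prim f a <= prim f b.
Proof.
move=> lf f0 ab; rewrite -subr_ge0.
have := prim_mono (locint_cst 0) lf ab (fun t _ => f0 t).
by rewrite prim_cst// mul0r.
Qed.

End derivatives.

(** * Integrals of periodic functions *)

Section measure_preserving.
Context d (T : measurableType d) (R : realType).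
Variables (mu : {measure set T -> \bar R}) (phi : T -> T).
Hypothesis mphi : measurable_fun setT phi.
Hypothesis muphi : forall A, measurable A -> mu (phi @^-1` A) = mu A.
Implicit Types (D : set T) (g : T -> \bar R).

Lemma ge0_integral_preserving D g :
  measurable D -> measurable_fun D g -> {in D, forall y, (0 <= g y)%E} ->
  (\int[mu]_(x in D) g x = \int[mu]_(x in phi @^-1` D) (g \o phi) x)%E.
Proof.
move=> mD mg g0; rewrite -(ge0_integral_pushforward mphi mu mD mg g0).
by apply: eq_measure_integral => // A mA _; rewrite -[LHS]muphi.
Qed.

Lemma integral_preserving D g : measurable D -> measurable_fun setT g ->
  mu.-integrable (phi @^-1` D) (g \o phi) ->
  (\int[mu]_(x in D) g x = \int[mu]_(x in phi @^-1` D) (g \o phi) x)%E.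
Proof.
move=> mD mg ig; rewrite -(integral_pushforward mphi mg ig mD).
by apply: eq_measure_integral => // A mA _; rewrite -[LHS]muphi.
Qed.

End measure_preserving.

Section periodic.
Context {R : realType}.
Notation clm := (@completed_lebesgue_measure R).
Implicit Types (f g u v : R -> R) (a b c : R).

Notation tr c := (fun x : lebR R => ((x : R) + c)%R : lebR R).

Lemma integrable_translation f c a b : measurable_fun setT (f : lebR R -> R) ->
  (forall x, f (x + c) = f x) ->
  clm.-integrable (`[a, b[%classic : set (lebR R)) (EFin \o f) ->
  clm.-integrable (`[a + c, b + c[%classic : set (lebR R)) (EFin \o f).
Proof.
move=> mf pf /integrableP[_ i].
have e : tr c @^-1` `[a + c, b + c[%classic = `[a, b[%classic.
  by apply/seteqP; split => x /=; rewrite !in_itv/= lerD2r ltrD2r.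
have ef : (fun x => `|(EFin \o f) x|%E) \o tr c = (fun x => `|(EFin \o f) x|%E).
  by apply/funext => x /=; rewrite pf.
have mf' D : measurable_fun D ((EFin \o f) : lebR R -> \bar R).
  by apply/measurable_EFinP; exact: measurable_funTS.
apply/integrableP; split; first exact: mf'.
rewrite (ge0_integral_preserving (measurable_translation c)) ?e ?ef.
- exact: i.
- by move=> A _; exact: outer_translation.
- exact: measurable_leb_itv.
- exact: measurableT_comp.
- by move=> x _; exact: abse_ge0.
Qed.

Lemma prim_translation f c a b : measurable_fun setT (f : lebR R -> R) ->
  (forall x, f (x + c) = f x) -> locint f -> a <= b ->
  prim f (b + c) - prim f (a + c) = prim f b - prim f a.
Proof.
move=> mf pf lf ab; rewrite -!int_prim ?lerD2r// /Rintegral; congr fine.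
have e : tr c @^-1` `[a + c, b + c]%classic = `[a, b]%classic.
  by apply/seteqP; split => x /=; rewrite !in_itv/= !lerD2r.
have ef : (EFin \o f) \o tr c = EFin \o f.
  by apply/funext => x /=; rewrite pf.
rewrite (integral_preserving (measurable_translation c)); last 4 first.
- by move=> A _; exact: outer_translation.
- exact: measurable_leb_itv.
- exact/measurable_EFinP.
- by rewrite e ef.
by rewrite e ef.
Qed.

Lemma periodicz f (T : R) : periodic f T ->
  forall (n : nat) x, f (x + T *+ n) = f x /\ f (x - T *+ n) = f x.
Proof.
move=> pf n x; split; first exact: periodicn.
by rewrite -[in RHS](subrK (T *+ n) x) periodicn.
Qed.

(** Integrability over one period spreads to a long interval by periodicity,
    and then to every interval. *)
Lemma locint_circle f : circle_fun f ->
  clm.-integrable (`[- pi, pi[%classic : set (lebR R)) (EFin \o f) -> locint f.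
Proof.
move=> [pf mf] i0 a b.
pose I (y z : R) := clm.-integrable (`[y, z[%classic : set (lebR R)) (EFin \o f).
have tr c y z : (forall x, f (x + c) = f x) -> I y z -> I (y + c) (z + c).
  exact: integrable_translation.
have un y z w : y <= z -> z <= w -> I y z -> I z w -> I y w.
  move=> yz zw i1 i2; rewrite /I.
  have -> : `[y, w[%classic = (`[y, z[ `|` `[z, w[ : set R).
    by rewrite -itv_bndbnd_setU ?bnd_simp.
  move/integrableP : i1 => [_ i1]; move/integrableP : i2 => [_ i2].
  have mf' D : measurable_fun D ((EFin \o f) : lebR R -> \bar R).
    by apply/measurable_EFinP; exact: measurable_funTS.
  apply/integrableP; split; first exact: mf'.
  rewrite ge0_integral_setU.
  - by rewrite lte_add_pinfty.
  - exact: measurable_leb_itv.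
  - exact: measurable_leb_itv.
  - exact: measurableT_comp.
  - by move=> x _; exact: abse_ge0.
  - apply/disj_setPS => t [/=]; rewrite !in_itv/= => /andP[_ tz] /andP[].
    by rewrite leNgt tz.
have p0 : (0 : R) < pi := pi_gt0 R.
have up n : I (- pi) (pi + pi *+ 2 *+ n).
  elim: n => [|n ih]; first by rewrite mulr0n addr0.
  apply: (un _ pi); [lra| |exact: i0|].
    by rewrite lerDl mulrn_wge0// mulrn_wge0// ltW.
  have := tr (pi *+ 2) _ _ pf ih.
  have -> : - pi + pi *+ 2 = pi :> R by rewrite mulr2n addrA addNr add0r.
  by rewrite -addrA -mulrSr.
have [n hn] : exists n : nat, `|a| + `|b| <= (pi : R) *+ 2 *+ n.
  exists (Num.truncn (`|a| + `|b|)).+1.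
  have h := truncnS_gt (`|a| + `|b|).
  apply: le_trans (ltW h) _.
  rewrite -[leRHS]mulr_natr ler_peMl//.
  by have := pi_ge2 R; rewrite mulr2n; lra.
(* The interval of length (2 n + 1) periods is moved back by n periods, so as
   to be centred at 0. *)
have := tr (- (pi *+ 2 *+ n)) _ _ (fun x => (periodicz pf n x).2) (up (n + n)%N).
rewrite /I => ii; apply: integrableS ii; try exact: measurable_leb_itv.
move=> x /=; rewrite !in_itv/= mulrnDr => /andP[ax xb].
have := ler_norm (- a); rewrite normrN; have := ler_norm b.
have := normr_ge0 a; have := normr_ge0 b.
by move: p0 hn; set P := pi *+ 2 *+ n; set A := `|a|; set B := `|b|; lra.
Qed.

End periodic.

(** * Steklov averages and windows *)

Section averages.
Context {R : realType}.
Implicit Types (f g u v : R -> R) (a b c h : R).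

(** The average over [[x, x + h]], equal to [steklov_dot h f x].  As a
    difference quotient of a primitive it satisfies the same rules as
    differences do. *)
Definition fav h f : R -> R := fun x => (prim f (x + h) - prim f x) / h.

(** The integral of [|f|] over [[x - a, x + a]], the universal majorant below. *)
Definition win a f : R -> R := fun x =>
  prim (fun t => `|f t|) (x + a) - prim (fun t => `|f t|) (x - a).

Definition CP u := continuous u /\ periodic u ((pi : R) *+ 2).

Lemma steklovE h f x : 0 < h -> locint f -> steklov h f x = fav h f (x - h / 2).
Proof.
move=> h0 lf; rewrite /steklov int_prim//; last by lra.
by rewrite /fav mulrC (_ : x - h / 2 + h = x + h / 2)//; field.
Qed.

Lemma steklov_dotE h f x : 0 < h -> locint f -> steklov_dot h f x = fav h f x.
Proof. by move=> h0 lf; rewrite /steklov_dot steklovE// addrK. Qed.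

Lemma winE a f x : 0 < a -> locint f ->
  win a f x = 2 * a * steklov (2 * a) (fun t => `|f t|) x.
Proof.
move=> a0 lf; rewrite steklovE//; [|lra|exact: locint_abs].
have -> : x - 2 * a / 2 = x - a by lra.
rewrite /win /fav mulrCA divff ?mulr1; last lra.
by congr (prim _ _ - _); lra.
Qed.

Lemma prim_win f x a b c : locint f -> x - c <= a -> a <= b -> b <= x + c ->
  prim (fun t => `|f t|) b - prim (fun t => `|f t|) a <= win c f x.
Proof.
move=> /locint_abs lf ca ab bc; rewrite /win.
by apply: lerB; apply: prim_ge0.
Qed.

Lemma win_ge0 a f x : 0 <= a -> locint f -> 0 <= win a f x.
Proof.
move=> a0 lf; apply: (@le_trans _ _ (prim (fun t => `|f t|) x - prim (fun t => `|f t|) x)).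
  by rewrite subrr.
by apply: prim_win => //; lra.
Qed.

(** This plays the part of translation invariance: a change of centre is paid
    by the radius. *)
Lemma win_mono f x y a b : locint f -> 0 <= a -> `|x - y| + a <= b ->
  win a f x <= win b f y.
Proof.
move=> lf a0; have := ler_norm (x - y); have := ler_norm (y - x).
rewrite (distrC y) => h1 h2 h3; rewrite {1}/win; apply: prim_win => //; lra.
Qed.

Lemma fav_le_win h f x : 0 < h -> locint f -> `|fav h f x| <= h^-1 * win h f x.
Proof.
move=> h0 lf; rewrite /fav normrM mulrC normfV (gtr0_norm h0).
apply: ler_wpM2l; first by rewrite invr_ge0 ltW.
by apply: (le_trans (prim_abs lf _)); [lra|apply: prim_win => //; lra].
Qed.

Lemma contD u v : continuous u -> continuous v -> continuous (fun x => u x + v x).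
Proof. by move=> cu cv x; exact: (@continuousD _ _ _ u v x (cu x) (cv x)). Qed.

Lemma contM u v : continuous u -> continuous v -> continuous (fun x => u x * v x).
Proof. by move=> cu cv x; exact: (@continuousM _ _ u v x (cu x) (cv x)). Qed.

Lemma cont_cst c : continuous (fun _ : R => c).
Proof. by move=> x; exact: cvg_cst. Qed.

Lemma contZ c u : continuous u -> continuous (fun x => c * u x).
Proof. by move=> cu; have := contM (@cont_cst c) cu. Qed.

Lemma contB u v : continuous u -> continuous v -> continuous (fun x => u x - v x).
Proof. by move=> cu cv x; exact: (@continuousB _ _ _ u v x (cu x) (cv x)). Qed.

Lemma fav_continuous h f : locint f -> continuous (fav h f).
Proof.
move=> /prim_continuous lf.
have sh : continuous (fun x => prim f (x + h)) by exact: cont_shift.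
exact: (contM (contB sh lf) (@cont_cst h^-1)).
Qed.

Lemma fav_periodic h f : 0 <= h -> locint f -> circle_fun f ->
  periodic (fav h f) ((pi : R) *+ 2).
Proof.
move=> h0 lf [pf mf] x; rewrite /fav.
have xh : x <= x + h by rewrite lerDl.
by have := prim_translation mf pf lf xh; rewrite (addrAC x) => ->.
Qed.

Lemma CP_circle u : CP u -> circle_fun u.
Proof. by move=> [cu pu]; split => //; exact: leb_measurable_continuous. Qed.

Lemma CP_locint u : CP u -> locint u.
Proof. by move=> [cu _]; exact: locint_continuous. Qed.

Lemma CP_fav h f : 0 <= h -> locint f -> circle_fun f -> CP (fav h f).
Proof.
by move=> h0 lf cf; split; [exact: fav_continuous|exact: fav_periodic].
Qed.

Lemma CPD u v : CP u -> CP v -> CP (fun x => u x + v x).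
Proof.
move=> [cu pu] [cv pv]; split; last by move=> x; rewrite pu pv.
exact: contD.
Qed.

Lemma CPM u v : CP u -> CP v -> CP (fun x => u x * v x).
Proof.
move=> [cu pu] [cv pv]; split; last by move=> x; rewrite pu pv.
exact: contM.
Qed.

Lemma CP_cst c : CP (fun=> c).
Proof. by split => // x; exact: cvg_cst. Qed.

Lemma CPZ c u : CP u -> CP (fun x => c * u x).
Proof. by move=> cu; have := CPM (CP_cst c) cu. Qed.

Lemma CPB u v : CP u -> CP v -> CP (fun x => u x - v x).
Proof.
move=> hu hv; have := CPD hu (CPZ (-1) hv).
by congr CP; apply/funext => x; rewrite mulN1r.
Qed.

Lemma CP_abs u : CP u -> CP (fun x => `|u x|).
Proof.
by move=> [cu pu]; split; [exact: continuous_abs|move=> x; rewrite pu].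
Qed.

Lemma CP_shift c u : CP u -> CP (fun x => u (x + c)).
Proof.
move=> [cu pu]; split; first exact: (@cont_shift _ c _ cu).
by move=> x; rewrite addrAC pu.
Qed.

Lemma circle_funD f g : circle_fun f -> circle_fun g -> circle_fun (f \+ g).
Proof.
move=> [pf mf] [pg mg]; split; first by move=> x /=; rewrite pf pg.
exact: measurable_funD.
Qed.

Lemma circle_fun_abs f : circle_fun f -> circle_fun (fun x => `|f x|).
Proof.
move=> [pf mf]; split; first by move=> x /=; rewrite pf.
exact: measurableT_comp.
Qed.

End averages.

(** * Banach lattices on the circle *)

Section restricted_measure.
Context d (T : measurableType d) (R : realType).
Variables (mu : {measure set T -> \bar R}) (D : set T) (mD : measurable D).
Variable (k : {nonneg R}).

Lemma ge0_integral_mscale_mrestr (g : T -> \bar R) :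
  measurable_fun D g -> (forall x, D x -> (0 <= g x)%E) ->
  (\int[mscale k (mrestr mu mD)]_(x in D) g x =
   k%:num%:E * \int[mu]_(x in D) g x)%E.
Proof.
move=> mg g0; rewrite ge0_integral_mscale//; congr (_ * _)%E.
by apply: eq_measure_integral => A mA AD; rewrite /= /mrestr setIidl.
Qed.

End restricted_measure.

Section lattice.
Context {R : realType}.
Variable X : banach_lattice R.
Notation clm := (@completed_lebesgue_measure R).
Notation nx := (bl_norm X).
Implicit Types (f g u v : R -> R) (a b c h : R).

Lemma ae_all (P : R -> Prop) :
  (forall x, P x) -> {ae (@circle_measure R), forall x, P x}.
Proof. move=> h; exact: (@aeW _ _ R (@circle_measure R) P h). Qed.

Lemma nx_le f g : circle_fun f -> X g -> (forall x, `|f x| <= `|g x|) ->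
  X f /\ nx f <= nx g.
Proof. by move=> cf Xg h; apply: bl_ideal => //; exact: ae_all. Qed.

Lemma nx_le_pos f g : circle_fun f -> X g -> (forall x, `|f x| <= g x) ->
  X f /\ nx f <= nx g.
Proof.
by move=> cf Xg h; apply: nx_le => // x; rewrite (le_trans (h x))// ler_norm.
Qed.

Lemma X_abs f : X f -> X (fun x => `|f x|) /\ nx (fun x => `|f x|) = nx f.
Proof.
move=> Xf; have cf := bl_circle Xf; have ca := circle_fun_abs cf.
have [Xa h1] : X (fun x => `|f x|) /\ nx (fun x => `|f x|) <= nx f.
  by apply: nx_le => // x; rewrite normr_id.
have [_ h2] : X f /\ nx f <= nx (fun x => `|f x|).
  by apply: nx_le => // x; rewrite normr_id.
by split => //; apply/eqP; rewrite eq_le h1 h2.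
Qed.

Lemma circle_measure_lty : (@circle_measure R circle < +oo)%E.
Proof.
rewrite /circle_measure /mscale/= /mrestr setIid.
have h : (clm (@circle R) <= clm `[(- pi)%R, pi%R]%classic)%E.
  apply: le_measure; rewrite ?inE; [exact: measurable_circle|exact: measurable_leb_itv|].
  by move=> x; rewrite /circle /= !in_itv/= => /andP[-> /ltW].
rewrite clm_itvcc in h; last by have := pi_ge0 R; lra.
have f : clm (@circle R) \is a fin_num.
  by rewrite ge0_fin_numE//; exact: le_lt_trans h (ltry _).
by rewrite -(fineK f) -EFinM ltry.
Qed.

Lemma periodize_circle : periodize (@circle R) = setT.
Proof.
apply/seteqP; split => // x _.
have p0 := pi_gt0 R.
set q := (x + pi) / (pi *+ 2).
exists (- Num.floor q).
have q1 : (Num.floor q)%:~R <= q by exact/real_floor_le/num_real.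
have q2 : q < (Num.floor q + 1)%:~R by exact/real_floorD1_gt/num_real.
have xq : x = q * (pi *+ 2) - pi.
  by rewrite /q divfK ?addrK// mulrn_eq0/= gt_eqF.
rewrite /circle /= in_itv/= -mulrzr mulrNz {1 2}xq.
rewrite intrD in q2.
move: q1 q2; set z := (Num.floor q)%:~R => q1 q2.
have := ler_wpM2r (ltW (_ : 0 < pi *+ 2)) q1.
have := ltr_pM2r (_ : 0 < (pi : R) *+ 2) q (z + 1).
rewrite q2 !mulr2n.
have e : (0 : R) < pi + pi by lra.
move=> /(_ e) + /(_ e); set Q := q * _; set Z := z * _; rewrite mulrN mulrDl mul1r -/Z mulrC -/Z; lra.
Qed.

(** The circle itself is a set of finite measure, and its periodic extension
    is the whole line. *)
Lemma X_one : X (fun=> 1).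
Proof.
have [h _] := bl_indic X (@measurable_circle R) (@subset_refl _ _) circle_measure_lty.
move: h; rewrite periodize_circle; congr (X _).
by apply/funext => x; rewrite indicE in_setT.
Qed.

Lemma X_cst c : X (fun=> c).
Proof. by have := bl_scale c X_one; congr (X _); apply/funext => x; rewrite mulr1. Qed.

Lemma periodic_bounded u : CP u -> exists M : R, forall x, `|u x| <= M.
Proof.
move=> [cu pu]; have [M hM] := bounded_on_segment (- pi) pi cu.
exists M => x; have : periodize (@circle R) x by rewrite periodize_circle.
move=> [j]; rewrite /circle/= in_itv/= => /andP[h1 h2].
have -> : u x = u (x + pi *+ 2 *~ j).
  case: j {h1 h2} => n; first by rewrite -pmulrn (periodicz pu n x).1.
  by rewrite NegzE mulrNz -pmulrn (periodicz pu n.+1 x).2.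
by apply: hM; rewrite h1/=; exact: ltW.
Qed.

Lemma X_bounded f (M : R) : circle_fun f -> (forall x, `|f x| <= M) -> X f.
Proof. by move=> cf h; have [] := nx_le_pos cf (X_cst M) h. Qed.

Lemma X_CP u : CP u -> X u.
Proof.
move=> cu; have [M hM] := periodic_bounded cu.
exact: X_bounded (CP_circle cu) hM.
Qed.

(** The lattice norm controls the integral over one period. *)
Lemma X_locint f : X f -> locint f.
Proof.
move=> Xf; have cf := bl_circle Xf; apply: locint_circle => //.
have [_ [c c0 hc]] := bl_indic X (@measurable_circle R) (@subset_refl _ _) circle_measure_lty.
have mf D : measurable_fun D ((EFin \o f) : lebR R -> \bar R).
  by case: cf => _ mf; apply/measurable_EFinP; exact: measurable_funTS.
apply/integrableP; split => //.
have := hc f Xf.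
rewrite /circle_measure ge0_integral_mscale_mrestr; last 2 first.
- by apply/measurable_EFinP; apply: measurable_funTS; exact: (circle_fun_abs cf).2.
- by move=> x _; rewrite lee_fin.
set I := (\int[_]_(x in _) _)%E.
move=> hI; suff : (I < +oo)%E by [].
move: hI.
have I0 : (0 <= I)%E by exact: integral_ge0.
have k0 : (0 < ((pi : R) *+ 2)^-1) by rewrite invr_gt0 mulrn_wgt0// pi_gt0.
move: I0; case: I => [r _ _|_|//]; first by rewrite ltry.
by rewrite gt0_muley ?lte_fin.
Qed.

Lemma X_sub f g : X f -> X g -> X (fun x => f x - g x).
Proof.
move=> Xf Xg; have := bl_add Xf (bl_scale (-1) Xg).
by congr (X _); apply/funext => x /=; rewrite mulN1r.
Qed.

Lemma nx_sub f g : X f -> X g -> nx (fun x => f x - g x) <= nx f + nx g.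
Proof.
move=> Xf Xg; have := bl_norm_add Xf (bl_scale (-1) Xg).
rewrite bl_norm_scale// normrN1 mul1r; congr (nx _ <= _).
by apply/funext => x /=; rewrite mulN1r.
Qed.

Lemma X_addp f g : X f -> X g -> X (fun x => f x + g x).
Proof. exact: bl_add. Qed.

Lemma nx_add f g : X f -> X g -> nx (fun x => f x + g x) <= nx f + nx g.
Proof. exact: bl_norm_add. Qed.

Lemma nx0 : nx (fun=> 0) = 0.
Proof.
have := bl_norm_scale 0 X_one; by rewrite normr0 !mul0r.
Qed.

Lemma nx_sum (n : nat) (F : nat -> R -> R) : (forall i, (i < n)%N -> X (F i)) ->
  X (fun x => \sum_(i < n) F i x) /\
  nx (fun x => \sum_(i < n) F i x) <= \sum_(i < n) nx (F i).
Proof.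
elim: n => [|n ih] hF.
  rewrite big_ord0; have -> : (fun x => \sum_(i < 0) F i x) = (fun=> 0).
    by apply/funext => x; rewrite big_ord0.
  by rewrite nx0; split => //; exact: bl_zero.
have [Xs hs] := ih (fun i hi => hF i (ltnW hi)).
have Xn := hF n (ltnSn n).
rewrite big_ord_recr/=.
have -> : (fun x => \sum_(i < n.+1) F i x) = (fun x => \sum_(i < n) F i x + F n x).
  by apply/funext => x; rewrite big_ord_recr.
split; first exact: bl_add.
by rewrite (le_trans (nx_add Xs Xn))// lerD2r.
Qed.

Definition steklov_bound (C : R) := 0 < C /\ forall f h, X f -> 0 < h ->
  X (steklov h f) /\ nx (steklov h f) <= C * nx f.

Lemma steklovZ c h f : 0 < h -> locint f ->
  steklov h (fun x => c * f x) = (fun x => c * steklov h f x).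
Proof.
move=> h0 lf; apply/funext => x; rewrite !steklovE//; last exact: locintZ.
by rewrite /fav !primZ// -mulrBr mulrA.
Qed.

(** The bound on the unit ball extends by homogeneity.  When [f] has norm 0
    every multiple of it is in the unit ball, which forces the average to have
    norm 0 too. *)
Lemma exists_steklov_bound : assumptionA X -> exists C, steklov_bound C.
Proof.
move=> [hX [C hC]]; exists (`|C| + 1); split; first by have := normr_ge0 C; lra.
move=> f h Xf h0; split; first exact: hX.
have key (k : R) : `|k| * nx f <= 1 -> `|k| * nx (steklov h f) <= C.
  move=> hk; rewrite -bl_norm_scale//; last exact: hX.
  rewrite -steklovZ//; last exact: X_locint.
  by apply: hC => //; [exact: bl_scale|rewrite bl_norm_scale].
have := bl_norm_ge0 Xf; rewrite le_eqVlt => /predU1P[e|n0]; last first.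
  have := key (nx f)^-1; rewrite normfV gtr0_norm// mulVf ?gt_eqF// lexx.
  move=> /(_ isT); rewrite ler_pdivrMl// mulrC => /le_trans; apply.
  by rewrite ler_pM2r// (le_trans (ler_norm C))// lerDl.
rewrite -e mulr0 leNgt; apply/negP => s0.
have := key ((`|C| + 1) / nx (steklov h f)).
rewrite -e mulr0 ler01 => /(_ isT).
have c1 : 0 < `|C| + 1 by have := normr_ge0 C; lra.
rewrite normrM normfV (gtr0_norm c1) (gtr0_norm s0) divfK ?gt_eqF//.
by have := ler_norm C; lra.
Qed.

End lattice.

(** * Calculus of the averages *)

Section average_calculus.
Context {R : realType}.
Implicit Types (f g u v w : R -> R) (a b c h k : R).

Lemma favD h f g x : locint f -> locint g ->
  fav h (fun t => f t + g t) x = fav h f x + fav h g x.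
Proof.
move=> lf lg; rewrite /fav; have e y := primD y lf lg.
by rewrite (e (x + h)) (e x) -mulrDl; congr (_ / _); ring.
Qed.

Lemma favZ h c f x : locint f -> fav h (fun t => c * f t) x = c * fav h f x.
Proof. by move=> lf; rewrite /fav !primZ// -mulrBr mulrA. Qed.

Lemma favB h f g x : locint f -> locint g ->
  fav h (fun t => f t - g t) x = fav h f x - fav h g x.
Proof.
move=> lf lg; have -> : (fun t => f t - g t) = (fun t => f t + (-1) * g t).
  by apply/funext => t; rewrite mulN1r.
by rewrite favD//; [rewrite favZ// mulN1r|exact: locintZ].
Qed.

Lemma fav_shift h c u x : continuous u ->
  fav h (fun t => u (t + c)) x = fav h u (x + c).
Proof.
move=> cu; rewrite /fav; congr (_ / _).
rewrite (prim_dv _ _ (dv_shift c (dv_prim cu)) (cont_shift cu)).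
by rewrite (addrAC x).
Qed.

Lemma fav_dv h u v x : dv u v -> continuous v ->
  fav h v x = (u (x + h) - u x) / h.
Proof. by move=> d cv; rewrite /fav (prim_dv _ _ d cv). Qed.

Lemma dv_scaled_diff h u v : dv u v ->
  dv (fun x => (u (x + h) - u x) / h) (fun x => (v (x + h) - v x) / h).
Proof.
move=> d; have := dvZ h^-1 (dvB (dv_shift h d) d).
by congr dv; apply/funext => x; rewrite mulrC.
Qed.

Lemma dv_fav h u : continuous u -> dv (fav h u) (fun x => (u (x + h) - u x) / h).
Proof. by move=> cu; exact: dv_scaled_diff (dv_prim cu). Qed.

Lemma dv_fav_fav h u v : dv u v -> continuous v -> dv (fav h u) (fav h v).
Proof.
move=> d cv; apply: dv_ext (dv_fav h (dv_continuous d)) _ => x.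
by rewrite (fav_dv _ _ d cv).
Qed.

Lemma fav_dist h u x c (M : R) : 0 < h -> continuous u ->
  (forall y, x <= y <= x + h -> `|u y - c| <= M) -> `|fav h u x - c| <= M.
Proof.
move=> h0 cu hM.
have cu' : continuous (fun t => u t - c) by apply: contB => //; exact: cont_cst.
have xh : x <= x + h by lra.
have := dv_le (dv_prim cu') xh hM.
have -> : prim (fun t => u t - c) (x + h) - prim (fun t => u t - c) x =
    h * (fav h u x - c).
  have lc := locint_cst (- c).
  have e y := primD y (locint_continuous cu) lc.
  rewrite (e (x + h)) (e x) /fav.
  have hn : h != 0 by rewrite gt_eqF.
  have e' (y z : R) : h * ((y - z) / h - c) = y - z - c * h by field.
  by rewrite e'; have := prim_cst (- c) xh; rewrite (addrC x) addrK; lra.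
rewrite normrM (gtr0_norm h0) addrAC subrr add0r mulrC.
by rewrite ler_pM2r.
Qed.

Lemma dv_win u v x y b : dv u v -> continuous v -> `|y - x| <= b ->
  `|u y - u x| <= win b v x.
Proof.
move=> d cv; have lv := locint_continuous cv.
have := ler_norm (y - x); have := ler_norm (x - y); rewrite (distrC x) => h1 h2 h3.
have [xy|yx] := leP x y.
  by apply: le_trans (dv_prim_abs d cv xy) _; apply: prim_win => //; lra.
rewrite distrC; apply: le_trans (dv_prim_abs d cv (ltW yx)) _.
by apply: prim_win => //; lra.
Qed.

Lemma fav_sub_le h u v x : 0 < h -> dv u v -> continuous v ->
  `|u x - fav h u x| <= win h v x.
Proof.
move=> h0 d cv; rewrite distrC; apply: fav_dist => //; first exact: dv_continuous d.
move=> y /andP[xy yx]; apply: dv_win => //; rewrite ger0_norm; lra.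
Qed.

Lemma steklov_sub_le1 h u v x : 0 < h -> dv u v -> continuous v ->
  `|u x - fav h u (x - h / 2)| <= win h v x.
Proof.
move=> h0 d cv; rewrite distrC; apply: fav_dist => //; first exact: dv_continuous d.
by move=> y /andP[xy yx]; apply: dv_win => //; rewrite ler_norml; lra.
Qed.

(** For a centred average the first-order terms cancel: the integrand is [u (x
    + t) + u (x - t) - 2 * u x], which the second derivative controls. *)
Lemma steklov_sub_le2 h u v w x : 0 < h -> dv u v -> dv v w -> continuous w ->
  `|u x - fav h u (x - h / 2)| <= h * win h w x.
Proof.
move=> h0 d d' cw; set W := win h w x.
have cu := dv_continuous d.
have W0 : 0 <= W by apply: win_ge0; [exact: ltW|exact: locint_continuous].
have refl f f' : dv f f' -> dv (fun t => f (x - t)) (fun t => - f' (x - t)).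
  move=> df; apply: dv_ext (dv_comp df (dvB (dv_cst x) dv_id)) _ => t.
  by rewrite sub0r mulrN1.
have shx f f' : dv f f' -> dv (fun t => f (x + t)) (fun t => f' (x + t)).
  by move=> df; have := dv_shift x df; congr dv; apply/funext => t; rewrite addrC.
have h2 : 0 <= h / 2 by lra.
have h3 t : 0 <= t <= h / 2 -> `|u (x + t) + u (x - t) - 2 * u x| <= W * h.
  move=> /andP[t0 th].
  have := dv_le (dvD (shx _ _ d) (refl _ _ d)) t0 (M := W).
  rewrite !addr0 subr0 (_ : u x + u x = 2 * u x); last by ring.
  rewrite subr0 => hh; apply: le_trans (hh _) _; last first.
    by apply: ler_wpM2l => //; lra.
  move=> s /andP[s0 st].
  have ss : x - s <= x + s by lra.
  apply: le_trans (dv_prim_abs d' cw ss) _.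
  by apply: prim_win; [exact: locint_continuous|lra..].
have dU := dv_prim cu.
have := dv_le (dvB (dvB (shx _ _ dU) (refl _ _ dU)) (dvZ (2 * u x) dv_id)) h2 (M := W * h).
rewrite /= mulr0 !subr0 addr0 subrr subr0.
have -> : 2 * u x * (h / 2) = h * u x by field.
move=> /(_ _)/wrap[|hh].
  move=> t /h3; congr (`|_| <= _); ring.
rewrite /fav.
have -> : x - h / 2 + h = x + h / 2 by field.
move: hh; set A := prim u _; set B := prim u _ => hh.
have hn : h != 0 by rewrite gt_eqF.
rewrite distrC.
have -> : (A - B) / h - u x = h^-1 * (A - B - h * u x) by field; exact: hn.
rewrite normrM normfV (gtr0_norm h0) ler_pdivrMl//.
apply: le_trans hh _.
have -> : h * (h * W) = W * h * h by ring.
by apply: ler_wpM2l; [rewrite mulr_ge0// ltW|lra].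
Qed.

End average_calculus.

(** * Differences of smooth functions *)

Section chains.
Context {R : realType}.
Implicit Types (f g u v w : R -> R) (a b c h : R) (G H : nat -> R -> R).

(** The functions [G 0, ..., G k] are successive derivatives, all periodic and
    continuous; carrying the whole family avoids iterated derivation. *)
Definition chain (k : nat) G :=
  (forall i, (i <= k)%N -> CP (G i)) /\
  (forall i, (i < k)%N -> dv (G i) (G i.+1)).

Lemma chain_le j k G : (j <= k)%N -> chain k G -> chain j G.
Proof.
move=> jk [h1 h2]; split => i ij; first exact/h1/(leq_trans ij).
exact/h2/(leq_trans ij).
Qed.

Lemma chain_shift j k G : chain (j + k) G -> chain k (fun i => G (j + i)%N).
Proof.
move=> [h1 h2]; split => i ik; first by apply: h1; rewrite leq_add2l.
by rewrite addnS; apply: h2; rewrite ltn_add2l.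
Qed.

Lemma chainB k G H : chain k G -> chain k H -> chain k (fun i x => G i x - H i x).
Proof.
move=> [g1 g2] [h1 h2]; split => i ik; first by apply: CPB; [exact: g1|exact: h1].
by apply: dvB; [exact: g2|exact: h2].
Qed.

Lemma steklov_CP h u : 0 < h -> CP u -> steklov h u = (fun x => fav h u (x - h / 2)).
Proof. by move=> h0 cu; apply/funext => x; rewrite steklovE//; exact: CP_locint. Qed.

Lemma steklov_dot_CP h u : 0 < h -> CP u -> steklov_dot h u = fav h u.
Proof. by move=> h0 cu; apply/funext => x; rewrite steklov_dotE//; exact: CP_locint. Qed.

Lemma CP_fav' h u : 0 < h -> CP u -> CP (fav h u).
Proof.
by move=> h0 cu; apply: CP_fav; [exact: ltW|exact: CP_locint|exact: CP_circle].
Qed.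

Lemma chain_fav k h G : 0 < h -> chain k G -> chain k (fun i => fav h (G i)).
Proof.
move=> h0 [g1 g2]; split => i ik; first exact/CP_fav'/g1.
by apply: dv_fav_fav; [exact: g2|have [] := g1 _ ik].
Qed.

Lemma chain_steklov k h G : 0 < h -> chain k G -> chain k (fun i => steklov h (G i)).
Proof.
move=> h0 cG; have [f1 f2] := chain_fav h0 cG; have [g1 _] := cG.
split => i ik.
  by rewrite steklov_CP//; [exact: CP_shift (f1 _ ik)|exact: g1].
rewrite !steklov_CP//; [|exact: g1|exact/g1/ltnW].
exact: dv_shift (f2 _ ik).
Qed.

Lemma iter_diffSr (A : (R -> R) -> R -> R) r f :
  iter_diff A r.+1 f = iter_diff A r (fun x => f x - A f x).
Proof. by rewrite /iter_diff iterSr. Qed.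

Lemma iter_diffS (A : (R -> R) -> R -> R) r f :
  iter_diff A r.+1 f = (fun x => iter_diff A r f x - A (iter_diff A r f) x).
Proof. by []. Qed.

End chains.

Section bounds.
Context {R : realType}.
Variables (X : banach_lattice R) (C : R).
Hypothesis hC : steklov_bound X C.
Notation nx := (bl_norm X).
Implicit Types (f g u v w : R -> R) (a b c h : R) (G H : nat -> R -> R).

Lemma steklov_bound_gt0 : 0 < C. Proof. by case: hC. Qed.

(** A window is a multiple of a Steklov average of [|f|]; in this form the
    bound on the averages enters all pointwise estimates. *)
Lemma nx_win a f : X f -> 0 < a ->
  X (win a f) /\ nx (win a f) <= 2 * a * C * nx f.
Proof.
move=> Xf a0; have [Xa e] := X_abs Xf.
have a2 : 0 < 2 * a by lra.
have [Xs s] := hC.2 _ _ Xa a2.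
have -> : win a f = (fun x => 2 * a * steklov (2 * a) (fun t => `|f t|) x).
  by apply/funext => x; rewrite winE//; exact: X_locint Xf.
split; first exact: bl_scale.
rewrite bl_norm_scale// ger0_norm; last lra.
by rewrite -mulrA ler_pM2l; [rewrite -e|lra].
Qed.

Lemma nx_le_win a c v f : circle_fun v -> X f -> 0 < a -> 0 <= c ->
  (forall x, `|v x| <= c * win a f x) ->
  X v /\ nx v <= c * (2 * a * C * nx f).
Proof.
move=> cv Xf a0 c0 h; have [Xw w] := nx_win Xf a0.
have [Xv hv] := nx_le_pos cv (bl_scale c Xw) h.
split => //; apply: le_trans hv _.
by rewrite bl_norm_scale// ger0_norm// ler_wpM2l.
Qed.

Lemma X_CP_fav h f : X f -> 0 < h -> CP (fav h f).
Proof.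
by move=> Xf h0; apply: CP_fav; [exact: ltW|exact: X_locint Xf|exact: bl_circle Xf].
Qed.

Lemma nx_fav h f : X f -> 0 < h -> X (fav h f) /\ nx (fav h f) <= 2 * C * nx f.
Proof.
move=> Xf h0; have cf := X_CP_fav Xf h0; split; first exact: X_CP.
have [] := @nx_le_win h h^-1 _ f (CP_circle cf) Xf h0.
- by rewrite invr_ge0 ltW.
- by move=> x; apply: fav_le_win => //; exact: X_locint Xf.
move=> _ /le_trans; apply; rewrite le_eqVlt; apply/orP; left; apply/eqP.
by field; rewrite gt_eqF.
Qed.

Lemma nx_sub_self f g K : X f -> X g -> nx g <= K * nx f ->
  X (fun x => f x - g x) /\ nx (fun x => f x - g x) <= (1 + K) * nx f.
Proof.
move=> Xf Xg h; split; first exact: X_sub.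
by apply: le_trans (nx_sub Xf Xg) _; rewrite mulrDl mul1r lerD2l.
Qed.

Lemma chain_X k G i : chain k G -> (i <= k)%N -> X (G i).
Proof. by move=> [h _] ik; exact/X_CP/h. Qed.

Lemma fav_step k h G : 0 < h -> (k <= 1)%N -> chain k G ->
  nx (fun x => G 0%N x - fav h (G 0%N) x) <= (1 + 2 * C) * h ^+ k * nx (G k).
Proof.
move=> h0; case: k => [_ cG|[_ cG|//]].
  rewrite expr0 mulr1; have X0 := chain_X cG (leqnn 0).
  by have [Xa ha] := nx_fav X0 h0; have [] := nx_sub_self X0 Xa ha.
have [c0 c1] := (cG.1 0%N isT, cG.1 1%N isT); have d := cG.2 0%N isT.
rewrite expr1.
have [] := @nx_le_win h 1 _ (G 1%N) (CP_circle (CPB c0 (CP_fav' h0 c0))) (X_CP X c1) h0 ler01.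
  by move=> x; rewrite mul1r; apply: fav_sub_le => //; case: c1.
move=> _ /le_trans; apply.
have n0 := bl_norm_ge0 (X_CP X c1); have := mulr_ge0 (ltW h0) n0.
by move=> hn; rewrite -subr_ge0; set E := (X in 0 <= X);
  have -> : E = h * nx (G 1%N) by rewrite /E; ring.
Qed.

(** Each factor of the difference consumes one derivative and gains a factor
    [h]. *)
Lemma fav_diff_le s h G : 0 < h -> chain s G ->
  nx (iter_diff (steklov_dot h) s (G 0%N)) <=
    (1 + 2 * C) ^+ s * h ^+ s * nx (G s).
Proof.
move=> h0; elim: s G => [|s ih] G cG.
  by rewrite !expr0 !mul1r.
rewrite iter_diffSr steklov_dot_CP//; last exact: cG.1.
have cG' : chain s (fun i x => G i x - fav h (G i) x).
  by apply: (chain_le (leqnSn s)); apply: chainB => //; exact: chain_fav.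
apply: le_trans (ih _ cG') _.
have cs : chain 1 (fun i => G (s + i)%N) by apply: chain_shift; rewrite addn1.
have := fav_step h0 (leqnn 1) cs; rewrite addn0 addn1 expr1 => hs.
rewrite !exprS.
have p0 : 0 <= (1 + 2 * C) ^+ s * h ^+ s.
  by rewrite mulr_ge0// exprn_ge0//; [have := steklov_bound_gt0; lra|exact: ltW].
by apply: le_trans (ler_wpM2l p0 hs) _; rewrite le_eqVlt; apply/orP; left; apply/eqP; ring.
Qed.

(** The three cases use the boundedness of the average, its first-order and
    its second-order approximation. *)
Lemma steklov_step k h G : 0 < h -> (k <= 2)%N -> chain k G ->
  nx (fun x => G 0%N x - steklov h (G 0%N) x) <= (1 + 2 * C) * h ^+ k * nx (G k).
Proof.
move=> h0; case: k => [_ cG|[_ cG|[_ cG|//]]].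
- rewrite expr0 mulr1; have X0 := chain_X cG (leqnn 0).
  have [Xa ha] := hC.2 _ h X0 h0; have [_ h1] := nx_sub_self X0 Xa ha.
  apply: le_trans h1 _; apply: ler_wpM2r; first exact: bl_norm_ge0.
  by have := steklov_bound_gt0; lra.
- have [c0 c1] := (cG.1 0%N isT, cG.1 1%N isT); have d := cG.2 0%N isT.
  rewrite expr1.
  have cs : CP (fun x => G 0%N x - steklov h (G 0%N) x).
    apply: CPB => //; rewrite steklov_CP//.
    exact: CP_shift (CP_fav' h0 c0).
  have [] := @nx_le_win h 1 _ (G 1%N) (CP_circle cs) (X_CP X c1) h0 ler01.
    by move=> x; rewrite mul1r steklov_CP//; apply: steklov_sub_le1 => //; case: c1.
  move=> _ /le_trans; apply.
  have n0 := bl_norm_ge0 (X_CP X c1); have := mulr_ge0 (ltW h0) n0.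
  by move=> hn; rewrite -subr_ge0; set E := (X in 0 <= X);
    have -> : E = h * nx (G 1%N) by rewrite /E; ring.
- have [c0 c2] := (cG.1 0%N isT, cG.1 2%N isT).
  have [d d'] := (cG.2 0%N isT, cG.2 1%N isT).
  have cs : CP (fun x => G 0%N x - steklov h (G 0%N) x).
    apply: CPB => //; rewrite steklov_CP//.
    exact: CP_shift (CP_fav' h0 c0).
  have [] := @nx_le_win h h _ (G 2%N) (CP_circle cs) (X_CP X c2) h0 (ltW h0).
    by move=> x; rewrite steklov_CP//; apply: (steklov_sub_le2 _ h0 d d'); case: c2.
  move=> _ /le_trans; apply.
  have n0 := bl_norm_ge0 (X_CP X c2); have := mulr_ge0 (exprn_ge0 2 (ltW h0)) n0.
  by move=> hn; rewrite -subr_ge0; set E := (X in 0 <= X);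
    have -> : E = h ^+ 2 * nx (G 2%N) by rewrite /E; ring.
Qed.

(** Each factor may consume up to two derivatives. *)
Lemma steklov_diff_le r k h G : 0 < h -> (k <= 2 * r)%N -> chain k G ->
  nx (iter_diff (steklov h) r (G 0%N)) <=
    (1 + 2 * C) ^+ r * h ^+ k * nx (G k).
Proof.
move=> h0; elim: r k G => [|r ih] k G kr cG.
  by move: kr cG; rewrite muln0 leqn0 => /eqP ->; rewrite !expr0 !mul1r.
rewrite iter_diffSr.
(* the remaining r factors consume j derivatives, the present one k - j <= 2 *)
pose j := minn k (2 * r).
have jk : (j <= k)%N by rewrite geq_minl.
have cG' : chain j (fun i x => G i x - steklov h (G i) x).
  by apply: (chain_le jk); apply: chainB => //; exact: chain_steklov.
apply: le_trans (ih _ _ (geq_minr _ _) cG') _.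
have cs : chain (k - j) (fun i => G (j + i)%N) by apply: chain_shift; rewrite subnKC.
have kj2 : (k - j <= 2)%N.
  by rewrite leq_subLR /j addn_minl leq_min leq_addr/= -mulnSr.
have := steklov_step h0 kj2 cs; rewrite addn0 subnKC// => hs.
have p0 : 0 <= (1 + 2 * C) ^+ r * h ^+ j.
  by rewrite mulr_ge0// exprn_ge0//; [have := steklov_bound_gt0; lra|exact: ltW].
apply: le_trans (ler_wpM2l p0 hs) _.
rewrite -[in h ^+ k](subnKC jk) exprD exprS.
by rewrite le_eqVlt; apply/orP; left; apply/eqP; ring.
Qed.

End bounds.

(** * The coefficients of (X - 1)^2 ((1 + X) / 2)^(2k) *)

Section binomial_smoothing.
Context {R : realType}.

Definition half_shift : {poly R} := (2^-1)%:P * (1 + 'X).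

(** With [X] standing for the shift by [h / 2], the [2 k]-th power of the
    average with step [h] is [half_shift ^+ (2 * k)] applied to the same power
    of the average with step [h / 2] ([iter_fav_half]); the factor [('X - 1)
    ^+ 2] comes from a second derivative. *)
Definition second_diff (k : nat) : {poly R} :=
  ('X - 1) ^+ 2 * half_shift ^+ (2 * k).

(** The normalized central binomial coefficient, of size [k ^ (- 1 / 2)]. *)
Definition central (k : nat) : R := 'C(2 * k, k)%:R / 4 ^+ k.

Lemma coef_half_shiftX n i : (half_shift ^+ n)`_i = 'C(n, i)%:R / 2 ^+ n.
Proof.
rewrite /half_shift exprMn -polyC_exp coefCM exprVn mulrC; congr (_ / _).
rewrite addrC exprD1n coef_sum.
have [ni|ni] := leqP i n; last first.
  rewrite bin_small// big1// => j _; rewrite coefMn coefXn.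
  by rewrite (_ : i == j = false) ?mul0rn// gtn_eqF// (leq_ltn_trans _ ni)// -ltnS.
rewrite (bigD1 (Ordinal (ni : (i < n.+1)%N)))//= coefMn coefXn eqxx big1 ?addr0//.
move=> j ji; rewrite coefMn coefXn (_ : i == j = false) ?mul0rn//.
by apply/negbTE; apply: contra ji => /eqP ij; apply/eqP/val_inj.
Qed.

Lemma second_diff_sq k (r := ('X - 1) * half_shift ^+ k) : second_diff k = r * r.
Proof. by rewrite /second_diff mulnC exprM /r -[LHS]exprMn expr2. Qed.

Lemma coef_subX1 (p : {poly R}) i :
  (('X - 1) * p)`_i = (if i == 0%N then 0 else p`_i.-1) - p`_i.
Proof. by rewrite mulrBl mul1r coefB coefXM. Qed.

Lemma coef_subX1_antisym k i : (i <= k.+1)%N ->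
  (('X - 1) * half_shift ^+ k)`_(k.+1 - i) = - (('X - 1) * half_shift ^+ k)`_i.
Proof.
move=> ik; rewrite !coef_subX1 !coef_half_shiftX opprB.
case: i ik => [_|i]; first by rewrite subn0/= binn bin0 (@bin_small k k.+1)// mul0r.
rewrite ltnS => ik; rewrite subSS subn_eq0/=.
have [ki|ki] := leqP k i.
  have -> : i = k by apply/eqP; rewrite eqn_leq ik ki.
  by rewrite subnn bin0 binn bin_small// mul0r !sub0r.
by rewrite -subn1 -subnDA addn1 !bin_sub// ltnW.
Qed.

Lemma second_diff_mid k : (second_diff k)`_k.+1 = - (2 * central k / k.+1%:R).
Proof.
rewrite /second_diff expr2 -mulrA !coef_subX1/= !coef_half_shiftX/=.
have hk : k.+1%:R != 0 :> R by rewrite pnatr_eq0.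
have h4 : (2 : R) ^+ (2 * k) = 4 ^+ k by rewrite exprM; congr (_ ^+ _); ring.
have h40 : (4 : R) ^+ k != 0 by rewrite expf_neq0// pnatr_eq0.
have e1 : k.+1%:R * 'C(2 * k, k.+1)%:R = k%:R * 'C(2 * k, k)%:R :> R.
  rewrite -!natrM mul_bin_left; congr (_ * _)%:R.
  by rewrite mul2n -addnn addnK.
have e2 : (if k == 0%N then 0 else 'C(2 * k, k.-1)%:R / 2 ^+ (2 * k)) =
    'C(2 * k, k.+1)%:R / 2 ^+ (2 * k) :> R.
  case: k {hk h4 h40 e1} => [|k]; first by rewrite /= muln0 (@bin_small 0 1)// mul0r.
  rewrite /= -(@bin_sub _ k.+2); last by rewrite mulnS ltnS mul2n -addnn leq_addr.
  by congr ('C(_, _)%:R / _); rewrite mulnS mul2n -addnn add2n !subSS addnK.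
rewrite e2 h4 /central.
have -> : 'C(2 * k, k.+1)%:R = k%:R * 'C(2 * k, k)%:R / k.+1%:R :> R.
  by rewrite -e1 mulrAC divff// mul1r.
set B := 'C(2 * k, k)%:R; rewrite -natr1 in hk *.
field.
by rewrite hk h40.
Qed.

Lemma central_ge0 k : 0 <= central k.
Proof. by rewrite /central divr_ge0// exprn_ge0. Qed.

(** The polynomial is the square of [r = ('X - 1) * half_shift ^+ k], so by
    the Cauchy-Schwarz inequality each of its coefficients is at most the sum
    of the squares of the coefficients of [r].  As [r] is antisymmetric, that
    sum is minus the middle coefficient of [r * r]. *)
Lemma second_diff_le k i :
  `|(second_diff k)`_i| <= 2 * central k / k.+1%:R.
Proof.
pose r := ('X - 1) * half_shift ^+ k.
have r0 j : (k.+1 < j)%N -> r`_j = 0.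
  move=> kj; rewrite /r coef_subX1 !coef_half_shiftX gtn_eqF ?(leq_trans _ kj)//.
  by rewrite !bin_small ?mul0r ?subrr//; [exact: ltnW|rewrite -ltnS prednK// (leq_trans _ kj)].
pose S := \sum_(j < k.+2) r`_j ^+ 2.
have eS : S = 2 * central k / k.+1%:R.
  apply: oppr_inj; rewrite -second_diff_mid second_diff_sq coefM /S -sumrN.
  apply: eq_bigr => -[j /= hj] _.
  by rewrite coef_subX1_antisym -1?ltnS// mulrN expr2.
have S2 n : \sum_(j < n) r`_j ^+ 2 <= S.
  have [nk|kn] := leqP n k.+2.
    rewrite /S (big_ord_widen _ (fun j => r`_j ^+ 2) nk).
    rewrite [leRHS](bigID (fun j : 'I__ => (j < n)%N))/= lerDl sumr_ge0// => j _.
    exact: sqr_ge0.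
  rewrite /S (big_ord_widen _ (fun j => r`_j ^+ 2) (ltnW kn)).
  rewrite [leLHS](bigID (fun j : 'I__ => (j < k.+2)%N))/= gerDl big1// => j.
  by rewrite -leqNgt => kj; rewrite r0// expr0n.
rewrite second_diff_sq coefM -/r -eS.
apply: le_trans (ler_norm_sum _ _ _) _.
have h j : `|r`_j * r`_(i - j)| <= (r`_j ^+ 2 + r`_(i - j) ^+ 2) / 2.
  rewrite normrM -[r`_j ^+ 2]real_normK ?num_real//.
  rewrite -[r`_(i - j) ^+ 2]real_normK ?num_real//.
  set x := `|_|; set y := `|_|.
  by have := sqr_ge0 (x - y); nra.
apply: le_trans (ler_sum _ (fun (j : 'I_i.+1) _ => h j)) _.
rewrite -mulr_suml big_split/= ler_pdivrMr// mulr_natr mulr2n.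
apply: lerD; first exact: S2.
rewrite (reindex_inj rev_ord_inj)/=.
under eq_bigr => j _ do rewrite subSS subKn -1?ltnS//.
exact: S2.
Qed.

(** Induction on [k] with the ratio [(2 k + 1) / (2 k + 2)] of consecutive
    terms. *)
Lemma central_sq k : central k ^+ 2 * (2 * k + 1)%:R <= 1.
Proof.
elim: k => [|k ih]; first by rewrite /central bin0 expr0 divr1 expr1n mul1r.
have h : (k + 1)%:R * central k.+1 = (2 * k + 1)%:R / 2 * central k.
  rewrite /central !mulrA exprS invfM !mulrA; congr (_ / _).
  have e : ((k + 1) * 'C(2 * k.+1, k.+1) = 2 * (2 * k + 1) * 'C(2 * k, k))%N.
    have e1 : (2 * k.+1 * 'C(2 * k + 1, k) = k.+1 * 'C(2 * k.+1, k.+1))%N.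
      by rewrite -mul_bin_diag mulnS addn1.
    have e2 : ((2 * k + 1) * 'C(2 * k, k) = k.+1 * 'C(2 * k + 1, k))%N.
      rewrite addn1 (mul_bin_down (2 * k).+1 k); congr (_ * _)%N.
      by rewrite mul2n -addnn -addnS addKn.
    by rewrite addn1 -e1 -!mulnA e2.
  by rewrite -natrM e !natrM; field.
have k1 : (0 : R) < (k + 1)%:R ^+ 2 by rewrite exprn_gt0// ltr0n addn1.
suff : (k + 1)%:R ^+ 2 * (central k.+1 ^+ 2 * (2 * k.+1 + 1)%:R) <=
    (k + 1)%:R ^+ 2 * 1 by rewrite ler_pM2l.
rewrite mulr1 mulrA -exprMn h exprMn.
set n : R := k%:R.
have E1 : (2 * k + 1)%:R = 2 * n + 1 by rewrite natrD natrM.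
have E2 : (2 * k.+1 + 1)%:R = 2 * n + 3 by rewrite natrD natrM -natr1 -/n; ring.
have E3 : (k + 1)%:R = n + 1 by rewrite natrD.
rewrite E1 in ih *; rewrite E2 E3; move: ih; set c := central k ^+ 2 => ih.
have n0 : 0 <= n by exact: ler0n.
have : c * (2 * n + 1) * ((2 * n + 1) * (2 * n + 3)) <= 1 * ((2 * n + 1) * (2 * n + 3)).
  by apply: ler_wpM2r => //; apply: mulr_ge0; lra.
nra.
Qed.

Lemma central_small (e : R) : 0 < e -> exists k, central k.+2 <= e.
Proof.
move=> e0; exists (Num.truncn (e ^- 2)).
set k := Num.truncn _.
have h : e ^- 2 < k.+1%:R by exact: truncnS_gt.
have e20 : 0 < e ^+ 2 by rewrite exprn_gt0.
rewrite leNgt; apply/negP => ec.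
have c0 := central_ge0 k.+2.
have := central_sq k.+2; apply/negP; rewrite -ltNge.
have : e ^+ 2 < central k.+2 ^+ 2 by rewrite ltr_pXn2r// nnegrE ltW.
have h2 : 1 < e ^+ 2 * (2 * k.+2 + 1)%:R.
  rewrite -ltr_pdivrMl// mulr1; apply: lt_le_trans h _.
  by rewrite ler_nat; apply: leq_trans (leq_addr _ _); apply: ltnW; rewrite leq_pmull.
move=> h3; apply: lt_trans h2 _.
by rewrite ltr_pM2r// ltr0n addn1.
Qed.

End binomial_smoothing.

(** * Polynomials in an operator *)

Section poly_operator.
Context {R : realType}.
Implicit Types (A : (R -> R) -> R -> R) (f u v : R -> R) (p q : {poly R}).

Definition pev A p f : R -> R := fun x => \sum_(i < size p) p`_i * iter i A f x.

Lemma pev_widen A p f n x : (size p <= n)%N ->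
  pev A p f x = \sum_(i < n) p`_i * iter i A f x.
Proof.
move=> pn; rewrite /pev (big_ord_widen n (fun i => p`_i * iter i A f x) pn).
rewrite [RHS](bigID (fun i : 'I_n => (i < size p)%N))/= [X in _ = _ + X]big1 ?addr0//.
by move=> i; rewrite -leqNgt => pi; rewrite nth_default// mul0r.
Qed.

Lemma pevD A p q f : pev A (p + q) f = (fun x => pev A p f x + pev A q f x).
Proof.
apply/funext => x.
rewrite (@pev_widen _ _ _ (maxn (size p) (size q)))//; last exact: size_polyD.
rewrite (@pev_widen _ p _ (maxn (size p) (size q))) ?leq_maxl//.
rewrite (@pev_widen _ q _ (maxn (size p) (size q))) ?leq_maxr//.
by rewrite -big_split/=; apply: eq_bigr => i _; rewrite coefD mulrDl.
Qed.

Lemma pevZ A c p f : pev A (c%:P * p) f = (fun x => c * pev A p f x).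
Proof.
apply/funext => x; rewrite mul_polyC (@pev_widen _ _ _ (size p)) ?size_scale_leq//.
by rewrite /pev mulr_sumr; apply: eq_bigr => i _; rewrite coefZ mulrA.
Qed.

Lemma pev1 A f : pev A 1 f = f.
Proof. by apply/funext => x; rewrite /pev size_poly1 big_ord1 coef1 eqxx mul1r. Qed.

Lemma pev0 A f : pev A 0 f = fun=> 0.
Proof. by apply/funext => x; rewrite /pev size_poly0 big_ord0. Qed.

Lemma pevC A c f : pev A c%:P f = (fun x => c * f x).
Proof. by rewrite -[c%:P]mulr1 pevZ pev1. Qed.

Lemma pevMX A p f : pev A (p * 'X) f = pev A p (A f).
Proof.
apply/funext => x; rewrite (@pev_widen _ _ _ (size p).+1); last first.
  by rewrite (leq_trans (size_polyMleq _ _))// size_polyX addn2.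
rewrite big_ord_recl coefMX eqxx mul0r add0r /pev; apply: eq_bigr => i _.
by rewrite coefMX/= -iterSr.
Qed.

Lemma pevX A f : pev A 'X f = A f.
Proof. by rewrite -['X]mul1r pevMX pev1. Qed.

(* A is linear only on a class K of functions, such as the elements of the
   lattice: integrals are additive only on integrable functions. *)
Variable K : (R -> R) -> Prop.
Variable A : (R -> R) -> R -> R.
Hypothesis KD : forall u v, K u -> K v -> K (fun x => u x + v x).
Hypothesis KZ : forall c u, K u -> K (fun x => c * u x).
Hypothesis KA : forall u, K u -> K (A u).
Hypothesis AD : forall u v, K u -> K v ->
  A (fun x => u x + v x) = (fun x => A u x + A v x).
Hypothesis AZ : forall c u, K u -> A (fun x => c * u x) = (fun x => c * A u x).

Lemma K_iter i u : K u -> K (iter i A u).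
Proof. by move=> Ku; elim: i => //= i; exact: KA. Qed.

Lemma K_pev p u : K u -> K (pev A p u).
Proof.
elim/poly_ind: p u => [|p c ih] u Ku.
  by rewrite pev0; have := KZ 0 Ku; congr K; apply/funext => x; rewrite mul0r.
by rewrite pevD pevMX pevC; apply: KD; [exact/ih/KA|exact: KZ].
Qed.

Lemma pev_add p u v : K u -> K v ->
  pev A p (fun x => u x + v x) = (fun x => pev A p u x + pev A p v x).
Proof.
elim/poly_ind: p u v => [|p c ih] u v Ku Kv.
  by rewrite !pev0; apply/funext => x; rewrite addr0.
rewrite !pevD !pevMX !pevC AD// ih; [|exact: KA|exact: KA].
by apply/funext => x; ring.
Qed.

Lemma pev_scale p c u : K u ->
  pev A p (fun x => c * u x) = (fun x => c * pev A p u x).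
Proof.
elim/poly_ind: p u => [|p d ih] u Ku.
  by rewrite !pev0; apply/funext => x; rewrite mulr0.
rewrite !pevD !pevMX !pevC AZ// ih; last exact: KA.
by apply/funext => x; ring.
Qed.

Lemma pevM p q u : K u -> pev A (p * q) u = pev A q (pev A p u).
Proof.
elim/poly_ind: p u => [|p c ih] u Ku.
  rewrite mul0r !pev0; have := pev_scale q 0 Ku.
  have -> : (fun x : R => 0 * u x) = (fun=> 0) by apply/funext => x; rewrite mul0r.
  by move=> ->; apply/funext => x; rewrite mul0r.
have -> : (p * 'X + c%:P) * q = p * q * 'X + c%:P * q.
  by rewrite mulrDl -!mulrA (mulrC 'X).
rewrite !pevD pevMX pevZ pevMX pevC ih; last exact: KA.
rewrite pev_add; [|exact/K_pev/KA|exact: KZ].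
by rewrite pev_scale.
Qed.

Lemma pevXn n u : K u -> pev A ('X ^+ n) u = iter n A u.
Proof.
elim: n => [|n ih] Ku; first by rewrite expr0 pev1.
by rewrite exprSr pevM// ih// pevX.
Qed.

Lemma pev_one_sub n u : K u ->
  pev A ((1 - 'X) ^+ n) u = iter_diff A n u.
Proof.
elim: n => [|n ih] Ku; first by rewrite expr0 pev1.
rewrite exprSr pevM// ih// pevD pev1.
have -> : - 'X = (-1)%:P * 'X :> {poly R} by rewrite polyCN mulN1r.
by rewrite pevZ pevX; apply/funext => x; rewrite mulN1r.
Qed.

End poly_operator.

(** * Iterated averages through half steps *)

Section key_pointwise.
Context {R : realType}.
Implicit Types (f u v w p : R -> R) (a b c h l : R).

Definition sh a u : R -> R := fun x => u (x + a).

(** Up to the factor [h], the derivative of the twice iterated average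
    ([dv_fav]). *)
Definition dl h u : R -> R := fun x => fav h u (x + h) - fav h u x.

Lemma fav_abs_le h u x : 0 < h -> CP u -> `|fav h u x| <= fav h (fun t => `|u t|) x.
Proof.
move=> h0 cu; rewrite /fav normrM normfV (gtr0_norm h0).
rewrite ler_pM2r ?invr_gt0//; apply: prim_abs; first exact: CP_locint.
by lra.
Qed.

(** Averaging with step [a] spreads the mass of [|v|] to the left by at most
    [a], and does not increase it. *)
Lemma prim_fav_abs_le a v y l : 0 < a -> 0 <= l -> CP v ->
  prim (fun t => `|fav a v t|) (y + l) - prim (fun t => `|fav a v t|) y <=
  prim (fun t => `|v t|) (y + l + a) - prim (fun t => `|v t|) y.
Proof.
move=> a0 l0 cv; have cva := CP_abs cv; have lva := CP_locint cva.
have cfv := CP_fav' a0 cv; have cfva := CP_fav' a0 cva.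
set P := prim (fun t => `|v t|).
have yl : y <= y + l by lra.
have h1 := prim_mono (CP_locint (CP_abs cfv)) (CP_locint cfva) yl
  (fun t _ => fav_abs_le t a0 cv).
apply: le_trans h1 _.
have dP : dv (prim P) P by apply: dv_prim; exact: prim_continuous.
rewrite (prim_dv _ _ (dv_scaled_diff a dP) cfva.1) -mulrBl ler_pdivrMr//.
(* The left-hand side is the increment of this function over [0, a]; as P
   increases, its derivative is at most P (y + l + a) - P y. *)
have dphi : dv (fun t => prim P (t + (y + l)) - prim P (t + y))
    (fun t => P (t + (y + l)) - P (t + y)).
  by apply: dvB; exact: dv_shift.
have := dv_le dphi (ltW a0) (M := P (y + l + a) - P y).
rewrite !add0r subr0 => hh.
have {}hh := le_trans (ler_norm _) (hh _).
apply: le_trans (hh _).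
  have e (A B D E : R) : A - B - (D - E) = A - D - (B - E) by ring.
  by rewrite (addrC a (y + l)) (addrC a y) e.
move=> t /andP[t0 ta].
have m b c : b <= c -> P b <= P c by move=> bc; apply: prim_ge0.
clear hh dphi dP; rewrite ger0_norm ?subr_ge0; last by apply: m; lra.
by apply: lerB; apply: m; lra.
Qed.

Lemma prim_iter_fav_abs_le j a v y l : 0 < a -> 0 <= l -> CP v ->
  prim (fun t => `|iter j (fav a) v t|) (y + l) -
    prim (fun t => `|iter j (fav a) v t|) y <=
  prim (fun t => `|v t|) (y + l + j%:R * a) - prim (fun t => `|v t|) y.
Proof.
move=> a0 l0; elim: j v => [|j ih] v cv; first by rewrite mul0r addr0.
rewrite iterSr; apply: le_trans (ih _ (CP_fav' a0 cv)) _.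
have e : y + l + j.+1%:R * a = y + (l + j%:R * a) + a by rewrite -natr1; ring.
rewrite e -(addrA y); apply: prim_fav_abs_le => //.
by rewrite addr_ge0// mulr_ge0// ltW.
Qed.

Lemma fav_le_prim a v y : 0 < a -> CP v ->
  `|fav a v y| <= a^-1 * (prim (fun t => `|v t|) (y + a) - prim (fun t => `|v t|) y).
Proof.
move=> a0 cv; apply: le_trans (fav_abs_le _ a0 cv) _.
by rewrite /fav mulrC.
Qed.

(** The intervals of the averages are adjacent, so that their integrals add up
    to one integral. *)
Lemma sum_fav_le n a v y : 0 < a -> CP v ->
  \sum_(i < n) `|fav a v (y + i%:R * a)| <=
  a^-1 * (prim (fun t => `|v t|) (y + n%:R * a) - prim (fun t => `|v t|) y).
Proof.
move=> a0 cv; elim: n => [|n ih]; first by rewrite big_ord0 mul0r addr0 subrr mulr0.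
rewrite big_ord_recr/=; apply: le_trans (lerD ih (fav_le_prim _ a0 cv)) _.
rewrite -mulrDr le_eqVlt; apply/orP; left; apply/eqP; congr (_ * _).
have -> : y + n%:R * a + a = y + n.+1%:R * a by rewrite -natr1; ring.
ring.
Qed.

Lemma iter_sh i a u x : iter i (sh a) u x = u (x + i%:R * a).
Proof.
elim: i x => [|i ih] x; first by rewrite mul0r addr0.
by rewrite /= /sh ih -natr1; congr u; ring.
Qed.

Lemma pev_sh_le a (q : {poly R}) n v y (M : R) : 0 < a -> CP v ->
  (size q <= n)%N -> (forall i, `|q`_i| <= M) ->
  `|pev (sh a) q (fav a v) y| <=
  M * (a^-1 * (prim (fun t => `|v t|) (y + n%:R * a) - prim (fun t => `|v t|) y)).
Proof.
move=> a0 cv qn hM; rewrite (pev_widen _ _ _ qn).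
have M0 : 0 <= M := le_trans (normr_ge0 _) (hM 0%N).
apply: le_trans (ler_norm_sum _ _ _) _.
apply: le_trans _ (ler_wpM2l M0 (sum_fav_le n y a0 cv)).
rewrite mulr_sumr; apply: ler_sum => i _.
by rewrite normrM iter_sh ler_wpM2r.
Qed.

Lemma pev_shM a (p q : {poly R}) u :
  pev (sh a) (p * q) u = pev (sh a) q (pev (sh a) p u).
Proof. exact: (@pevM _ (fun=> True)). Qed.

Lemma CP_pev_sh a (q : {poly R}) u : CP u -> CP (pev (sh a) q u).
Proof.
apply: K_pev; [exact: CPD|exact: CPZ|exact: CP_shift].
Qed.

Lemma fav_pev_sh h a (q : {poly R}) u : 0 < h -> CP u ->
  fav h (pev (sh a) q u) = pev (sh a) q (fav h u).
Proof.
move=> h0; elim/poly_ind: q u => [|q c ih] u cu.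
  rewrite !pev0; apply/funext => x.
  by have := favZ h 0 x (locint_cst (1 : R)); rewrite !mul0r.
rewrite !pevD !pevMX !pevC; apply/funext => x.
have lu := CP_locint cu; have cs : CP (sh a u) by exact: CP_shift.
rewrite favD ?favZ//; [|exact/CP_locint/CP_pev_sh|exact: locintZ].
congr (_ + _); rewrite ih//; congr (pev _ _ _ x).
by apply/funext => z; rewrite /sh fav_shift//; case: cu.
Qed.

(** The interval of length [h] is made of two halves. *)
Lemma fav_half h f : 0 < h ->
  fav h f = pev (sh (h / 2)) half_shift (fav (h / 2) f).
Proof.
move=> h0; apply/funext => x.
rewrite /half_shift pevZ pevD pev1 pevX /sh /fav.
have -> : x + h / 2 + h / 2 = x + h by field.
by field; rewrite gt_eqF.
Qed.

Lemma iter_fav_half n h p : 0 < h -> CP p ->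
  iter n (fav h) p =
  pev (sh (h / 2)) (half_shift ^+ n) (iter n (fav (h / 2)) p).
Proof.
move=> h0 cp; have a0 : 0 < h / 2 by lra.
have ci i : CP (iter i (fav (h / 2)) p).
  by apply: (@K_iter _ CP) => // u; exact: CP_fav'.
elim: n => [|n ih]; first by rewrite expr0 pev1.
rewrite iterS ih fav_half// fav_pev_sh// exprSr pev_shM.
by [].
Qed.

End key_pointwise.

(** * Controlling the shifted difference of an average *)

Section taylor.
Context {R : realType}.
Implicit Types (f u v w p : R -> R) (a b c h l : R) (G : nat -> R -> R).

(** Integrate [r (t) G'''(x + h t)], where [r (t) = t (t - 1)^2 / 3], by parts
    three times.  The weight is chosen so that the boundary terms contain no
    second derivative, and [G'] at the left end only. *)
Lemma taylor_remainder G h x (S : R) : 0 < h -> chain 3 G ->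
  (forall y, x <= y <= x + h -> `|G 3%N y| <= S) ->
  `|2 / 3 * (G 0%N (x + h) - G 0%N x) + h * G 1%N x / 3 +
     2 * (G 0%N x - fav h (G 0%N) x)| <= h ^+ 3 * S.
Proof.
move=> h0 [cG dG] hS; have hn : h != 0 by rewrite gt_eqF.
pose s y := (y - x) / h.
have ds : dv s (fun=> h^-1).
  apply: dv_ext (dvM (dvB dv_id (dv_cst x)) (dv_cst h^-1)) _ => y.
  by rewrite subr0 mul1r mulr0 addr0.
(* the weight r and its first two derivatives; the third one is 2 *)
pose r0 y := (s y * s y * s y - 2 * (s y * s y) + s y) / 3.
pose r1 y := (3 * (s y * s y) - 4 * s y + 1) / 3.
pose r2 y := (6 * s y - 4) / 3.
have d0 : dv r0 (fun y => r1 y / h).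
  have d2 := dvM ds ds; have d3 := dvM d2 ds.
  apply: dv_ext (dvM (dvD (dvB d3 (dvZ 2 d2)) ds) (dv_cst 3^-1)) _ => y.
  by rewrite /r1; set z := s y; field.
have d1 : dv r1 (fun y => r2 y / h).
  have d2 := dvM ds ds.
  apply: dv_ext (dvM (dvD (dvB (dvZ 3 d2) (dvZ 4 ds)) (dv_cst 1)) (dv_cst 3^-1)) _ => y.
  by rewrite /r2; set z := s y; field.
have d2 : dv r2 (fun=> 2 / h).
  apply: dv_ext (dvM (dvB (dvZ 6 ds) (dv_cst 4)) (dv_cst 3^-1)) _ => y.
  by field.
have cont0 : continuous (G 0%N) by case: (cG 0%N isT).
pose Psi y := h ^+ 2 * (r0 y * G 2%N y) - h * (r1 y * G 1%N y) + r2 y * G 0%N y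
  - 2 / h * prim (G 0%N) y.
have dPsi : dv Psi (fun y => h ^+ 2 * (r0 y * G 3%N y)).
  apply: dv_ext (dvB (dvD (dvB (dvZ (h ^+ 2) (dvM d0 (dG 2%N isT)))
    (dvZ h (dvM d1 (dG 1%N isT)))) (dvM d2 (dG 0%N isT)))
    (dvZ (2 / h) (dv_prim cont0))) _ => y.
  set A := r0 y; set B := r1 y; set D := r2 y.
  set E := G 0%N y; set F := G 1%N y; set H := G 2%N y; set I := G 3%N y.
  by field.
have xh : x <= x + h by lra.
have := dv_le dPsi xh (M := h ^+ 2 * S).
rewrite (addrC x h) addrK (addrC h x) => hh.
have -> : h ^+ 3 * S = h ^+ 2 * S * h by ring.
apply: le_trans (hh _).
  rewrite le_eqVlt; apply/orP; left; apply/eqP; congr `|_|.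
  rewrite /Psi /r0 /r1 /r2.
  have -> : s (x + h) = 1 by rewrite /s (addrC x) addrK divff.
  have -> : s x = 0 by rewrite /s subrr mul0r.
  rewrite /fav; set A := prim _ _; set B := prim _ _.
  set D := G 0%N (x + h); set E := G 1%N (x + h); set F := G 2%N (x + h).
  set H := G 0%N x; set I := G 1%N x; set J := G 2%N x.
  by field.
move=> y yxh; have S0 := le_trans (normr_ge0 _) (hS _ yxh).
rewrite normrM (ger0_norm (exprn_ge0 2 (ltW h0))).
apply: ler_wpM2l; first exact: exprn_ge0 (ltW h0).
rewrite normrM.
move: yxh (hS _ yxh) => /andP[xy yx] h1.
have s0 : 0 <= s y by rewrite divr_ge0 ?subr_ge0// ltW.
have s1 : s y <= 1 by rewrite ler_pdivrMr// mul1r lerBlDl.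
have r01 : `|r0 y| <= 1.
  rewrite /r0; move: s0 s1; set z := s y => z0 z1.
  have z2 : 0 <= z * z <= 1 by apply/andP; split; nra.
  have z3 : 0 <= z * z * z <= 1 by move/andP: z2 => [? ?]; apply/andP; split; nra.
  move/andP: z2 => [? ?]; move/andP: z3 => [? ?].
  by rewrite ler_norml; apply/andP; split; lra.
by rewrite -[leRHS]mul1r; apply: ler_pM.
Qed.

End taylor.

Section key.
Context {R : realType}.
Variables (X : banach_lattice R) (C : R).
Hypothesis hC : steklov_bound X C.
Notation nx := (bl_norm X).
Implicit Types (f u v w p : R -> R) (a b c h l : R) (G : nat -> R -> R).

Lemma CP_dl h u : X u -> 0 < h -> CP (dl h u).
Proof. by move=> Xu h0; apply: CPB; [apply: CP_shift|]; exact: X_CP_fav Xu h0. Qed.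

Lemma dlB h u v : locint u -> locint v ->
  dl h (fun x => u x - v x) = (fun x => dl h u x - dl h v x).
Proof. move=> lu lv; apply/funext => x; rewrite /dl !favB//.
have e (A B D E : R) : A - B - (D - E) = A - D - (B - E) by ring.
by rewrite e. Qed.

Lemma dl_fav h u : X u -> 0 < h -> fav h (dl h u) = dl h (fav h u).
Proof.
move=> Xu h0; have cu := X_CP_fav Xu h0; apply/funext => x.
rewrite /dl favB ?fav_shift//; first by case: cu.
- exact: CP_locint (CP_shift h cu).
- exact: CP_locint cu.
Qed.

Lemma nx_iter_fav n h u : X u -> 0 < h -> X (iter n (fav h) u) /\
  nx (iter n (fav h) u) <= (2 * C) ^+ n * nx u.
Proof.
move=> Xu h0; have C0 := steklov_bound_gt0 hC.
elim: n => [|n [Xn hn]]; first by rewrite expr0 mul1r.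
have [Xa ha] := nx_fav hC Xn h0; split => //=.
by rewrite exprS -mulrA; apply: le_trans ha _; rewrite ler_pM2l//; lra.
Qed.

Lemma iter_dl n h u : X u -> 0 < h ->
  iter n (fav h) (dl h u) = dl h (iter n (fav h) u).
Proof.
move=> Xu h0; elim: n => //= n ->; rewrite dl_fav//.
by have [] := nx_iter_fav n Xu h0.
Qed.

Lemma nx_dl h u : X u -> 0 < h -> X (dl h u) /\ nx (dl h u) <= 4 * C * nx u.
Proof.
move=> Xu h0; have lu := X_locint Xu.
have h2 : 0 < 2 * h by lra.
have hi : 0 <= h^-1 by rewrite invr_ge0 ltW.
have [] := nx_le_win hC (CP_circle (CP_dl Xu h0)) Xu h2 hi.
  move=> x; rewrite /dl /fav -mulrBl normrM normfV (gtr0_norm h0) mulrC.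
  apply: ler_wpM2l => //.
  apply: le_trans (ler_normB _ _) _.
  have x1 : x + h <= x + h + h by lra.
  have x2 : x <= x + h by lra.
  apply: le_trans (lerD (prim_abs lu x1) (prim_abs lu x2)) _.
  rewrite subrKA; apply: prim_win => //; lra.
move=> Xd hd; split => //; apply: le_trans hd _.
rewrite le_eqVlt; apply/orP; left; apply/eqP.
by field; rewrite gt_eqF.
Qed.

Lemma iter_fav_step n h u : X u -> 0 < h ->
  iter n (fav h) (fun x => u x - fav h u x) =
  (fun x => iter n (fav h) u x - iter n.+1 (fav h) u x).
Proof.
move=> Xu h0; elim: n => // n ih; rewrite iterS ih; apply/funext => x.
have [X1 _] := nx_iter_fav n Xu h0; have [X2 _] := nx_iter_fav n.+1 Xu h0.
by rewrite favB ?iterS//; [exact: X_locint X1|exact: X_locint X2].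
Qed.

Lemma iter_fav_sub n h p K : X p -> 0 < h -> 0 <= K ->
  nx (fun x => p x - fav h p x) <= K ->
  X (fun x => p x - iter n (fav h) p x) /\
  nx (fun x => p x - iter n (fav h) p x) <= (\sum_(i < n) (2 * C) ^+ i) * K.
Proof.
move=> Xp h0 K0 hK; have C0 := steklov_bound_gt0 hC.
elim: n => [|n [Xn hn]].
  rewrite big_ord0 mul0r /=; have -> : (fun x => p x - p x) = (fun=> 0).
    by apply/funext => x; rewrite subrr.
  by rewrite nx0; split => //; exact: bl_zero.
have Xd : X (fun x => p x - fav h p x) by apply: X_sub => //; have [] := nx_fav hC Xp h0.
have [Xi hi] := nx_iter_fav n Xd h0.
have -> : (fun x => p x - iter n.+1 (fav h) p x) =
  (fun x => (p x - iter n (fav h) p x) + iter n (fav h) (fun x => p x - fav h p x) x).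
  by apply/funext => x; rewrite iter_fav_step//; ring.
split; first exact: bl_add.
rewrite big_ord_recr/= mulrDl; apply: le_trans (nx_add Xn Xi) _.
apply: lerD => //; apply: le_trans hi _; apply: ler_wpM2l => //.
by rewrite exprn_ge0//; lra.
Qed.

Lemma size_second_diff k : (size (second_diff k : {poly R}) <= 2 * k + 3)%N.
Proof.
rewrite /second_diff -[X in (X <= _)%N]/(size _).
apply: leq_trans (size_polyMleq _ _) _.
have h1 : (size (('X - 1) ^+ 2 : {poly R}) <= 3)%N.
  apply: leq_trans (size_poly_exp_leq _ _) _.
  by rewrite -[1]/(1%:P) size_XsubC.
have h2 : (size (half_shift ^+ (2 * k) : {poly R}) <= (2 * k).+1)%N.
  apply: leq_trans (size_poly_exp_leq _ _) _.
  have : (size (half_shift : {poly R}) <= 2)%N.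
    rewrite /half_shift mul_polyC; apply: leq_trans (size_scale_leq _ _) _.
    by rewrite addrC -[1]/(1%:P) size_XaddC.
  case: (size _) => [|[|[|//]]] _ /=; rewrite ?muln0 ?mul0n//.
  by rewrite mul1n.
apply: (@leq_trans (3 + (2 * k).+1).-1).
  by rewrite -!subn1 leq_sub2r// leq_add.
by rewrite addnS /= addnC.
Qed.

(** The first derivative falls on a full-step average and produces [iter (2 *
    k.+2) (fav h) p].  Written through half steps, this is a weighted sum of
    shifts of [fav a (fav a (fav a v))] with [a = h / 2], and the other two
    derivatives fall on two of these averages, whose differences produce the
    factor [('X - 1) ^+ 2]. *)
Lemma iter_fav_chain k h f : X f -> 0 < h ->
  let p := dl h f in
  let v := iter (2 * k).+1 (fav (h / 2)) p in
  exists G, [/\ chain 3 G, G 0%N = iter (2 * k.+2).+2 (fav h) f,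
    (forall x, h * G 1%N x = iter (2 * k.+2) (fav h) p x) &
    forall x, h ^+ 3 * G 3%N x =
      4 * pev (sh (h / 2)) (second_diff k.+2) (fav (h / 2) v) x].
Proof.
move=> Xf h0 p v; set a := h / 2.
have a0 : 0 < a by rewrite /a; lra.
have hn : h != 0 by rewrite gt_eqF.
have an : a != 0 by rewrite gt_eqF.
have cp : CP p by exact: CP_dl.
have ci i : CP (iter i (fav a) p).
  by apply: (@K_iter _ CP) => // u; exact: CP_fav'.
have cv : CP v := ci _.
pose N := (2 * k.+2)%N.
pose q0 := pev (sh a) (half_shift ^+ N) (fav a v).
have cq : CP q0 by apply: CP_pev_sh; exact: CP_fav'.
have eN : iter N (fav h) p = fav a (fav a q0).
  rewrite (iter_fav_half N h0 cp) -/a.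
  have -> : iter N (fav a) p = fav a (fav a (fav a v)).
    by rewrite /N !mulnS !add2n.
  have cbv : CP (fav a v) by exact: CP_fav'.
  rewrite -(fav_pev_sh _ _ a0 (CP_fav' a0 cbv)).
  by rewrite -(fav_pev_sh _ _ a0 cbv).
pose w1 := fav a q0.
pose w2 x := (q0 (x + a) - q0 x) / a.
have dw1 : dv w1 w2 by apply: dv_fav; case: cq.
have cw1 : CP w1 by exact: CP_fav'.
have cw2 : CP w2.
  have := CPZ a^-1 (CPB (CP_shift a cq) cq).
  by congr CP; apply/funext => x; rewrite mulrC.
pose G (i : nat) : R -> R := match i with
  | 0%N => iter N.+2 (fav h) f
  | 1%N => fun x => h^-1 * fav a w1 x
  | 2%N => fun x => h^-1 * ((w1 (x + a) - w1 x) / a)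
  | _ => fun x => h^-1 * ((w2 (x + a) - w2 x) / a)
  end.
have cd u : CP u -> CP (fun x => h^-1 * ((u (x + a) - u x) / a)).
  move=> cu; apply: CPZ; have := CPZ a^-1 (CPB (CP_shift a cu) cu).
  by congr CP; apply/funext => x; rewrite mulrC.
have [Xy _] := nx_iter_fav N Xf h0.
have cy := X_CP_fav Xy h0.
exists G; split => //.
- split.
    case=> [|[|[|[|//]]]] _ /=; last 2 first.
    + exact: cd.
    + exact: cd.
    + by apply: CP_fav' => //; apply: CP_fav'.
    + by apply: CPZ; apply: CP_fav'.
  case=> [|[|[|//]]] _ /=; last 2 first.
  + by apply: dvZ; apply: dv_fav; case: cw1.
  + by apply: dvZ; exact: dv_scaled_diff.
  apply: dv_ext (dv_fav h cy.1) _ => x.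
  by rewrite -eN iter_dl// mulrC.
- by move=> x; rewrite /= mulrA divff// mul1r /w1 -eN.
- move=> x; rewrite /= /w2.
  have eq2 u : pev (sh a) ('X - 1) u = (fun x => u (x + a) - u x).
    have -> : - 1 = (-1)%:P :> {poly R} by rewrite polyCN.
    by rewrite pevD pevX pevC; apply/funext => y; rewrite mulN1r.
  have e2 : second_diff k.+2 = half_shift ^+ N * (('X - 1) * ('X - 1)) :> {poly R}.
    by rewrite /second_diff mulrC expr2.
  rewrite e2 (pev_shM a (half_shift ^+ N)) -/a -/q0 (pev_shM a ('X - 1)) !eq2 /=.
  set A := q0 (x + a + a); set B := q0 (x + a); set D := q0 x.
  by rewrite /a; field.
Qed.

(** The remainder of the Taylor formula, estimated by the size of the
    coefficients ([second_diff_le]); the radius of the window covers all the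
    half-step averages involved. *)
Lemma iter_fav_taylor k h f x (G : nat -> R -> R) :
  let p := dl h f in
  let v := iter (2 * k).+1 (fav (h / 2)) p in
  X f -> 0 < h -> chain 3 G ->
  (forall x, h ^+ 3 * G 3%N x =
      4 * pev (sh (h / 2)) (second_diff k.+2) (fav (h / 2) v) x) ->
  `|2 / 3 * (G 0%N (x + h) - G 0%N x) + h * G 1%N x / 3 +
     2 * (G 0%N x - fav h (G 0%N) x)| <=
  16 * central k.+2 / k.+3%:R / h * win ((4 * k + 10)%:R * (h / 2)) p x.
Proof.
move=> p v Xf h0 cG e3; set a := h / 2.
have a0 : 0 < a by rewrite /a; lra.
have hn : h != 0 by rewrite gt_eqF.
have cp : CP p by exact: CP_dl.
have cv : CP v by apply: (@K_iter _ CP) => // u; exact: CP_fav'.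
have lp := CP_locint cp.
set W := win _ p x.
pose M : R := 2 * central k.+2 / k.+3%:R.
have M0 : 0 <= M by rewrite divr_ge0// mulr_ge0// central_ge0.
have bound y : x <= y <= x + h -> `|G 3%N y| <= h ^- 3 * (4 * (M * (a^-1 * W))).
  move=> /andP[xy yx].
  have h3 : 0 < h ^+ 3 by rewrite exprn_gt0.
  rewrite ler_pdivlMl//.
  rewrite -{1}(gtr0_norm h3) -normrM e3 normrM ger0_norm// ler_pM2l//.
  apply: le_trans (pev_sh_le y a0 cv (size_second_diff _) (second_diff_le _)) _.
  rewrite -/M; apply: ler_wpM2l => //; apply: ler_wpM2l; first by rewrite invr_ge0 ltW.
  have l0 : 0 <= (2 * k.+2 + 3)%:R * a by rewrite mulr_ge0// ltW.
  apply: le_trans (prim_iter_fav_abs_le (2 * k).+1 y a0 l0 cp) _.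
  have -> : y + (2 * k.+2 + 3)%:R * a + (2 * k).+1%:R * a = y + (4 * k + 8)%:R * a.
    by rewrite -addrA -mulrDl -natrD; congr (_ + _%:R * _); lia.
  have e10 : (4 * k + 10)%:R * a = (4 * k + 8)%:R * a + 2 * a.
    by rewrite -mulrDl -natrD; congr (_%:R * _); lia.
  have n8 : 0 <= (4 * k + 8)%:R * a by rewrite mulr_ge0// ltW.
  have ha : h = 2 * a by rewrite /a; field.
  by rewrite /W -/a e10; apply: prim_win => //; lra.
apply: le_trans (taylor_remainder h0 cG bound) _.
rewrite le_eqVlt; apply/orP; left; apply/eqP; rewrite /M /a.
have fin (c n w : R) : n != 0 ->
    h ^+ 3 * (h ^- 3 * (4 * (2 * c / n * ((h / 2)^-1 * w)))) = 16 * c / n / h * w.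
  by move=> nn; field; rewrite hn nn.
by apply: fin; rewrite pnatr_eq0.
Qed.

End key.

Section nx_dl_le.
Context {R : realType}.
Variables (X : banach_lattice R) (C : R).
Hypothesis hC : steklov_bound X C.
Notation nx := (bl_norm X).
Implicit Types (f u v w p : R -> R) (a b c h l : R).

(** With [p = dl h f] and [w = f - fav h f], the quantity bounded in
    [iter_fav_taylor] is [iter N (fav h) p], up to powers of the average
    applied to [dl h w] and [w]; and [p - iter N (fav h) p] is bounded by
    means of [p - fav h p = dl h w].  The radius of the window in
    [iter_fav_taylor] grows like [k] and is compensated by the factor
    [k.+3%:R^-1], so by the hypothesis on [central] that quantity has norm at
    most half that of [p], and moves to the left-hand side. *)
Lemma nx_dl_absorb k N h f : N = (2 * k.+2)%N -> X f -> 0 < h ->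
  128 * C * central k.+2 <= 1 ->
  nx (dl h f) <= 2 * ((\sum_(i < N) (2 * C) ^+ i) * (4 * C) +
     (2 * C) ^+ N * (4 * C) + 2 * (2 * C) ^+ N.+2) *
     nx (fun x => f x - fav h f x).
Proof.
move=> eN Xf h0 hk; have C0 := steklov_bound_gt0 hC.
set p := dl h f; set w := fun x => f x - fav h f x.
have Xw : X w by apply: X_sub => //; have [] := nx_fav hC Xf h0.
have [Xp _] : X p /\ _ := nx_dl hC Xf h0.
have [Xdw hdw] := nx_dl hC Xw h0.
have ep : (fun x => p x - fav h p x) = dl h w.
  have [Xa _] := nx_fav hC Xf h0.
  by rewrite /p (dl_fav Xf h0) dlB//; [exact: X_locint Xf|exact: X_locint Xa].
have K00 : 0 <= 4 * C * nx w by rewrite mulr_ge0 ?bl_norm_ge0//; lra.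
have [Xs hs] : X (fun x => p x - iter N (fav h) p x) /\
    nx (fun x => p x - iter N (fav h) p x) <= (\sum_(i < N) (2 * C) ^+ i) * (4 * C * nx w).
  by apply: (iter_fav_sub hC) => //; rewrite ep.
have [X1 h1] := nx_iter_fav hC N Xdw h0.
have [X2 h2] := nx_iter_fav hC N.+2 Xw h0.
have [G [cG e0 e1 e3]] := iter_fav_chain hC k Xf h0.
rewrite -eN in e0 e1.
pose T x := 2 / 3 * (G 0%N (x + h) - G 0%N x) + h * G 1%N x / 3 +
     2 * (G 0%N x - fav h (G 0%N) x).
have cT : CP T.
  have c0 := cG.1 0%N isT; have c1 := cG.1 1%N isT.
  apply: CPD; last by apply: CPZ; apply: CPB => //; exact: CP_fav'.
  apply: CPD; first by apply: CPZ; apply: CPB => //; exact: CP_shift.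
  by apply: CPM; [exact: CPZ|exact: CP_cst].
have hT x := iter_fav_taylor x Xf h0 cG e3.
set c := 16 * central k.+2 / k.+3%:R / h in hT.
have c0 : 0 <= c.
  by rewrite /c !divr_ge0// ?mulr_ge0// ?central_ge0// ltW.
have a0 : 0 < (4 * k + 10)%:R * (h / 2) by apply: mulr_gt0; [rewrite ltr0n addn_gt0 orbT|lra].
have [XT nT] := nx_le_win hC (CP_circle cT) Xp a0 c0 hT.
have nT2 : nx T <= 2^-1 * nx p.
  apply: le_trans nT _; rewrite /c.
  have nk : (4 * k + 10 <= 4 * k.+3)%N by clear; lia.
  have en : (4 * k + 10)%:R <= 4 * k.+3%:R :> R by rewrite -natrM ler_nat.
  have n0 : 0 < k.+3%:R :> R by rewrite ltr0n.
  have fin (cn n m y : R) : n != 0 ->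
      16 * cn / n / h * (2 * (m * (h / 2)) * C * y) = 16 * cn * C * m / n * y.
    by move=> nn; field; rewrite nn gt_eqF.
  rewrite fin ?gt_eqF//; apply: ler_wpM2r; first exact: bl_norm_ge0.
  rewrite ler_pdivrMr//.
  have q0 : 0 <= 16 * central k.+2 * C.
    by apply: mulr_ge0; [apply: mulr_ge0 => //; exact: central_ge0|exact: ltW].
  apply: le_trans (ler_wpM2l q0 en) _.
  have -> : 16 * central k.+2 * C * (4 * k.+3%:R) =
    2^-1 * (128 * C * central k.+2) * k.+3%:R by field.
  by apply: ler_wpM2r; [exact: ltW|rewrite -[leRHS]mulr1; apply: ler_wpM2l].
have eT x : iter N (fav h) p x =
    T x + 2 / 3 * iter N (fav h) (dl h w) x - 2 * iter N.+2 (fav h) w x.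
  rewrite -ep (iter_fav_step hC)// /w (iter_fav_step hC)//.
  rewrite /T e1 e0.
  have -> : iter N.+2 (fav h) f (x + h) - iter N.+2 (fav h) f x = iter N.+1 (fav h) p x.
    by rewrite /p (iter_dl hC _ Xf h0).
    have -> : fav h (iter N.+2 (fav h) f) x = iter N.+3 (fav h) f x by [].
  move: (iter N _ p x) (iter N.+1 _ p x) (iter N.+2 _ f x) (iter N.+3 _ f x) => A B D E.
  by field.
have ep2 : p = (fun x => ((p x - iter N (fav h) p x) + T x) +
    (2 / 3 * iter N (fav h) (dl h w) x + (-2) * iter N.+2 (fav h) w x)).
  apply/funext => x; rewrite eT.
  by move: (p x) (T x) (iter N _ _ x) (iter N.+2 _ _ x) => A B D E; ring.
have Xz1 := bl_scale (2 / 3) X1; have Xz2 := bl_scale (-2) X2.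
have main : nx p <= (nx (fun x => p x - iter N (fav h) p x) + nx T) +
   (2 / 3 * nx (iter N (fav h) (dl h w)) + 2 * nx (iter N.+2 (fav h) w)).
  rewrite {1}ep2; apply: le_trans (nx_add (bl_add Xs XT) (bl_add Xz1 Xz2)) _.
  apply: lerD; first exact: nx_add.
  apply: le_trans (nx_add Xz1 Xz2) _.
  by rewrite !bl_norm_scale// normrN !ger0_norm.
have hdw' : nx (iter N (fav h) (dl h w)) <= (2 * C) ^+ N * (4 * C * nx w).
  by apply: le_trans h1 _; apply: ler_wpM2l => //; rewrite exprn_ge0//; lra.
have n1 : 0 <= nx (iter N (fav h) (dl h w)) by exact: bl_norm_ge0.
move: main hs nT2 hdw' h2 n1.
set A := nx p; set B := nx (fun x => _); set D := nx T; set E := nx (iter N _ _).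
set F := nx (iter N.+2 _ _); set S := \sum_(i < N) _; set P := (2 * C) ^+ N.
set Q := (2 * C) ^+ N.+2; set W := nx w.
move=> m1 m2 m3 m4 m5 m6.
have -> : 2 * (S * (4 * C) + P * (4 * C) + 2 * Q) * W =
  2 * (S * (4 * C * W) + P * (4 * C * W) + 2 * (Q * W)) by ring.
move: m2 m4 m5; move: (S * _) (P * _) (Q * _) => a1 a2 a3 m2 m4 m5.
clear -m1 m2 m3 m4 m5 m6; lra.
Qed.

(** The hypothesis of [nx_dl_absorb] holds for large [k] because the central
    binomial coefficients are [o (4 ^ k)]. *)
Theorem nx_dl_le : exists2 K, 0 < K & forall h f, X f -> 0 < h ->
  nx (dl h f) <= K * nx (fun x => f x - fav h f x).
Proof.
have C0 := steklov_bound_gt0 hC.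
have e0 : 0 < (128 * C)^-1 by rewrite invr_gt0; lra.
have [k hk] := central_small e0.
pose N := (2 * k.+2)%N.
exists (2 * ((\sum_(i < N) (2 * C) ^+ i) * (4 * C) +
     (2 * C) ^+ N * (4 * C) + 2 * (2 * C) ^+ N.+2)).
  have p0 i : 0 < (2 * C) ^+ i by rewrite exprn_gt0//; lra.
  have s0 : 0 <= \sum_(i < N) (2 * C) ^+ i by apply: sumr_ge0 => i _; exact: ltW.
  have := p0 N; have := p0 N.+2; move: s0.
  move: (\sum_(i < N) _) ((2 * C) ^+ N) ((2 * C) ^+ N.+2) => s a b s0 b0 a0.
  nra.
move=> h f Xf h0; apply: nx_dl_absorb => //.
have c0 : 0 < 128 * C by lra.
by rewrite -ler_pdivlMl// mulr1.
Qed.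

End nx_dl_le.

(** * Smooth approximation *)

Section smooth_approximation.
Context {R : realType}.
Variables (X : banach_lattice R) (C : R).
Hypothesis hC : steklov_bound X C.
Notation nx := (bl_norm X).
Implicit Types (f u v w p : R -> R) (a b c h l : R).

Lemma X_favD h u v : X u -> X v ->
  fav h (fun x => u x + v x) = (fun x => fav h u x + fav h v x).
Proof.
by move=> Xu Xv; apply/funext => x; apply: favD; [exact: X_locint Xu|exact: X_locint Xv].
Qed.

Lemma X_favZ h c u : X u -> fav h (fun x => c * u x) = (fun x => c * fav h u x).
Proof. by move=> Xu; apply/funext => x; apply: favZ; exact: X_locint Xu. Qed.

Section pev_fav.
Variable h : R.
Hypothesis h0 : 0 < h.

Let XA u : X u -> X (fav h u). Proof. by move=> Xu; have [] := nx_fav hC Xu h0. Qed.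

Lemma X_pev (q : {poly R}) u : X u -> X (pev (fav h) q u).
Proof.
by apply: (@K_pev _ X) => // *; [exact: bl_add|exact: bl_scale].
Qed.

Lemma pev_favM (q r : {poly R}) u : X u ->
  pev (fav h) (q * r) u = pev (fav h) r (pev (fav h) q u).
Proof.
apply: (@pevM _ X) => // *;
  [exact: bl_add|exact: bl_scale|exact: X_favD|exact: X_favZ].
Qed.

Lemma pev_fav_iter n u : X u -> pev (fav h) ('X ^+ n) u = iter n (fav h) u.
Proof.
apply: (@pevXn _ X) => // *;
  [exact: bl_add|exact: bl_scale|exact: X_favD|exact: X_favZ].
Qed.

Lemma pev_fav_one_sub n u : X u ->
  pev (fav h) ((1 - 'X) ^+ n) u = iter_diff (fav h) n u.
Proof.
apply: (@pev_one_sub _ X) => // *;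
  [exact: bl_add|exact: bl_scale|exact: X_favD|exact: X_favZ].
Qed.

(** A bound for the norm of the polynomial in [fav h], uniform in [h]. *)
Definition pev_const (q : {poly R}) : R := \sum_(i < size q) `|q`_i| * (2 * C) ^+ i.

Lemma pev_const_ge0 q : 0 <= pev_const q.
Proof.
apply: sumr_ge0 => i _; apply: mulr_ge0 => //; apply: exprn_ge0.
by have := steklov_bound_gt0 hC; lra.
Qed.

Lemma nx_pev (q : {poly R}) u : X u ->
  nx (pev (fav h) q u) <= pev_const q * nx u.
Proof.
move=> Xu; have := @nx_sum _ X (size q) (fun i x => q`_i * iter i (fav h) u x).
have Xi i := nx_iter_fav hC i Xu h0.
move=> [i _|_ h1]; first by apply: bl_scale; have [] := Xi i.
apply: le_trans h1 _; rewrite mulr_suml; apply: ler_sum => i _.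
have [X1 h2] := Xi i.
by rewrite bl_norm_scale// -mulrA; apply: ler_wpM2l.
Qed.

Lemma X_iter_diff n u : X u -> X (iter_diff (fav h) n u).
Proof. by move=> Xu; rewrite -pev_fav_one_sub//; exact: X_pev. Qed.

Lemma X_dl_mem u : X u -> X (dl h u).
Proof. by move=> Xu; have [] := nx_dl hC Xu h0. Qed.

Lemma X_iter_dl n u : X u -> X (iter n (dl h) u).
Proof. by move=> Xu; elim: n => //= n; exact: X_dl_mem. Qed.

Lemma iter_diff_dl n u : X u ->
  iter_diff (fav h) n (dl h u) = dl h (iter_diff (fav h) n u).
Proof.
move=> Xu; elim: n => // n ih; rewrite !iter_diffS ih.
have Xn := X_iter_diff n Xu.
rewrite dlB; [|exact: X_locint Xn|exact: X_locint (XA Xn)].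
by rewrite (dl_fav Xn h0).
Qed.

Lemma nx_iter_dl K n u : 0 < K ->
  (forall f, X f -> nx (dl h f) <= K * nx (fun x => f x - fav h f x)) ->
  X u -> nx (iter n (dl h) u) <= K ^+ n * nx (iter_diff (fav h) n u).
Proof.
move=> K0 hK; elim: n u => [|n ih] u Xu; first by rewrite expr0 mul1r.
rewrite iterSr; apply: le_trans (ih _ (X_dl_mem Xu)) _.
rewrite iter_diff_dl// exprSr -mulrA; apply: ler_wpM2l; first exact: exprn_ge0 (ltW K0).
exact: hK (X_iter_diff n Xu).
Qed.

End pev_fav.

Definition approx_poly (s : nat) : {poly R} :=
  (\sum_(i < s) (1 - 'X) ^+ i) ^+ (2 * s).

Definition error_poly (s : nat) : {poly R} :=
  \sum_(j < 2 * s) (1 - (1 - 'X) ^+ s) ^+ j.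

(** With [y = 1 - 'X] the first product is [(1 - y ^+ s) ^+ (2 * s)], and [1 -
    y ^+ s] and [y ^+ s] have sum 1. *)
Lemma approx_polyE s :
  approx_poly s * 'X ^+ (2 * s) + (1 - 'X) ^+ s * error_poly s = 1.
Proof.
rewrite /approx_poly -exprMn; set y := 1 - 'X.
have e1 : (\sum_(i < s) y ^+ i) * 'X = 1 - y ^+ s.
  have -> : 'X = - (y - 1) by rewrite /y; ring.
  by rewrite mulrN mulrC -subrX1 opprB.
rewrite e1 /error_poly -/y; set z := 1 - y ^+ s.
have -> : y ^+ s = - (z - 1) by rewrite /z; ring.
by rewrite mulNr -subrX1; ring.
Qed.

(** The approximant is [A^(2 s) P(A) f] with [A = fav h] and [P = approx_poly
    s].  A derivative turns two of the averages into [dl h], up to the factor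
    [h^-1], so the [s]-th derivative is [h^-s] times [dl h] iterated [s]
    times, to which [nx_dl_le] applies [s] times. *)
Theorem smooth_approx s : (0 < s)%N -> exists2 K, 0 < K &
  forall h f, X f -> 0 < h -> exists G, [/\ chain s G,
    nx (fun x => f x - G 0%N x) <= K * nx (iter_diff (fav h) s f) &
    h ^+ s * nx (G s) <= K * nx (iter_diff (fav h) s f)].
Proof.
move=> s0; have [K K0 hK] := nx_dl_le hC.
have C0 := steklov_bound_gt0 hC.
have c1 := pev_const_ge0 (approx_poly s); have c2 := pev_const_ge0 (error_poly s).
have Ks : 0 < K ^+ s by rewrite exprn_gt0.
pose K' := K ^+ s * pev_const (approx_poly s) + pev_const (error_poly s) + 1.
have k1 : K ^+ s * pev_const (approx_poly s) <= K'.
  by rewrite /K'; lra.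
have k2 : pev_const (error_poly s) <= K'.
  by rewrite /K'; have := mulr_ge0 (ltW Ks) c1; lra.
exists K'.
  by rewrite /K'; have := mulr_ge0 (ltW Ks) c1; lra.
move=> h f Xf h0; set om := nx _.
have om0 : 0 <= om by apply: bl_norm_ge0; exact: X_iter_diff.
pose f1 := pev (fav h) (approx_poly s) f.
have Xf1 : X f1 by exact: X_pev.
have XA u : X u -> X (fav h u) by move=> Xu; have [] := nx_fav hC Xu h0.
pose G i x := h ^- i * iter (2 * (s - i)) (fav h) (iter i (dl h) f1) x.
exists G; split.
- split=> i si.
    apply: CPZ; move: si; rewrite leq_eqVlt => /predU1P[->|si].
      rewrite subnn muln0/= -(prednK s0) iterS; apply: CP_dl => //.
      exact: X_iter_dl.
    rewrite -(subnSK si) mulnS iterD/=.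
    have [Xz _] := nx_iter_fav hC (2 * (s - i.+1)) (X_iter_dl h0 i Xf1) h0.
    apply: (CP_fav' h0); exact: (X_CP_fav Xz h0).
  rewrite /G -(subnSK si) mulnS iterD/=.
  set z := iter (2 * (s - i.+1)) _ _.
  have [Xz _] : X z /\ _ := nx_iter_fav hC (2 * (s - i.+1)) (X_iter_dl h0 i Xf1) h0.
  have cz := X_CP_fav Xz h0.
  apply: dv_ext (dvZ (h ^- i) (dv_fav h cz.1)) _ => x.
  rewrite (iter_dl hC _ (X_iter_dl h0 i Xf1) h0) -/z exprSr invfM.
  by rewrite -/(dl h z x) mulrA mulrAC.
- have -> : (fun x => f x - G 0%N x) =
      pev (fav h) (error_poly s) (iter_diff (fav h) s f).
    apply/funext => x.
    have := pevD (fav h) (approx_poly s * 'X ^+ (2 * s))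
      ((1 - 'X) ^+ s * error_poly s) f.
    rewrite approx_polyE pev1 !pev_favM// pev_fav_one_sub// pev_fav_iter//.
    move=> /(congr1 (fun g => g x)) ->.
    by rewrite /G subn0 expr0 invr1 mul1r -/f1 addrC addKr.
  apply: le_trans (nx_pev h0 _ (X_iter_diff h0 s Xf)) _.
  exact: ler_wpM2r.
- have -> : h ^+ s * nx (G s) = nx (iter s (dl h) f1).
    rewrite /G subnn muln0/= bl_norm_scale; last exact: X_iter_dl.
    rewrite ger0_norm ?invr_ge0 ?exprn_ge0 ?ltW//.
    by rewrite mulrA divff ?mul1r// expf_neq0// gt_eqF.
  apply: le_trans (nx_iter_dl h0 s K0 (fun f Xf => hK h f Xf h0) Xf1) _.
  have -> : iter_diff (fav h) s f1 =
      pev (fav h) (approx_poly s) (iter_diff (fav h) s f).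
    rewrite -!pev_fav_one_sub// /f1 -!pev_favM//; congr (pev _ _ f).
    exact: mulrC.
  apply: le_trans (ler_wpM2l (ltW Ks) (nx_pev h0 _ (X_iter_diff h0 s Xf))) _.
  by rewrite mulrA; exact: ler_wpM2r.
Qed.

End smooth_approximation.

(** * Integrals of continuous functions *)

Section circle_integral.
Context {R : realType}.
Implicit Types (f u v w F G : R -> R) (a b c x : R).

Definition cint a b F : R := prim F b - prim F a.
Definition intp F : R := cint (- pi) pi F.

Lemma cint_dv a b u v : dv u v -> continuous v -> cint a b v = u b - u a.
Proof. by move=> d cv; rewrite /cint (prim_dv _ _ d cv). Qed.

Lemma cintD a b F G : continuous F -> continuous G ->
  cint a b (fun t => F t + G t) = cint a b F + cint a b G.
Proof.
move=> cF cG.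
rewrite (cint_dv _ _ (dvD (dv_prim cF) (dv_prim cG)) (contD cF cG)) /cint /=.
by rewrite opprD addrACA.
Qed.

Lemma cintZ a b c F : continuous F -> cint a b (fun t => c * F t) = c * cint a b F.
Proof.
move=> cF; rewrite (cint_dv _ _ (dvZ c (dv_prim cF)) (contZ cF)) /cint.
by rewrite /= mulrBr.
Qed.

Lemma cintB a b F G : continuous F -> continuous G ->
  cint a b (fun t => F t - G t) = cint a b F - cint a b G.
Proof.
move=> cF cG.
rewrite (cint_dv _ _ (dvB (dv_prim cF) (dv_prim cG)) (contB cF cG)) /cint /=.
by rewrite !opprD addrACA.
Qed.

Lemma cont_sum (n : nat) (F : nat -> R -> R) : (forall i, continuous (F i)) ->
  continuous (fun t => \sum_(i < n) F i t).
Proof.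
move=> cF; elim: n => [|n ih].
  have -> : (fun t => \sum_(i < 0) F i t) = (fun=> 0).
    by apply/funext => t; rewrite big_ord0.
  exact: cont_cst.
have -> : (fun t => \sum_(i < n.+1) F i t) = (fun t => \sum_(i < n) F i t + F n t).
  by apply/funext => t; rewrite big_ord_recr.
exact: contD ih (cF n).
Qed.

Lemma cint_sum a b (n : nat) (F : nat -> R -> R) : (forall i, continuous (F i)) ->
  cint a b (fun t => \sum_(i < n) F i t) = \sum_(i < n) cint a b (F i).
Proof.
move=> cF; elim: n => [|n ih].
  rewrite big_ord0; have -> : (fun t => \sum_(i < 0) F i t) = (fun=> 0).
    by apply/funext => t; rewrite big_ord0.
  by have := cintZ a b 0 (@cont_cst R 0); rewrite !mul0r.
rewrite big_ord_recr/= -ih -cintD//; last exact: cont_sum.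
by congr cint; apply/funext => t; rewrite big_ord_recr.
Qed.

Lemma cint_shift a b c F : continuous F ->
  cint a b (fun t => F (t + c)) = cint (a + c) (b + c) F.
Proof.
by move=> cF; rewrite (cint_dv _ _ (dv_shift c (dv_prim cF)) (cont_shift cF)).
Qed.

Lemma cint_le a b F G : continuous F -> continuous G -> a <= b ->
  (forall t, a <= t <= b -> F t <= G t) -> cint a b F <= cint a b G.
Proof.
by move=> cF cG ab h; apply: prim_mono => //; exact: locint_continuous.
Qed.

Lemma cint_abs a b F : continuous F -> a <= b ->
  `|cint a b F| <= cint a b (fun t => `|F t|).
Proof. by move=> cF ab; apply: prim_abs => //; exact: locint_continuous. Qed.

Lemma cint_cst a b c : a <= b -> cint a b (fun=> c) = c * (b - a).
Proof. exact: prim_cst. Qed.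

Lemma cint_split a b c F : cint a c F = cint a b F + cint b c F.
Proof. by rewrite /cint [RHS]addrC subrKA. Qed.

Lemma cint_ge0 a b F : continuous F -> (forall t, 0 <= F t) -> a <= b ->
  0 <= cint a b F.
Proof.
move=> cF F0 ab; rewrite subr_ge0; apply: prim_ge0 => //.
exact: locint_continuous.
Qed.

Lemma winC a u x : continuous u -> win a u x = cint (- a) a (fun t => `|u (x + t)|).
Proof.
move=> cu.
have -> : (fun t => `|u (x + t)|) = (fun t => `|u (t + x)|).
  by apply/funext => t; rewrite addrC.
have := @cint_shift (- a) a x _ (continuous_abs cu) => /= ->.
by rewrite /cint /win (addrC a) (addrC (- a)).
Qed.

Lemma intp_shift F c : CP F -> intp (fun t => F (t + c)) = intp F.
Proof.
move=> [cF pF]; rewrite /intp cint_shift//.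
have d := dvB (dv_shift pi (dv_prim cF)) (dv_shift (- pi) (dv_prim cF)).
have d0 : dv (fun x => prim F (x + pi) - prim F (x - pi)) (fun=> 0).
  apply: dv_ext d _ => x; apply/eqP; rewrite subr_eq0; apply/eqP.
  have e (y z : R) : y + z = y - z + z *+ 2 by rewrite mulr2n; ring.
  rewrite (e x).
  by rewrite pF.
have := dv_inj c 0 d0 (dv_cst 0); rewrite subrr /cint.
rewrite !add0r (addrC (- pi) c) (addrC pi c).
by move=> /eqP; rewrite subr_eq0 => /eqP.
Qed.

Lemma intp_deriv u v : dv u v -> CP u -> CP v -> intp v = 0.
Proof.
move=> d [_ pu] [cv _]; rewrite /intp (cint_dv _ _ d cv).
have e (z : R) : z = - z + z *+ 2 by rewrite mulr2n; ring.
by rewrite {1}(e pi) pu subrr.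
Qed.

End circle_integral.

(** * Trigonometric polynomials *)

Section trigonometric_polynomials.
Context {R : realType}.
Implicit Types (f u v w F G K T : R -> R) (a b c x t : R).

Lemma dv_sin : dv (@sin R) (@cos R). Proof. by move=> x; exact: is_derive_sin. Qed.

Lemma dv_cos : dv (@cos R) (fun x => - sin x).
Proof. by move=> x; exact: is_derive_cos. Qed.

Lemma dv_cos_lin c a : dv (fun x => cos (c * x + a)) (fun x => - c * sin (c * x + a)).
Proof.
have dl : dv (fun x => c * x + a) (fun=> c).
  by apply: dv_ext (dvD (dvZ c dv_id) (dv_cst a)) _ => x; rewrite mulr1 addr0.
by apply: dv_ext (dv_comp dv_cos dl) _ => x; rewrite mulNr mulrC mulNr.
Qed.

Lemma dv_sin_lin c a : dv (fun x => sin (c * x + a)) (fun x => c * cos (c * x + a)).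
Proof.
have dl : dv (fun x => c * x + a) (fun=> c).
  by apply: dv_ext (dvD (dvZ c dv_id) (dv_cst a)) _ => x; rewrite mulr1 addr0.
by apply: dv_ext (dv_comp dv_sin dl) _ => x; rewrite mulrC.
Qed.

Lemma dv_cosn (k : nat) : dv (fun x => cos (k%:R * x)) (fun x => - k%:R * sin (k%:R * x)).
Proof.
have := dv_cos_lin k%:R 0.
by congr dv; apply/funext => x; rewrite addr0.
Qed.

Lemma dv_sinn (k : nat) : dv (fun x => sin (k%:R * x)) (fun x => k%:R * cos (k%:R * x)).
Proof.
have := dv_sin_lin k%:R 0.
by congr dv; apply/funext => x; rewrite addr0.
Qed.

Lemma sin_npi (k : nat) : sin (k%:R * pi) = 0 :> R.
Proof.
elim: k => [|k ih]; first by rewrite mul0r sin0.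
by rewrite -natr1 mulrDl mul1r sinD ih sinpi mulr0 mul0r addr0.
Qed.

Lemma CP_cosn (k : nat) : CP (fun x : R => cos (k%:R * x)).
Proof.
split; first exact: dv_continuous (dv_cosn k).
by move=> x; rewrite mulrDr [k%:R * (pi *+ 2)]mulr_natl (periodicn (@cosD2pi R)).
Qed.

Lemma CP_sinn (k : nat) : CP (fun x : R => sin (k%:R * x)).
Proof.
split; first exact: dv_continuous (dv_sinn k).
by move=> x; rewrite mulrDr [k%:R * (pi *+ 2)]mulr_natl (periodicn (@sinD2pi R)).
Qed.

Lemma CP_sum (n : nat) (F : nat -> R -> R) : (forall i, CP (F i)) ->
  CP (fun x => \sum_(i < n) F i x).
Proof.
move=> cF; split; first by apply: cont_sum => i; case: (cF i).
by move=> x; apply: eq_bigr => i _; case: (cF i) => _ ->.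
Qed.

Lemma trigpoly_CP n T : trigpoly n T -> CP T.
Proof.
move=> [a [b ->]].
apply: (@CP_sum n.+1 (fun k x => a k * cos (k%:R * x) + b k * sin (k%:R * x))) => k.
by apply: CPD; apply: CPZ; [exact: CP_cosn|exact: CP_sinn].
Qed.

Lemma dv_sum (n : nat) (F G : nat -> R -> R) : (forall i, dv (F i) (G i)) ->
  dv (fun x => \sum_(i < n) F i x) (fun x => \sum_(i < n) G i x).
Proof.
move=> d; elim: n => [|n ih].
  by have := @dv_cst R 0; congr dv; apply/funext => x; rewrite big_ord0.
by have := dvD ih (d n); congr dv; apply/funext => x; rewrite big_ord_recr.
Qed.

Lemma trigpoly_dv n T : trigpoly n T -> exists2 T', trigpoly n T' & dv T T'.
Proof.
move=> [a [b ->]].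
exists (fun x => \sum_(k < n.+1) (b k * k%:R * cos (k%:R * x) + - (a k * k%:R) * sin (k%:R * x))).
  by exists (fun k => b k * k%:R), (fun k => - (a k * k%:R)).
apply: (@dv_sum n.+1 (fun k x => a k * cos (k%:R * x) + b k * sin (k%:R * x))
 (fun k x => b k * k%:R * cos (k%:R * x) + - (a k * k%:R) * sin (k%:R * x))) => k.
apply: dv_ext (dvD (dvZ (a k) (dv_cosn k)) (dvZ (b k) (dv_sinn k))) _ => x.
by ring.
Qed.

Lemma trigpoly_derive n T i : trigpoly n T -> trigpoly n (derive1n i T).
Proof.
move=> tT; elim: i => // i [] ; rewrite derive1nS.
by move=> a [b e]; have [T' tT' d] := @trigpoly_dv n (derive1n i T)
  (ex_intro _ a (ex_intro _ b e)); rewrite (dv_derive1 d).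
Qed.

Lemma trigpoly_chain n T k : trigpoly n T -> chain k (fun i => derive1n i T).
Proof.
move=> tT; split => i _; first exact: trigpoly_CP (trigpoly_derive i tT).
have [T' _ d] := trigpoly_dv (trigpoly_derive i tT).
by rewrite derive1nS (dv_derive1 d).
Qed.

Lemma trigpolyD n S T : trigpoly n S -> trigpoly n T ->
  trigpoly n (fun x => S x + T x).
Proof.
move=> [a [b ->]] [c [d ->]].
exists (fun k => a k + c k), (fun k => b k + d k).
by apply/funext => x; rewrite -big_split/=; apply: eq_bigr => k _; ring.
Qed.

Lemma trigpolyZ n c T : trigpoly n T -> trigpoly n (fun x => c * T x).
Proof.
move=> [a [b ->]]; exists (fun k => c * a k), (fun k => c * b k).
by apply/funext => x; rewrite mulr_sumr; apply: eq_bigr => k _; ring.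
Qed.

Lemma trigpolyB n S T : trigpoly n S -> trigpoly n T ->
  trigpoly n (fun x => S x - T x).
Proof.
move=> hS hT; have := trigpolyD hS (trigpolyZ (-1) hT).
by congr trigpoly; apply/funext => x; rewrite mulN1r.
Qed.

End trigonometric_polynomials.

(** * The Fejer kernel *)

Section kernels.
Context {R : realType}.
Implicit Types (f u v w F G K T : R -> R) (a b c x t : R).

Lemma dv_ge0 u v a b : dv u v -> a <= b -> (forall t, a <= t <= b -> 0 <= v t) ->
  u a <= u b.
Proof.
move=> d ab h.
have [c + e] := MVT_segment ab (fun x _ => d x) (continuous_subspaceT (dv_continuous d)).
rewrite in_itv/= => /h hc; rewrite -subr_ge0 e mulr_ge0// subr_ge0//.
Qed.

Lemma sin_le_id t : 0 <= t -> sin t <= t.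
Proof.
move=> t0; have := dv_ge0 (dvB dv_id dv_sin) t0.
rewrite sin0 subr0 subr_ge0; apply => s _.
by rewrite subr_ge0 cos_le1.
Qed.

Lemma cos_ge_quad t : 0 <= t -> 1 - t ^+ 2 / 2 <= cos t.
Proof.
move=> t0; have d : dv (fun x : R => cos x + x * x / 2) (fun x => - sin x + x).
  apply: dv_ext (dvD dv_cos (dvM (dvM dv_id dv_id) (dv_cst 2^-1))) _ => x.
  by field.
have := dv_ge0 d t0; rewrite cos0 mul0r mul0r addr0 => h.
rewrite lerBlDr expr2; apply: h => s /andP[s0 _].
by rewrite addrC subr_ge0 sin_le_id.
Qed.

Lemma sin_ge_cubic t : 0 <= t -> t - t ^+ 3 / 6 <= sin t.
Proof.
move=> t0.
have d : dv (fun x : R => sin x - x + x * x * x / 6) (fun x => cos x - (1 - x ^+ 2 / 2)).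
  apply: dv_ext (dvD (dvB dv_sin dv_id)
    (dvM (dvM (dvM dv_id dv_id) dv_id) (dv_cst 6^-1))) _ => x.
  by field.
have := dv_ge0 d t0; rewrite sin0 !mul0r subrr addr0 => h.
have {}h : 0 <= sin t - t + t * t * t / 6.
  by apply: h => s /andP[s0 _]; rewrite subr_ge0 cos_ge_quad.
have -> : t ^+ 3 = t * t * t by ring.
lra.
Qed.

Lemma pi_le4 : (pi : R) <= 4.
Proof. by have := pihalf_lt2 R; lra. Qed.

(** A crude quadratic lower bound valid up to [pi <= 4], from the Taylor bound
    of the sine at [t / 2]. *)
Lemma one_sub_cos_ge t : `|t| <= pi -> t ^+ 2 / 18 <= 1 - cos t.
Proof.
move=> tpi; rewrite -[t ^+ 2]real_normK ?num_real// -(cos_norm t).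
move: tpi (normr_ge0 t); set s := `|t| => spi s0.
have s4 : s <= 4 := le_trans spi pi_le4.
have e : cos s = 1 - 2 * sin (s / 2) ^+ 2.
  have {1}-> : s = s / 2 + s / 2 by field.
  rewrite cosD; have := cos2Dsin2 (s / 2); rewrite !expr2; lra.
have s2 : 0 <= s / 2 by lra.
have h : s / 6 <= sin (s / 2).
  apply: le_trans (sin_ge_cubic s2).
  have : 0 <= s * ((4 - s) * (4 + s)).
    by apply: mulr_ge0 => //; apply: mulr_ge0; lra.
  have -> : (s / 2) ^+ 3 = s * s * s / 8 by field.
  lra.
rewrite e; have := ler_pM (_ : 0 <= s / 6) (_ : 0 <= s / 6) h h.
rewrite expr2 => /(_ _ _)/wrap[||]; nra.
Qed.

Definition csum (m : nat) t : R := \sum_(i < m) cos (i%:R * t).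
Definition ssum (m : nat) t : R := \sum_(i < m) sin (i%:R * t).
(** The squared modulus of the sum of [e^(i k t)] over [k < m], that is [m]
    times the Fejer kernel, in real form. *)
Definition fejer (m : nat) t : R := csum m t ^+ 2 + ssum m t ^+ 2.

Lemma csum_tele m t :
  (1 - cos t) * csum m t + sin t * ssum m t = 1 - cos (m%:R * t).
Proof.
elim: m => [|m ih]; first by rewrite /csum /ssum !big_ord0 mul0r cos0; ring.
rewrite /csum /ssum !big_ord_recr/= -/(csum m t) -/(ssum m t).
have -> : m.+1%:R * t = m%:R * t + t by rewrite -natr1 mulrDl mul1r.
rewrite cosD; move: ih.
move: (csum m t) (ssum m t) (cos (m%:R * t)) (sin (m%:R * t)) => A B D E h.
by rewrite !mulrDr addrACA h; ring.
Qed.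

Lemma ssum_tele m t :
  (1 - cos t) * ssum m t - sin t * csum m t = - sin (m%:R * t).
Proof.
elim: m => [|m ih]; first by rewrite /csum /ssum !big_ord0 mul0r sin0; ring.
rewrite /csum /ssum !big_ord_recr/= -/(csum m t) -/(ssum m t).
have -> : m.+1%:R * t = m%:R * t + t by rewrite -natr1 mulrDl mul1r.
rewrite sinD; move: ih.
move: (csum m t) (ssum m t) (cos (m%:R * t)) (sin (m%:R * t)) => A B D E h.
have -> : (1 - cos t) * (B + E) - sin t * (A + D) =
  ((1 - cos t) * B - sin t * A) + (1 - cos t) * E - sin t * D by ring.
by rewrite h; ring.
Qed.

Lemma fejer_ge0 m t : 0 <= fejer m t.
Proof. by rewrite /fejer addr_ge0// sqr_ge0. Qed.

(** The geometric sum has modulus [|e^(i m t) - 1| / |e^(i t) - 1|]. *)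
Lemma fejer_decay m t : (2 - 2 * cos t) * fejer m t <= 4.
Proof.
have e : (2 - 2 * cos t) * fejer m t = 2 - 2 * cos (m%:R * t).
  have h1 := csum_tele m t; have h2 := ssum_tele m t.
  have h3 := cos2Dsin2 t; have h4 := cos2Dsin2 (m%:R * t).
  rewrite /fejer; move: h1 h2 h3 h4.
  move: (csum m t) (ssum m t) (cos (m%:R * t)) (sin (m%:R * t)) (cos t) (sin t).
  move=> A B D E c s h1 h2 h3 h4.
  have -> : (2 - 2 * c) * (A ^+ 2 + B ^+ 2) =
    ((1 - c) * A + s * B) ^+ 2 + ((1 - c) * B - s * A) ^+ 2 +
      (1 - (c ^+ 2 + s ^+ 2)) * (A ^+ 2 + B ^+ 2) by ring.
  rewrite h1 h2 h3.
  have -> : (1 - D) ^+ 2 + (- E) ^+ 2 + (1 - 1) * (A ^+ 2 + B ^+ 2) =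
    1 - 2 * D + (D ^+ 2 + E ^+ 2) by ring.
  by rewrite h4; ring.
by rewrite e; have := cos_geN1 (m%:R * t); lra.
Qed.

Lemma fejer_le m t : fejer m t <= 2 * m%:R ^+ 2.
Proof.
have h1 : `|csum m t| <= m%:R.
  apply: le_trans (ler_norm_sum _ _ _) _.
  apply: le_trans (ler_sum _ (fun (i : 'I_m) _ => cos_max (i%:R * t))) _.
  by rewrite sumr_const card_ord.
have h2 : `|ssum m t| <= m%:R.
  apply: le_trans (ler_norm_sum _ _ _) _.
  apply: le_trans (ler_sum _ (fun (i : 'I_m) _ => sin_max (i%:R * t))) _.
  by rewrite sumr_const card_ord.
rewrite /fejer -[csum m t ^+ 2]real_normK ?num_real//.
rewrite -[ssum m t ^+ 2]real_normK ?num_real// !expr2.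
have := ler_pM (normr_ge0 _) (normr_ge0 _) h1 h1.
have := ler_pM (normr_ge0 _) (normr_ge0 _) h2 h2.
lra.
Qed.

Lemma fejer_ge m t : (0 < m)%N -> `|t| <= m%:R^-1 -> m%:R ^+ 2 / 4 <= fejer m t.
Proof.
move=> m0 tm; have mr : 0 < m%:R :> R by rewrite ltr0n.
have h : m%:R / 2 <= csum m t.
  have -> : m%:R / 2 = \sum_(i < m) (2^-1 : R).
    by rewrite sumr_const card_ord mulrC mulr_natr.
  apply: ler_sum => i _; rewrite -cos_norm.
  have s1 : `|i%:R * t| <= 1.
    rewrite normrM normr_nat -[leRHS](@divff _ (m%:R)) ?gt_eqF//.
    by apply: ler_pM => //; rewrite ler_nat ltnW.
  have s0 := normr_ge0 (i%:R * t).
  apply: le_trans (cos_ge_quad s0).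
  have := ler_pM s0 s0 s1 s1; rewrite expr2 mulr1; lra.
rewrite /fejer; have := sqr_ge0 (ssum m t).
have m2 : 0 <= m%:R / 2 :> R by lra.
have := ler_pM m2 m2 h h; rewrite !expr2; lra.
Qed.

(** The decay [36 / t^2] on the dyadic annulus [2^(j - 1) / m <= |t|]. *)
Lemma fejer_annulus m j t : (0 < m)%N -> `|t| <= pi ->
  (j = 0%N \/ 2 ^+ j.-1 / m%:R <= `|t|) ->
  fejer m t <= 144 * m%:R ^+ 2 * 4 ^- j.
Proof.
move=> m0 tpi; have mr : 0 < m%:R :> R by rewrite ltr0n.
have m2 : 0 <= m%:R ^+ 2 :> R by exact: sqr_ge0.
case: j => [_|j [//|/= hj]].
  by rewrite expr0 invr1 mulr1; apply: le_trans (fejer_le m t) _; lra.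
have t0 : 0 < `|t|.
  by apply: lt_le_trans hj; rewrite divr_gt0// exprn_gt0.
have t2 : 0 < t ^+ 2 by rewrite -real_normK ?num_real// exprn_gt0.
have h1 : t ^+ 2 / 9 * fejer m t <= 4.
  apply: le_trans (fejer_decay m t); apply: ler_wpM2r; first exact: fejer_ge0.
  by have := one_sub_cos_ge tpi; lra.
have h2 : (2 ^+ j / m%:R) ^+ 2 <= t ^+ 2.
  rewrite -[leRHS]real_normK ?num_real//.
  by rewrite ler_pXn2r// nnegrE// divr_ge0// exprn_ge0.
have p0 := fejer_ge0 m t.
have q0 : 0 < 4 ^+ j :> R by rewrite exprn_gt0.
have e : (2 ^+ j / m%:R) ^+ 2 = 4 ^+ j / m%:R ^+ 2 :> R.
  rewrite exprMn exprVn -exprM mulnC exprM; congr (_ ^+ _ / _); ring.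
rewrite e ler_pdivrMr ?exprn_gt0// in h2.
rewrite ler_pdivlMr ?exprn_gt0// exprS.
move: h1 h2; set P := fejer m t in p0 *; set M := m%:R ^+ 2 in m2 *.
set Q := 4 ^+ j in q0 *; set T := t ^+ 2 in t2 * => h1 h2.
have h3 : P * Q <= P * (T * M) by apply: ler_wpM2l.
have h4 : T / 9 * P * M <= 4 * M by apply: ler_wpM2r.
have -> : P * (4 * Q) = 4 * (P * Q) by ring.
have e5 : T / 9 * P * M = P * (T * M) / 9 by ring.
rewrite e5 in h4; lra.
Qed.

Lemma continuous_csum m : continuous (csum m).
Proof.
apply: (@cont_sum R m (fun i t => cos (i%:R * t))) => i.
by have [] := @CP_cosn R i.
Qed.

Lemma continuous_ssum m : continuous (ssum m).
Proof.
apply: (@cont_sum R m (fun i t => sin (i%:R * t))) => i.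
by have [] := @CP_sinn R i.
Qed.

Lemma continuous_fejer m : continuous (fejer m).
Proof.
have h1 := contM (@continuous_csum m) (@continuous_csum m).
have h2 := contM (@continuous_ssum m) (@continuous_ssum m).
have -> : fejer m = (fun t => csum m t * csum m t + ssum m t * ssum m t).
  by apply/funext => t; rewrite /fejer !expr2.
exact: contD.
Qed.

Lemma intp_fejer_sq_ge m : (0 < m)%N -> m%:R ^+ 3 / 8 <= intp (fun t => fejer m t ^+ 2).
Proof.
move=> m0; have mr : 0 < m%:R :> R by rewrite ltr0n.
have mi : 0 < m%:R^-1 :> R by rewrite invr_gt0.
have m1 : m%:R^-1 <= pi :> R.
  apply: (@le_trans _ _ 1); first by rewrite invf_le1// ler1n.
  by have := pi_ge2 R; lra.
have cp : continuous (fun t => fejer m t ^+ 2).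
  have -> : (fun t => fejer m t ^+ 2) = (fun t => fejer m t * fejer m t).
    by apply/funext => t; rewrite expr2.
  by apply: contM; exact: continuous_fejer.
rewrite /intp (cint_split _ (- m%:R^-1)) (cint_split (- m%:R^-1) m%:R^-1).
have p2 t : 0 <= fejer m t ^+ 2 by exact: sqr_ge0.
have h1 : 0 <= cint (- pi) (- m%:R^-1) (fun t => fejer m t ^+ 2).
  by apply: cint_ge0 => //; lra.
have h2 : 0 <= cint m%:R^-1 pi (fun t => fejer m t ^+ 2) by apply: cint_ge0.
have mm : - m%:R^-1 <= m%:R^-1 :> R by lra.
have h3 : cint (- m%:R^-1) m%:R^-1 (fun=> m%:R ^+ 4 / 16) <=
    cint (- m%:R^-1) m%:R^-1 (fun t => fejer m t ^+ 2).
  apply: cint_le => //; first exact: cont_cst.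
  move=> t tm; have tm' : `|t| <= m%:R^-1 by rewrite ler_norml.
  have h := fejer_ge m0 tm'.
  have q0 : 0 <= m%:R ^+ 2 / 4 :> R by rewrite divr_ge0// sqr_ge0.
  have := ler_pM q0 q0 h h; rewrite -!expr2 => /(le_trans _); apply.
  rewrite le_eqVlt; apply/orP; left; apply/eqP; by field.
rewrite cint_cst// in h3.
have e : m%:R ^+ 4 / 16 * (m%:R^-1 - - m%:R^-1) = m%:R ^+ 3 / 8 :> R.
  by field; rewrite gt_eqF.
rewrite e in h3; lra.
Qed.

End kernels.

(** * Convolution with a kernel *)

Section convolution.
Context {R : realType}.
Implicit Types (f u v w F G K T : R -> R) (a b c x t : R).

(** Even trigonometric polynomials of degree at most [n], such as the Fejer
    and Jackson kernels. *)
Definition etrig n K := exists k : nat -> R,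
  K = fun t => \sum_(i < n.+1) k i * cos (i%:R * t).

Lemma etrigD n K L : etrig n K -> etrig n L -> etrig n (fun t => K t + L t).
Proof.
move=> [k ->] [l ->]; exists (fun i => k i + l i).
by apply/funext => t; rewrite -big_split/=; apply: eq_bigr => i _; ring.
Qed.

Lemma etrigZ n c K : etrig n K -> etrig n (fun t => c * K t).
Proof.
move=> [k ->]; exists (fun i => c * k i).
by apply/funext => t; rewrite mulr_sumr; apply: eq_bigr => i _; ring.
Qed.

Lemma etrig0 n : etrig n (fun=> 0).
Proof.
exists (fun=> 0); apply/funext => t.
by rewrite big1// => i _; rewrite mul0r.
Qed.

Lemma etrig_sum n (m : nat) (F : nat -> R -> R) :
  (forall i, (i < m)%N -> etrig n (F i)) ->
  etrig n (fun t => \sum_(i < m) F i t).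
Proof.
elim: m => [|m ih] h.
  by have := etrig0 n; congr etrig; apply/funext => t; rewrite big_ord0.
have := etrigD (ih (fun i im => h i (ltnW im))) (h m (ltnSn m)).
by congr etrig; apply/funext => t; rewrite big_ord_recr.
Qed.

Lemma etrig_cos n k : (k <= n)%N -> etrig n (fun t => cos (k%:R * t)).
Proof.
move=> kn; exists (fun i => (i == k)%:R); apply/funext => t.
rewrite (bigD1 (Ordinal (kn : (k < n.+1)%N)))//= eqxx mul1r big1 ?addr0//.
move=> i ik; have /negbTE -> : (i : nat) != k.
  by apply: contra ik => /eqP e; apply/eqP/val_inj.
by rewrite mul0r.
Qed.

Lemma cosM x t : cos x * cos t = (cos (x + t) + cos (x - t)) / 2 :> R.
Proof. by rewrite cosD cosB; field. Qed.

Lemma cos_natB (i j : nat) t :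
  cos (i%:R * t - j%:R * t) = cos ((maxn i j - minn i j)%:R * t).
Proof.
case: (leqP i j) => ij.
  by rewrite natrB// mulrBl -cosN opprB.
by rewrite natrB 1?ltnW// mulrBl.
Qed.

Lemma etrigM n m K L : etrig n K -> etrig m L ->
  etrig (n + m) (fun t => K t * L t).
Proof.
move=> [k ->] [l ->].
have -> : (fun t => (\sum_(i < n.+1) k i * cos (i%:R * t)) *
    (\sum_(j < m.+1) l j * cos (j%:R * t))) =
  (fun t => \sum_(i < n.+1) \sum_(j < m.+1)
    k i * l j / 2 * (cos ((i + j)%:R * t) + cos ((maxn i j - minn i j)%:R * t))).
  apply/funext => t; rewrite mulr_suml; apply: eq_bigr => i _.
  rewrite mulr_sumr; apply: eq_bigr => j _.
  rewrite -cos_natB natrD mulrDl.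
  have := cosM (i%:R * t) (j%:R * t).
  set A := cos (i%:R * t); set B := cos (j%:R * t) => e.
  have -> : k i * A * (l j * B) = k i * l j * (A * B) by ring.
  by rewrite e; field.
apply: (@etrig_sum _ n.+1 (fun i t => \sum_(j < m.+1)
    k i * l j / 2 * (cos ((i + j)%:R * t) + cos ((maxn i j - minn i j)%:R * t)))) => i im.
apply: (@etrig_sum _ m.+1 (fun j t =>
    k i * l j / 2 * (cos ((i + j)%:R * t) + cos ((maxn i j - minn i j)%:R * t)))) => j jm.
apply: etrigZ; apply: etrigD; apply: etrig_cos.
  by apply: leq_add.
apply: leq_trans (leq_subr _ _) _; rewrite geq_max.
by rewrite -ltnS (leq_trans im)/= ?ltnS ?leq_addr// -ltnS (leq_trans jm)// ltnS leq_addl.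
Qed.

Lemma fejerE m t : fejer m t =
  \sum_(i < m) \sum_(j < m) cos (i%:R * t - j%:R * t) :> R.
Proof.
rewrite /fejer /csum /ssum !expr2 !mulr_suml -big_split/=; apply: eq_bigr => i _.
rewrite !mulr_sumr -big_split/=; apply: eq_bigr => j _.
by rewrite cosB.
Qed.

Lemma etrig_fejer m : etrig m (@fejer R m.+1).
Proof.
have -> : @fejer R m.+1 = (fun t => \sum_(i < m.+1) \sum_(j < m.+1)
    cos ((maxn i j - minn i j)%:R * t)).
  apply/funext => t; rewrite fejerE; apply: eq_bigr => i _.
  by apply: eq_bigr => j _; rewrite cos_natB.
apply: (@etrig_sum _ m.+1 (fun i t => \sum_(j < m.+1)
  cos ((maxn i j - minn i j)%:R * t))) => i im.
apply: (@etrig_sum _ m.+1 (fun j t =>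
  cos ((maxn i j - minn i j)%:R * t))) => j jm.
apply: etrig_cos; apply: leq_trans (leq_subr _ _) _.
by rewrite geq_max; apply/andP; split; rewrite -ltnS.
Qed.

Lemma continuous_etrig n K : etrig n K -> continuous K.
Proof.
move=> [k ->]; apply: (@cont_sum R n.+1 (fun i t => k i * cos (i%:R * t))) => i.
by apply: contZ; case: (@CP_cosn R i).
Qed.

(** The correlation of [K] and [u] over a period: for an even kernel, their
    convolution. *)
Definition pconv K u x : R := intp (fun t => K t * u (x + t)).

Lemma intp_sum (n : nat) (F : nat -> R -> R) : (forall i, continuous (F i)) ->
  intp (fun t => \sum_(i < n) F i t) = \sum_(i < n) intp (F i).
Proof. exact: cint_sum. Qed.

Lemma pconv_cos k u x : CP u ->
  pconv (fun t => cos (k%:R * t)) u x =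
  intp (fun t => u t * cos (k%:R * t)) * cos (k%:R * x) +
  intp (fun t => u t * sin (k%:R * t)) * sin (k%:R * x).
Proof.
move=> cu; rewrite /pconv.
have c1 := CPM cu (@CP_cosn R k); have c2 := CPM cu (@CP_sinn R k).
pose F y := cos (k%:R * x) * (u y * cos (k%:R * y)) + sin (k%:R * x) * (u y * sin (k%:R * y)).
have cF : CP F by apply: CPD; exact: CPZ.
have -> : (fun t => cos (k%:R * t) * u (x + t)) = (fun t => F (t + x)).
  apply/funext => t; rewrite /F (addrC t x).
  have -> : k%:R * t = k%:R * (x + t) - k%:R * x by ring.
  by rewrite cosB; ring.
rewrite intp_shift// /F /intp cintD; [|exact: (CPZ _ c1).1|exact: (CPZ _ c2).1].
by rewrite !cintZ; [ring|exact: c2.1|exact: c1.1].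
Qed.

Lemma continuous_pconv_arg K u x : continuous K -> continuous u ->
  continuous (fun t => K t * u (x + t)).
Proof.
move=> cK cu; apply: contM => //.
have -> : (fun t => u (x + t)) = (fun t => u (t + x)).
  by apply/funext => t; rewrite addrC.
exact: cont_shift.
Qed.

Lemma pconv_etrig (k : nat -> R) n u x : CP u ->
  pconv (fun t => \sum_(i < n.+1) k i * cos (i%:R * t)) u x =
  \sum_(i < n.+1) (k i * intp (fun t => u t * cos (i%:R * t)) * cos (i%:R * x) +
    k i * intp (fun t => u t * sin (i%:R * t)) * sin (i%:R * x)).
Proof.
move=> cu; rewrite /pconv.
have cc i := (@CP_cosn R i).1.
have -> : (fun t => (\sum_(i < n.+1) k i * cos (i%:R * t)) * u (x + t)) =
  (fun t => \sum_(i < n.+1) k i * (cos (i%:R * t) * u (x + t))).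
  by apply/funext => t; rewrite mulr_suml; apply: eq_bigr => i _; rewrite mulrA.
rewrite (@intp_sum n.+1 (fun i t => k i * (cos (i%:R * t) * u (x + t)))); last first.
  by move=> i; apply: contZ; apply: continuous_pconv_arg; [exact: cc|exact: cu.1].
apply: eq_bigr => i _; rewrite /intp cintZ; last first.
  by apply: continuous_pconv_arg; [exact: cc|exact: cu.1].
have := pconv_cos i x cu; rewrite /pconv /intp => ->.
by ring.
Qed.

Lemma trigpoly_pconv n K u : etrig n K -> CP u -> trigpoly n (pconv K u).
Proof.
move=> [k ->] cu.
exists (fun i => k i * intp (fun t => u t * cos (i%:R * t))),
  (fun i => k i * intp (fun t => u t * sin (i%:R * t))).
by apply/funext => x; rewrite pconv_etrig.
Qed.

Lemma intp_cos_dv k u v : CP u -> CP v -> dv u v ->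
  intp (fun t => v t * cos (k%:R * t)) = k%:R * intp (fun t => u t * sin (k%:R * t)).
Proof.
move=> cu cv d; have cc := @CP_cosn R k; have cs := @CP_sinn R k.
have c1 := CPM cv cc; have c2 := CPM cu cs.
have := intp_deriv (v := fun t => v t * cos (k%:R * t) - k%:R * (u t * sin (k%:R * t)))
  (dv_ext (dvM d (dv_cosn k)) _) (CPM cu cc) (CPB c1 (CPZ k%:R c2)).
move=> /(_ _)/wrap[|]; first by move=> t /=; ring.
rewrite /intp cintB; [|exact: c1.1|exact: (CPZ _ c2).1].
rewrite cintZ; last exact: c2.1.
by move=> /eqP; rewrite subr_eq0 => /eqP.
Qed.

Lemma intp_sin_dv k u v : CP u -> CP v -> dv u v ->
  intp (fun t => v t * sin (k%:R * t)) = - k%:R * intp (fun t => u t * cos (k%:R * t)).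
Proof.
move=> cu cv d; have cc := @CP_cosn R k; have cs := @CP_sinn R k.
have c1 := CPM cv cs; have c2 := CPM cu cc.
have := intp_deriv (v := fun t => v t * sin (k%:R * t) + k%:R * (u t * cos (k%:R * t)))
  (dv_ext (dvM d (dv_sinn k)) _) (CPM cu cs) (CPD c1 (CPZ k%:R c2)).
move=> /(_ _)/wrap[|]; first by move=> t /=; ring.
rewrite /intp cintD; [|exact: c1.1|exact: (CPZ _ c2).1].
rewrite cintZ; last exact: c2.1.
by move=> /eqP; rewrite addr_eq0 mulNr => /eqP.
Qed.

(** Convolution with an even trigonometric polynomial only involves Fourier
    coefficients, and those of a derivative are known by partial integration. *)
Lemma dv_pconv n K u v : etrig n K -> CP u -> CP v -> dv u v ->
  dv (pconv K u) (pconv K v).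
Proof.
move=> [k ->] cu cv d.
pose cu' i := k i * intp (fun t => u t * cos (i%:R * t)).
pose su' i := k i * intp (fun t => u t * sin (i%:R * t)).
have -> : pconv (fun t => \sum_(i < n.+1) k i * cos (i%:R * t)) u =
  (fun x => \sum_(i < n.+1) (cu' i * cos (i%:R * x) + su' i * sin (i%:R * x))).
  by apply/funext => x; rewrite pconv_etrig.
have -> : pconv (fun t => \sum_(i < n.+1) k i * cos (i%:R * t)) v =
  (fun x => \sum_(i < n.+1) (cu' i * (- i%:R * sin (i%:R * x)) +
     su' i * (i%:R * cos (i%:R * x)))).
  apply/funext => x; rewrite pconv_etrig//; apply: eq_bigr => i _.
  by rewrite (intp_cos_dv _ cu cv d) (intp_sin_dv _ cu cv d) /cu' /su'; ring.
apply: (@dv_sum R n.+1 (fun i x => cu' i * cos (i%:R * x) + su' i * sin (i%:R * x))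
  (fun i x => cu' i * (- i%:R * sin (i%:R * x)) + su' i * (i%:R * cos (i%:R * x)))) => i.
by apply: dvD; apply: dvZ; [exact: dv_cosn|exact: dv_sinn].
Qed.

(** The integral is cut along the dyadic annuli of radii [2^j / m]; the last
    one exceeds [pi].  On each the function is replaced by a majorant over the
    whole interval, which produces windows. *)
Lemma dyadic_bound (m : nat) (H : R -> R) (g : nat -> R -> R) :
  (0 < m)%N -> continuous H -> (forall j, continuous (g j)) ->
  (forall t, 0 <= H t) ->
  (forall j t, `|t| <= pi -> `|t| <= 2 ^+ j / m%:R ->
     (j = 0%N \/ 2 ^+ j.-1 / m%:R <= `|t|) -> H t <= g j t) ->
  (forall j t, 0 <= g j t) ->
  intp H <= \sum_(j < m.+2) cint (- (2 ^+ j / m%:R)) (2 ^+ j / m%:R) (g j).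
Proof.
move=> m0 cH cg H0 hH g0; have mr : 0 < m%:R :> R by rewrite ltr0n.
pose b j : R := 2 ^+ j / m%:R.
have b0 j : 0 < b j by rewrite divr_gt0// exprn_gt0.
(* the induction treats an arbitrary cut-off r, as the last annulus stops at
   pi *)
have key j r : 0 <= r <= pi -> r <= b j ->
    cint (- r) r H <= \sum_(i < j.+1) cint (- b i) (b i) (g i).
  elim: j r => [|j ih] r /andP[r0 rp] rb.
    rewrite big_ord1.
    have rr : - r <= r by lra.
    have h : cint (- r) r H <= cint (- r) r (g 0%N).
      apply: cint_le => // t; rewrite -ler_norml => tr.
      by apply: hH; [exact: le_trans tr _|exact: le_trans tr _|left].
    apply: le_trans h _.
    rewrite (cint_split (- b 0%N) (- r)) (cint_split (- r) r (b 0%N)).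
    have h1 : 0 <= cint (- b 0%N) (- r) (g 0%N) by apply: cint_ge0 => //; lra.
    have h2 : 0 <= cint r (b 0%N) (g 0%N) by apply: cint_ge0.
    have e (A B D : R) : 0 <= A -> 0 <= D -> B <= A + (B + D) by lra.
    exact: e.
  rewrite big_ord_recr/=.
  have [rbj|rbj] := leP r (b j).
    apply: le_trans (ih r _ rbj) _; first by rewrite r0.
    rewrite lerDl; apply: cint_ge0 => //; have := b0 j.+1; lra.
  have bj := b0 j.
  rewrite (cint_split (- r) (- b j)) (cint_split (- b j) (b j)).
  have h0 : cint (- b j) (b j) H <= \sum_(i < j.+1) cint (- b i) (b i) (g i).
    by apply: ih => //; lra.
  have h1 : cint (- r) (- b j) H <= cint (- r) (- b j) (g j.+1).
    apply: cint_le => //; first lra.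
    move=> t tt; have tn : `|t| = - t by rewrite ler0_norm; lra.
    apply: hH; rewrite ?tn; [lra|apply: le_trans rb; lra|right].
    by rewrite -/(b j); lra.
  have h2 : cint (b j) r H <= cint (b j) r (g j.+1).
    apply: cint_le => //; first lra.
    move=> t tt; have tn : `|t| = t by rewrite ger0_norm; lra.
    apply: hH; rewrite ?tn; [lra|apply: le_trans rb; lra|right].
    by rewrite -/(b j); lra.
  have h3 : cint (- r) (- b j) (g j.+1) + cint (b j) r (g j.+1) <=
      cint (- b j.+1) (b j.+1) (g j.+1).
    rewrite (cint_split (- b j.+1) (- r)) (cint_split (- r) (- b j) (b j.+1)).
    rewrite (cint_split (- b j) (b j) (b j.+1)) (cint_split (b j) r (b j.+1)).
    have i1 : 0 <= cint (- b j.+1) (- r) (g j.+1) by apply: cint_ge0 => //; lra.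
    have i2 : 0 <= cint (- b j) (b j) (g j.+1) by apply: cint_ge0 => //; lra.
    have i3 : 0 <= cint r (b j.+1) (g j.+1) by apply: cint_ge0.
    move: i1 i2 i3.
    move: (cint (- b j.+1) (- r) (g j.+1)) (cint (- r) (- b j) (g j.+1))
      (cint (- b j) (b j) (g j.+1)) (cint (b j) r (g j.+1))
      (cint r (b j.+1) (g j.+1)) => A B D E F; lra.
  move: h0 h1 h2 h3; move: (\sum_(i < j.+1) _).
  move: (cint (- r) (- b j) H) (cint (- b j) (b j) H) (cint (b j) r H).
  move: (cint (- r) (- b j) (g j.+1)) (cint (b j) r (g j.+1))
    (cint (- b j.+1) (b j.+1) (g j.+1)) => A B D E F G S.
  lra.
apply: key; first by rewrite lexx pi_ge0.
rewrite /b ler_pdivlMr//; apply: le_trans (ler_wpM2r (ltW mr) (@pi_le4 R)) _.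
rewrite -natrX -natrM ler_nat expnS.
case: m m0 {mr b b0 hH} => // m _.
by rewrite expnS mulnA leq_mul2l/= ltn_expl.
Qed.

End convolution.

(** * A convolution formula for the derivative *)

Section bernstein_identity.
Context {R : realType}.
Implicit Types (P x t : R).

(** Orthogonality of the trigonometric system. *)
Lemma intp_sin_shift P (p q : nat) :
  intp (fun t => sin (P + (p%:R - q%:R) * t)) = 2 * pi * sin P * (p == q)%:R.
Proof.
have [->|pq] := eqVneq p q.
  have -> : (fun t => sin (P + (q%:R - q%:R) * t)) = (fun=> sin P).
    by apply/funext => t; rewrite subrr mul0r addr0.
  rewrite /intp cint_cst; last by have := pi_ge0 R; lra.
  by rewrite mulr1; ring.
set c : R := p%:R - q%:R.
have c0 : c != 0 by rewrite subr_eq0 eqr_nat.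
have d : dv (fun t => - c^-1 * cos (c * t + P)) (fun t => sin (P + c * t)).
  apply: dv_ext (dvZ (- c^-1) (dv_cos_lin c P)) _ => t.
  by rewrite mulrA mulrNN mulVf// mul1r addrC.
have cs : continuous (fun t => sin (P + c * t)).
  have -> : (fun t => sin (P + c * t)) = (fun t => sin (c * t + P)).
    by apply/funext => t; rewrite addrC.
  exact: dv_continuous (dv_sin_lin c P).
rewrite /intp (cint_dv _ _ d cs) mulr0 -mulrBr.
have -> : cos (c * pi + P) - cos (c * - pi + P) = - 2 * sin P * sin (c * pi).
  by rewrite mulrN (addrC _ P) (addrC _ P) cosB cosD; ring.
by rewrite /c mulrBl sinB !sin_npi; ring.
Qed.

(** There is exactly one [i] for each [j < k], and none for the other [j]. *)
Lemma count_pairs n k : (k <= n)%N ->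
  \sum_(i < n) \sum_(j < n) ((k + i == n + j)%N%:R : R) = k%:R.
Proof.
move=> kn; rewrite exchange_big/=.
have h (j : 'I_n) : \sum_(i < n) ((k + i == n + j)%N%:R : R) = (j < k)%N%:R.
  have [jk|kj] := ltnP j k.
    have i0 : (n + j - k < n)%N.
      by rewrite ltn_subLR ?(leq_trans kn) ?leq_addr// addnC ltn_add2r.
    rewrite (bigD1 (Ordinal i0))//= subnKC ?(leq_trans kn) ?leq_addr// eqxx.
    rewrite big1 ?addr0// => i ii.
    have /negbTE -> // : (k + i)%N != (n + j)%N.
    apply: contra ii => /eqP e; apply/eqP/val_inj => /=.
    by rewrite -e addKn.
  rewrite big1// => i _.
  have /negbTE -> // : (k + i)%N != (n + j)%N.
  by rewrite ltn_eqF// addnC -addSn leq_add// ltn_ord.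
rewrite (eq_bigr _ (fun j _ => h j)).
have -> : k%:R = \sum_(j < k) (1 : R) by rewrite sumr_const card_ord.
rewrite (big_ord_widen n (fun=> 1) kn) [RHS]big_mkcond/=.
by apply: eq_bigr => j _; case: (_ < _)%N.
Qed.

(** The coefficient of [sin (k t)] in [sin (n t) * fejer n t] is the number of
    pairs [(i, j)] with [i - j = n - k], which is [k] ([count_pairs]): for
    frequencies up to [n], convolution with this kernel is differentiation.
    The phase [P] gives the sines as well as the cosines. *)
Lemma bernstein_cos n k x P : (k <= n)%N -> (0 < n)%N ->
  intp (fun t => sin (n%:R * t) * fejer n t * cos (k%:R * (x + t) + P)) =
  - (pi * k%:R * sin (k%:R * x + P)).
Proof.
move=> kn n0; set Q := k%:R * x + P.
pose s (p q : nat) t := sin (Q + (p%:R - q%:R) * t).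
pose F (i j : nat) t := 4^-1 * (s (k + n + i)%N j t + s (k + n + j)%N i t)
  - 4^-1 * (s (k + i)%N (n + j)%N t + s (k + j)%N (n + i)%N t).
have cs p q : continuous (s p q).
  have -> : s p q = (fun t => sin ((p%:R - q%:R) * t + Q)).
    by apply/funext => t; rewrite /s addrC.
  exact: dv_continuous (dv_sin_lin _ _).
have cs2 p q p' q' : continuous (fun t => 4^-1 * (s p q t + s p' q' t)).
  by apply: contZ; apply: contD.
have cF i j : continuous (F i j) by exact: contB.
have -> : (fun t => sin (n%:R * t) * fejer n t * cos (k%:R * (x + t) + P)) =
    (fun t => \sum_(i < n) \sum_(j < n) F i j t).
  apply/funext => t; rewrite fejerE mulrAC mulr_sumr; apply: eq_bigr => i _.
  rewrite mulr_sumr; apply: eq_bigr => j _.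
  have prod (A B D : R) : sin B * cos A * cos D =
    4^-1 * (sin (A + (B + D)) + sin (A + (B - D))) -
    4^-1 * (sin (A + (D - B)) + sin (A - (B + D))).
    rewrite ?opprD !(sinD, cosD) !(sinN, cosN).
    by field.
  rewrite prod /F /s /Q !natrD.
  congr (_ * (sin _ + sin _) - _ * (sin _ + sin _)); ring.
rewrite (@intp_sum _ n (fun i t => \sum_(j < n) F i j t)); last first.
  by move=> i; exact: cont_sum.
pose a : R := - (pi / 2 * sin Q).
have e (i j : 'I_n) : intp (F i j) =
    a * (k + i == n + j)%N%:R + a * (k + j == n + i)%N%:R.
  rewrite /intp cintB//.
  have cd p q p' q' : cint (- pi) pi (fun t => 4^-1 * (s p q t + s p' q' t)) =
      4^-1 * (intp (s p q) + intp (s p' q')).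
    by rewrite cintZ ?cintD//; exact: contD.
  rewrite !cd !intp_sin_shift.
  have /negbTE -> : (k + n + i)%N != j.
    by rewrite gtn_eqF// -addnA addnCA ltn_addr.
  have /negbTE -> : (k + n + j)%N != i.
    by rewrite gtn_eqF// -addnA addnCA ltn_addr.
  rewrite /= ?mulr0n /a; move: ((k + i)%N == (n + j)%N) ((k + j)%N == (n + i)%N) => c d.
  by move: (c%:R) (d%:R) => A B; field.
transitivity (\sum_(i < n) (a * (\sum_(j < n) (k + i == n + j)%N%:R) +
    a * (\sum_(j < n) (k + j == n + i)%N%:R))).
  apply: eq_bigr => i _; rewrite intp_sum// !mulr_sumr -big_split/=.
  by apply: eq_bigr => j _; exact: e.
rewrite big_split/= -!mulr_sumr count_pairs// exchange_big/= count_pairs//.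
by rewrite /a; field.
Qed.

Lemma bernstein_pconv n (T : R -> R) x : (0 < n)%N -> trigpoly n T ->
  pconv (fun t => pi^-1 * (sin (n%:R * t) * fejer n t)) T x = derive1 T x.
Proof.
move=> n0 tT; have [a [b eT]] := tT.
pose D (y : R) : R := \sum_(k < n.+1) (a k * (- k%:R * sin (k%:R * y)) + b k * (k%:R * cos (k%:R * y))).
have dT : dv T D.
  rewrite eT; apply: (@dv_sum R n.+1 (fun k x => a k * cos (k%:R * x) + b k * sin (k%:R * x))
   (fun k x => a k * (- k%:R * sin (k%:R * x)) + b k * (k%:R * cos (k%:R * x)))) => k.
  by apply: dvD; apply: dvZ; [exact: dv_cosn|exact: dv_sinn].
rewrite (dv_derive1 dT) /pconv.
pose K t := sin (n%:R * t) * fejer n t.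
have cK : continuous K.
  by apply: contM; [case: (@CP_sinn R n)|exact: continuous_fejer].
have cc k (P : R) : continuous (fun t => K t * cos (k%:R * (x + t) + P)).
  apply: contM => //.
  have -> : (fun t => cos (k%:R * (x + t) + P)) = (fun t => cos (k%:R * t + (k%:R * x + P))).
    by apply/funext => t; congr cos; ring.
  exact: dv_continuous (dv_cos_lin _ _).
have -> : (fun t => pi^-1 * (sin (n%:R * t) * fejer n t) * T (x + t)) =
  (fun t => \sum_(k < n.+1) (pi^-1 * a k * (K t * cos (k%:R * (x + t) + 0)) +
     pi^-1 * b k * (K t * cos (k%:R * (x + t) + (- (pi / 2)))))).
  apply/funext => t; rewrite eT mulr_sumr; apply: eq_bigr => k _.
  by rewrite addr0 cosBpihalf /K; ring.
rewrite (@intp_sum _ n.+1 (fun k t => pi^-1 * a k * (K t * cos (k%:R * (x + t) + 0)) +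
     pi^-1 * b k * (K t * cos (k%:R * (x + t) + (- (pi / 2)))))); last first.
  by move=> k; apply: contD; apply: contZ; exact: cc.
apply: eq_bigr => k _.
rewrite /intp cintD; [|by apply: contZ; exact: cc|by apply: contZ; exact: cc].
rewrite !cintZ; [|exact: cc|exact: cc].
have kn : (k <= n)%N by rewrite -ltnS.
have := bernstein_cos x 0 kn n0; rewrite /intp -/K => ->.
have := bernstein_cos x (- (pi / 2)) kn n0; rewrite /intp -/K => ->.
have p0 : pi != 0 :> R by rewrite gt_eqF// pi_gt0.
rewrite addr0 sinBpihalf.
by move: (@pi R) p0 => q q0; field.
Qed.

End bernstein_identity.

(** * Convolutions in the lattice norm *)

Section jackson_bernstein.
Context {R : realType}.
Variables (X : banach_lattice R) (C : R).
Hypothesis hC : steklov_bound X C.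
Notation nx := (bl_norm X).
Implicit Types (f u v w K T : R -> R) (a b c t x : R).

(** Decay of a kernel at scale [1 / m]: by a factor [q] from each dyadic
    annulus to the next. *)
Definition annulus_bound (m : nat) (a q : R) K :=
  forall j t, `|t| <= pi -> (j = 0%N \/ 2 ^+ j.-1 / m%:R <= `|t|) ->
  `|K t| <= a * q ^- j.

Lemma sum_geo2_le n : \sum_(j < n) (2 ^- j : R) <= 2.
Proof.
suff : \sum_(j < n) (2 ^- j : R) <= 2 - 2 * 2 ^- n.
  by have : 0 <= 2 ^- n :> R by []; lra.
elim: n => [|n ih]; first by rewrite big_ord0 expr0 invr1; lra.
rewrite big_ord_recr/=; have -> : 2 ^- n.+1 = 2 ^- n / 2 :> R by rewrite exprSr invfM.
move: ih; move: (2 ^- n) (\sum_(_ < _) _) => A B; lra.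
Qed.


(** On the annulus of radius [2^j / m] the kernel is at most [a 4^-j], and the
    window of that radius has norm [2^(j + 1) C / m]: the sum over [j] is
    geometric. *)
Lemma nx_pconv m a K u : (0 < m)%N -> 0 <= a -> continuous K ->
  annulus_bound m a 4 K -> CP u -> CP (pconv K u) ->
  nx (pconv K u) <= 4 * a * C / m%:R * nx u.
Proof.
move=> m0 a0 cK hK cu cc; have mr : 0 < m%:R :> R by rewrite ltr0n.
have C0 := steklov_bound_gt0 hC.
have Xu := X_CP X cu; have n0 := bl_norm_ge0 Xu.
pose b j : R := 2 ^+ j / m%:R.
have b0 j : 0 < b j by rewrite divr_gt0// exprn_gt0.
have q0 j : 0 <= a * 4 ^- j by rewrite mulr_ge0// invr_ge0 exprn_ge0.
have pw x : `|pconv K u x| <= \sum_(j < m.+2) a * 4 ^- j * win (b j) u x.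
  have cx : continuous (fun t => K t * u (x + t)).
    by apply: continuous_pconv_arg => //; case: cu.
  have pp : - pi <= pi :> R by have := pi_ge0 R; lra.
  apply: le_trans (cint_abs cx pp) _.
  have cau : continuous (fun t => `|u (x + t)|).
    have -> : (fun t => `|u (x + t)|) = (fun t => `|u (t + x)|).
      by apply/funext => t; rewrite addrC.
    by case: (CP_abs (CP_shift x cu)).
  have := @dyadic_bound R m (fun t => `|K t * u (x + t)|)
    (fun j t => a * 4 ^- j * `|u (x + t)|) m0.
  move=> /(_ (continuous_abs cx) (fun j => contZ (c := a * 4 ^- j) cau) (fun t => normr_ge0 _)).
  move=> /(_ _ _)/wrap[||h].
  - by move=> j t tpi tb hj; rewrite normrM; apply: ler_wpM2r => //; exact: hK.
  - by move=> j t; rewrite mulr_ge0.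
  apply: le_trans h _; apply: ler_sum => j _.
  rewrite cintZ//; rewrite winC//; case: cu => //.
have Xw j : X (fun x => a * 4 ^- j * win (b j) u x).
  by apply: bl_scale; have [] := nx_win hC Xu (b0 j).
have [Xs hs] := nx_sum (n := m.+2) (fun j _ => Xw j).
have [_ h1] := nx_le_pos (CP_circle cc) Xs pw.
apply: le_trans h1 _; apply: le_trans hs _.
apply: (@le_trans _ _ (\sum_(j < m.+2) 2 * a * C / m%:R * nx u * 2 ^- j)).
  apply: ler_sum => j _.
  have [Xb hb] := nx_win hC Xu (b0 j).
  rewrite bl_norm_scale// ger0_norm//.
  apply: le_trans (ler_wpM2l (q0 j) hb) _.
  rewrite le_eqVlt; apply/orP; left; apply/eqP; rewrite /b.
  have -> : 4 ^- j = 2 ^- j * 2 ^- j :> R.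
    by rewrite -invfM -exprMn; congr (_ ^- j); ring.
  have pn : 2 ^+ j != 0 :> R by rewrite expf_neq0.
  by move: (2 ^+ j) pn => P pn; field; rewrite pn gt_eqF.
rewrite -mulr_sumr; have k0 : 0 <= 2 * a * C / m%:R * nx u.
  by rewrite mulr_ge0// divr_ge0// mulr_ge0// ?mulr_ge0// ltW.
apply: le_trans (ler_wpM2l k0 (sum_geo2_le _)) _.
rewrite le_eqVlt; apply/orP; left; apply/eqP.
by field; rewrite gt_eqF.
Qed.

(** Since [K] has integral 1, the difference is the integral of [K t * (u x -
    u (x + t))]; on an annulus of radius [b] the increment of [u] is at most a
    window of its derivative, which brings one more factor [b] and requires a
    faster decay of the kernel. *)
Lemma nx_sub_pconv m a K u v : (0 < m)%N -> 0 <= a -> continuous K ->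
  annulus_bound m a 16 K -> intp K = 1 -> CP u -> CP v -> dv u v ->
  CP (pconv K u) ->
  nx (fun x => u x - pconv K u x) <= 8 * a * C / m%:R ^+ 2 * nx v.
Proof.
move=> m0 a0 cK hK iK cu cv d cc; have mr : 0 < m%:R :> R by rewrite ltr0n.
have C0 := steklov_bound_gt0 hC.
have Xv := X_CP X cv; have n0 := bl_norm_ge0 Xv.
pose b j : R := 2 ^+ j / m%:R.
have b0 j : 0 < b j by rewrite divr_gt0// exprn_gt0.
have q0 j : 0 <= a * 16 ^- j by rewrite mulr_ge0// invr_ge0 exprn_ge0.
have k0 : 0 <= 4 * a * C / m%:R ^+ 2 * nx v.
  apply: mulr_ge0 => //; apply: divr_ge0; last exact: sqr_ge0.
  by apply: mulr_ge0; [exact: mulr_ge0|exact: ltW].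
have pw x : `|u x - pconv K u x| <= \sum_(j < m.+2) a * 16 ^- j * (2 * b j) * win (b j) v x.
  have cx : continuous (fun t => K t * u (x + t)).
    by apply: continuous_pconv_arg => //; case: cu.
  have cx0 : continuous (fun t => u x * K t) by exact: contZ.
  have cd : continuous (fun t => u x * K t - K t * u (x + t)) by exact: contB.
  have pp : - pi <= pi :> R by have := pi_ge0 R; lra.
  have -> : u x - pconv K u x = intp (fun t => u x * K t - K t * u (x + t)).
    by rewrite /intp cintB// cintZ// -/(intp K) iK mulr1.
  apply: le_trans (cint_abs cd pp) _.
  have w0 j : 0 <= win (b j) v x by apply: win_ge0; [exact: ltW|exact: CP_locint].
  have := @dyadic_bound R m (fun t => `|u x * K t - K t * u (x + t)|)
    (fun j t => a * 16 ^- j * win (b j) v x) m0.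
  move=> /(_ (continuous_abs cd) (fun j => @cont_cst R _) (fun t => normr_ge0 _)).
  move=> /(_ _ _)/wrap[||h].
  - move=> j t tpi tb hj; rewrite mulrC -mulrBr normrM; apply: ler_pM => //.
      exact: hK.
    by rewrite distrC; apply: dv_win => //; [case: cv|rewrite addrC addKr].
  - by move=> j t; rewrite mulr_ge0.
  apply: le_trans h _; apply: ler_sum => j _.
  rewrite cint_cst; last by have := b0 j; rewrite /b; lra.
  rewrite le_eqVlt; apply/orP; left; apply/eqP; rewrite /b; ring.
have Xw j : X (fun x => a * 16 ^- j * (2 * b j) * win (b j) v x).
  by apply: bl_scale; have [] := nx_win hC Xv (b0 j).
have [Xs hs] := nx_sum (n := m.+2) (fun j _ => Xw j).
have [_ h1] := nx_le_pos (CP_circle (CPB cu cc)) Xs pw.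
apply: le_trans h1 _; apply: le_trans hs _.
apply: (@le_trans _ _ (\sum_(j < m.+2) 4 * a * C / m%:R ^+ 2 * nx v * 2 ^- j)).
  apply: ler_sum => j _.
  have [Xb hb] := nx_win hC Xv (b0 j).
  have q1 : 0 <= a * 16 ^- j * (2 * b j).
    by apply: mulr_ge0 => //; apply: mulr_ge0 => //; exact: ltW.
  rewrite bl_norm_scale// ger0_norm//.
  apply: le_trans (ler_wpM2l q1 hb) _.
  have -> : 16 ^- j = 2 ^- j * 2 ^- j * (2 ^- j * 2 ^- j) :> R.
    by rewrite -!invfM -!exprMn; congr (_ ^- j); ring.
  have pn : 2 ^+ j != 0 :> R by rewrite expf_neq0.
  have p1 : 1 <= 2 ^+ j :> R by rewrite exprn_ege1// ler1n.
  have -> : a * (2 ^- j * 2 ^- j * (2 ^- j * 2 ^- j)) * (2 * b j) * (2 * b j * C * nx v) =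
     4 * a * C / m%:R ^+ 2 * nx v * 2 ^- j * 2 ^- j.
    by rewrite /b; move: (2 ^+ j) pn => P pn; field; rewrite pn gt_eqF.
  apply: ler_piMr; last by rewrite invf_le1// exprn_gt0.
  by apply: mulr_ge0 => //; rewrite invr_ge0 exprn_ge0.
rewrite -mulr_sumr.
apply: le_trans (ler_wpM2l k0 (sum_geo2_le _)) _.
rewrite le_eqVlt; apply/orP; left; apply/eqP.
by field; rewrite gt_eqF.
Qed.

(** The derivative is a convolution with a kernel decaying like [144 n^2
    4^-j]. *)
Lemma bernstein n T : (0 < n)%N -> trigpoly n T ->
  nx (derive1 T) <= 576 * C * n%:R * nx T.
Proof.
move=> n0 tT; have nr : 0 < n%:R :> R by rewrite ltr0n.
pose K t : R := pi^-1 * (sin (n%:R * t) * fejer n t).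
have cK : continuous K.
  apply: contZ; apply: contM; [by case: (@CP_sinn R n)|exact: continuous_fejer].
have eK : pconv K T = derive1 T.
  by apply/funext => x; exact: bernstein_pconv.
have cT := trigpoly_CP tT.
have cT' : CP (pconv K T).
  by rewrite eK; exact: trigpoly_CP (trigpoly_derive 1 tT).
have a0 : 0 <= 144 * n%:R ^+ 2 :> R by rewrite mulr_ge0// sqr_ge0.
have hK : annulus_bound n (144 * n%:R ^+ 2) 4 K.
  move=> j t tpi hj; rewrite /K normrM.
  have p1 : `|pi^-1| <= 1 :> R.
    rewrite ger0_norm ?invr_ge0 ?pi_ge0// invf_le1 ?pi_gt0//.
    by have := pi_ge2 R; lra.
  have s1 : `|sin (n%:R * t) * fejer n t| <= 144 * n%:R ^+ 2 * 4 ^- j.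
    rewrite normrM (ger0_norm (fejer_ge0 _ _)) -[leRHS]mul1r.
    apply: ler_pM => //; [exact: fejer_ge0|exact: sin_max|exact: fejer_annulus].
  by rewrite -[leRHS]mul1r; apply: ler_pM.
rewrite -eK; apply: le_trans (nx_pconv n0 a0 cK hK cT cT') _.
rewrite le_eqVlt; apply/orP; left; apply/eqP.
by field; rewrite gt_eqF.
Qed.

End jackson_bernstein.

(** * Jackson's theorem *)

Section jackson.
Context {R : realType}.
Variables (X : banach_lattice R) (C : R).
Hypothesis hC : steklov_bound X C.
Notation nx := (bl_norm X).
Implicit Types (f u v w K T : R -> R) (a b c t x : R) (G : nat -> R -> R).

Lemma etrig_le m n K : (m <= n)%N -> @etrig R m K -> etrig n K.
Proof.
move=> mn [k ->].
apply: (@etrig_sum R n m.+1 (fun i t => k i * cos (i%:R * t))) => i im.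
by apply: etrigZ; apply: etrig_cos; exact: leq_trans mn.
Qed.

Lemma annulus_bound_le m a p q K : 0 <= a -> 0 < p -> p <= q ->
  annulus_bound m a q K -> annulus_bound m a p K.
Proof.
move=> a0 p0 pq hK j t tpi hj; apply: le_trans (hK j t tpi hj) _.
apply: ler_wpM2l => //; rewrite lef_pV2 ?posrE ?exprn_gt0//; last exact: lt_le_trans pq.
by apply: lerXn2r => //; rewrite nnegrE ltW// (lt_le_trans p0).
Qed.

Definition jackson_kernel (m : nat) t : R :=
  (intp (fun t => fejer m t ^+ 2))^-1 * (fejer m t * fejer m t).

(** The index is chosen so that the squared Fejer kernel has degree [2 * n./2
    <= n]. *)
Definition jackson (n : nat) := pconv (jackson_kernel n./2.+1).

Lemma etrig_jackson n : etrig n (jackson_kernel n./2.+1).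
Proof.
apply: (@etrig_le (n./2 + n./2)); first by rewrite addnn -[leqRHS]odd_double_half leq_addl.
by apply: etrigZ; apply: etrigM; exact: etrig_fejer.
Qed.

Lemma intp_jackson m : (0 < m)%N -> intp (jackson_kernel m) = 1.
Proof.
move=> m0; have h := intp_fejer_sq_ge (R := R) m0; have mr : 0 < m%:R :> R by rewrite ltr0n.
have i0 : 0 < intp (fun t : R => fejer m t ^+ 2).
  by apply: lt_le_trans h; rewrite divr_gt0// exprn_gt0.
rewrite /jackson_kernel /intp cintZ; last by apply: contM; exact: continuous_fejer.
by rewrite mulVf// gt_eqF.
Qed.

(** The factor 8 comes from [intp_fejer_sq_ge], the square of 144 from
    [fejer_annulus]. *)
Definition jackson_const : R := 8 * 144 ^+ 2.

Lemma jackson_const_ge0 : 0 <= jackson_const.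
Proof. by rewrite mulr_ge0// exprn_ge0. Qed.

Lemma annulus_jackson m : (0 < m)%N ->
  annulus_bound m (jackson_const * m%:R) 16 (jackson_kernel m).
Proof.
move=> m0; have mr : 0 < m%:R :> R by rewrite ltr0n.
have h := intp_fejer_sq_ge (R := R) m0.
have m3 : 0 < m%:R ^+ 3 / 8 :> R by rewrite divr_gt0// exprn_gt0.
have i0 : 0 < intp (fun t : R => fejer m t ^+ 2) by exact: lt_le_trans h.
move=> j t tpi hj; have p0 := fejer_ge0 m t; have pa := fejer_annulus m0 tpi hj.
rewrite /jackson_kernel normrM ger0_norm ?invr_ge0 ?(ltW i0)//.
rewrite (ger0_norm (mulr_ge0 p0 p0)).
apply: (@le_trans _ _ ((m%:R ^+ 3 / 8)^-1 *
  ((144 * m%:R ^+ 2 * 4 ^- j) * (144 * m%:R ^+ 2 * 4 ^- j)))).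
  apply: ler_pM; [by rewrite invr_ge0 ltW|exact: mulr_ge0| |exact: ler_pM].
  by rewrite lef_pV2// posrE.
have -> : 16 ^- j = 4 ^- j * 4 ^- j :> R.
  by rewrite -invfM -exprMn; congr (_ ^- j); ring.
rewrite /jackson_const; move: (4 ^- j) => q; rewrite le_eqVlt; apply/orP; left; apply/eqP.
by field; rewrite gt_eqF.
Qed.

Lemma continuous_jackson n : continuous (jackson_kernel n./2.+1).
Proof. exact: continuous_etrig (@etrig_jackson n). Qed.

Lemma trigpoly_jackson n u : CP u -> trigpoly n (jackson n u).
Proof. by move=> cu; apply: trigpoly_pconv => //; exact: etrig_jackson. Qed.

Lemma CP_jackson n u : CP u -> CP (jackson n u).
Proof. by move=> cu; exact: trigpoly_CP (trigpoly_jackson n cu). Qed.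

Lemma nx_jackson n u : CP u -> nx (jackson n u) <= 4 * jackson_const * C * nx u.
Proof.
move=> cu; have mr : 0 < n./2.+1%:R :> R by rewrite ltr0n.
have a0 : 0 <= jackson_const * n./2.+1%:R :> R by rewrite mulr_ge0 ?jackson_const_ge0// ltW.
have h4 : annulus_bound n./2.+1 (jackson_const * n./2.+1%:R) 4 (jackson_kernel n./2.+1).
  by apply: (annulus_bound_le (q := 16)) (annulus_jackson _) => //; lra.
apply: le_trans (nx_pconv hC (isT : (0 < n./2.+1)%N) a0 (@continuous_jackson n) h4 cu
  (CP_jackson n cu)) _.
rewrite le_eqVlt; apply/orP; left; apply/eqP.
by field; rewrite gt_eqF.
Qed.

Lemma nx_sub_jackson n u v : (0 < n)%N -> CP u -> CP v -> dv u v ->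
  nx (fun x => u x - jackson n u x) <= 16 * jackson_const * C / n%:R * nx v.
Proof.
move=> n0 cu cv d; have nr : 0 < n%:R :> R by rewrite ltr0n.
have mr : 0 < n./2.+1%:R :> R by rewrite ltr0n.
have a0 : 0 <= jackson_const * n./2.+1%:R :> R by rewrite mulr_ge0 ?jackson_const_ge0// ltW.
apply: le_trans (nx_sub_pconv hC (isT : (0 < n./2.+1)%N) a0 (@continuous_jackson n)
  (annulus_jackson _) (intp_jackson _) cu cv d (CP_jackson n cu)) _ => //.
apply: ler_wpM2r; first exact: bl_norm_ge0 (X_CP X cv).
have C0 := steklov_bound_gt0 hC.
have mn : n./2.+1%:R^-1 <= 2 / n%:R :> R.
  rewrite ler_pdivlMr// ler_pdivrMl// -natrM ler_nat.
  by rewrite muln2 doubleS -addn2 -[leqLHS]odd_double_half addnC leq_add2l; case: (odd n).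
have -> : 8 * (jackson_const * n./2.+1%:R) * C / n./2.+1%:R ^+ 2 = 8 * jackson_const * C * n./2.+1%:R^-1.
  by field; rewrite gt_eqF.
have -> : 16 * jackson_const * C / n%:R = 8 * jackson_const * C * (2 / n%:R) by field; rewrite gt_eqF.
by apply: ler_wpM2l => //; rewrite !mulr_ge0 ?jackson_const_ge0// ltW.
Qed.

Lemma chain_sub_jackson n k G : chain k G ->
  chain k (fun i x => G i x - jackson n (G i) x).
Proof.
move=> cG; apply: chainB => //; case: cG => g1 g2; split => i ik.
  by apply: CP_jackson; exact: g1.
apply: dv_pconv (@etrig_jackson n) _ _ _; [exact/g1/ltnW|exact: g1|exact: g2].
Qed.

Lemma chain_diff_jackson n j k G : chain k G ->
  chain k (fun i => iter_diff (jackson n) j (G i)).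
Proof.
by move=> cG; elim: j => [//|j ih]; exact: (chain_sub_jackson n ih).
Qed.

(** Each factor [u - jackson n u] consumes one derivative and gains [1 / n]. *)
Lemma jackson_diff_le s n G : (0 < n)%N -> chain s G ->
  nx (iter_diff (jackson n) s (G 0%N)) <= (16 * jackson_const * C / n%:R) ^+ s * nx (G s).
Proof.
move=> n0; elim: s G => [|s ih] G cG; first by rewrite expr0 mul1r.
have nr : 0 < n%:R :> R by rewrite ltr0n.
have c1 : chain s (fun i x => G i x - jackson n (G i) x).
  by apply: chain_sub_jackson; exact: chain_le cG.
rewrite iter_diffSr; apply: le_trans (ih _ c1) _.
rewrite exprSr -[leRHS]mulrA; apply: ler_wpM2l.
  by apply: exprn_ge0; rewrite divr_ge0// !mulr_ge0 ?jackson_const_ge0// ltW// (steklov_bound_gt0 hC).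
by apply: nx_sub_jackson => //; [exact: cG.1|exact: cG.1|exact: cG.2].
Qed.

Lemma nx_diff_jackson s n u : CP u ->
  nx (iter_diff (jackson n) s u) <= (1 + 4 * jackson_const * C) ^+ s * nx u.
Proof.
elim: s u => [|s ih] u cu; first by rewrite expr0 mul1r.
have cJ := CP_jackson n cu.
rewrite iter_diffSr; apply: le_trans (ih _ (CPB cu cJ)) _.
rewrite exprSr -[leRHS]mulrA; apply: ler_wpM2l.
  by apply: exprn_ge0; rewrite addr_ge0// !mulr_ge0 ?jackson_const_ge0// ltW// (steklov_bound_gt0 hC).
by have [] := nx_sub_self (X_CP X cu) (X_CP X cJ) (nx_jackson n cu).
Qed.

Lemma trigpoly_sub_jackson s n u : CP u ->
  trigpoly n (fun x => u x - iter_diff (jackson n) s u x).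
Proof.
elim: s u => [|s ih] u cu.
  have := trigpolyZ 0 (trigpoly_jackson n cu); congr trigpoly.
  by apply/funext => x; rewrite mul0r subrr.
have cJ := CP_jackson n cu.
have := trigpolyD (ih _ (CPB cu cJ)) (trigpoly_jackson n cu).
rewrite -iter_diffSr; congr trigpoly; apply/funext => x.
have e (A B D : R) : A - B - D + B = A - D by ring.
exact: e.
Qed.

Lemma chain_derive1n k G : chain k G -> derive1n k (G 0%N) = G k.
Proof.
elim: k => [//|k ih] cG; rewrite derive1nS ih; last exact: chain_le cG.
by apply: dv_derive1; exact: cG.2.
Qed.

Lemma iter_diff_dot s h f : X f -> 0 < h ->
  iter_diff (steklov_dot h) s f = iter_diff (fav h) s f.
Proof.
move=> Xf h0; elim: s => // s ih; rewrite !iter_diffS ih.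
apply/funext => x; rewrite steklov_dotE//.
exact: X_locint (X_iter_diff hC h0 s Xf).
Qed.

(** The smooth approximant [G 0] is replaced by [G 0 - (I - J)^s G 0], where
    [J] is the Jackson operator: this is a trigonometric polynomial since the
    power [J^0] cancels, and the correction is small because [G 0] is smooth. *)
Theorem trig_approx s g : (0 < s)%N -> 0 < g -> exists2 K, 0 < K &
  forall n f, X f -> (0 < n)%N -> exists T, [/\ trigpoly n T,
    nx (fun x => f x - T x) <= K * nx (iter_diff (steklov_dot (g / n%:R)) s f) &
    n%:R ^- s * nx (derive1n s T) <= K * nx (iter_diff (steklov_dot (g / n%:R)) s f)].
Proof.
move=> s0 g0; have [K0 K00 hK] := smooth_approx hC s0.
have C0 := steklov_bound_gt0 hC.
pose cJ : R := 16 * jackson_const * C.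
have cJ0 : 0 <= cJ by rewrite !mulr_ge0 ?jackson_const_ge0// ltW.
pose p : R := (cJ / g) ^+ s; pose q : R := (1 + (1 + 4 * jackson_const * C) ^+ s) * g ^- s.
have p0 : 0 <= p by rewrite exprn_ge0// divr_ge0// ltW.
have q0 : 0 <= q.
  rewrite mulr_ge0//; last by rewrite invr_ge0 exprn_ge0// ltW.
  by rewrite addr_ge0// exprn_ge0// addr_ge0// !mulr_ge0 ?jackson_const_ge0// ltW.
exists (K0 * (1 + p + q)); first by apply: mulr_gt0 => //; lra.
move=> n f Xf n0; have nr : 0 < n%:R :> R by rewrite ltr0n.
have h0 : 0 < g / n%:R by exact: divr_gt0.
have [G [cG h1 h2]] := hK _ _ Xf h0.
rewrite iter_diff_dot//; set om := nx (iter_diff (fav _) s f) in h1 h2 *.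
have om0 : 0 <= om by apply: bl_norm_ge0; exact: (X_iter_diff hC h0).
have X0 := chain_X X cG (leq0n s); have Xs := chain_X X cG (leqnn s).
have cD := chain_diff_jackson n s cG.
have cT := chainB cG cD.
exists (fun x => G 0%N x - iter_diff (jackson n) s (G 0%N) x).
have Gs : nx (G s) <= (n%:R / g) ^+ s * (K0 * om).
  rewrite -ler_pdivrMl ?exprn_gt0 ?divr_gt0//; apply: le_trans h2.
  by rewrite -exprVn invf_div.
split.
- by apply: trigpoly_sub_jackson; exact: cG.1.
- have XD := chain_X X cD (leq0n s).
  have -> : (fun x => f x - (G 0%N x - iter_diff (jackson n) s (G 0%N) x)) =
    (fun x => (f x - G 0%N x) + iter_diff (jackson n) s (G 0%N) x).
    apply/funext => x; move: (iter_diff _ _ _ x) => A; ring.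
  apply: le_trans (nx_add (X_sub Xf X0) XD) _.
  have h3 := jackson_diff_le n0 cG.
  have h4 : nx (iter_diff (jackson n) s (G 0%N)) <= p * (K0 * om).
    apply: le_trans h3 _.
    have c0 : 0 <= (cJ / n%:R) ^+ s by rewrite exprn_ge0// divr_ge0// ltW.
    apply: le_trans (ler_wpM2l c0 Gs) _; rewrite [leLHS]mulrA -exprMn.
    have -> : cJ / n%:R * (n%:R / g) = cJ / g by field; rewrite !gt_eqF.
    exact: lexx.
  apply: le_trans (lerD h1 h4) _.
  have -> : K0 * (1 + p + q) * om = K0 * om + p * (K0 * om) + q * (K0 * om) by ring.
  by rewrite lerDl mulr_ge0// mulr_ge0// ltW.
- rewrite (chain_derive1n cT).
  have XD := chain_X X cD (leqnn s).
  have h3 : nx (fun x => G s x - iter_diff (jackson n) s (G s) x) <=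
      (1 + (1 + 4 * jackson_const * C) ^+ s) * nx (G s).
    rewrite mulrDl mul1r; apply: le_trans (nx_sub Xs XD) _.
    by rewrite lerD2l; apply: nx_diff_jackson; exact: cG.1.
  have i0 : 0 <= n%:R ^- s :> R by rewrite invr_ge0 exprn_ge0// ltW.
  apply: le_trans (ler_wpM2l i0 h3) _.
  have b0 : 0 <= n%:R ^- s * (1 + (1 + 4 * jackson_const * C) ^+ s) :> R.
    apply: mulr_ge0 => //; apply: addr_ge0 => //; apply: exprn_ge0.
    by apply: addr_ge0 => //; rewrite !mulr_ge0 ?jackson_const_ge0// ltW.
  rewrite [leLHS]mulrA; apply: le_trans (ler_wpM2l b0 Gs) _.
  have -> : n%:R ^- s * (1 + (1 + 4 * jackson_const * C) ^+ s) * ((n%:R / g) ^+ s * (K0 * om)) =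
     q * (K0 * om).
    rewrite /q expr_div_n; move: ((1 + _) ^+ s) => A.
    by field; rewrite !gt_eqF// exprn_gt0.
  have -> : K0 * (1 + p + q) * om = q * (K0 * om) + (1 + p) * (K0 * om) by ring.
  by rewrite lerDl mulr_ge0//; [lra|rewrite mulr_ge0// ltW].
Qed.

End jackson.

(** * The discrete norm *)

Section discrete.
Context {R : realType}.
Variables (X : banach_lattice R) (C : R).
Hypothesis hC : steklov_bound X C.
Variables (g g' : R) (m : nat -> nat) (x : nat -> nat -> R).
Hypotheses (g0 : 0 < g) (g'0 : 0 < g') (hx : sampling_nodes g g' m x).
Variable n : nat.
Hypothesis n0 : (0 < n)%N.
Notation nx := (bl_norm X).
Notation dx := (discrete_norm X m x n).
Implicit Types (f u v w T P : R -> R) (y : R) (G : nat -> R -> R).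

Lemma periodize_shift (E : set R) (j : int) y :
  periodize E (y + (pi *+ 2) *~ j) = periodize E y.
Proof.
apply/propext; split => [[i Ei]|[i Ei]].
  by exists (j + i); rewrite mulrzDr addrA.
by exists (i - j); rewrite -addrA -mulrzDr addrCA subrr addr0.
Qed.

Lemma circle_fun_periodize (E : set (lebR R)) : measurable E ->
  circle_fun (\1_(periodize E) : R -> R).
Proof.
move=> mE; split.
  move=> y; rewrite !indicE; have := periodize_shift E 1 y.
  by rewrite mulr1z => e; rewrite /in_mem/= /mem/= /in_set e.
apply: measurable_indic.
have -> : periodize E = \bigcup_(j in [set: int])
    ((fun y : R => y + (pi *+ 2) *~ j) @^-1` E).
  by apply/seteqP; split => y [j]; exists j.
apply: countable_bigcupT_measurable; first exact: countableP.
move=> j; rewrite -[X in measurable X]setTI.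
exact: measurable_translation.
Qed.

Definition step u y : R := \sum_(1 <= k < (m n).+1)
  `|u (x n k)| * \1_(periodize `[x n k, x n k.+1[%classic) y.

Lemma dxE u : dx u = nx (step u). Proof. by []. Qed.

Lemma circle_funZ c f : circle_fun f -> circle_fun (fun y => c * f y).
Proof.
move=> [pf mf]; split; first by move=> y /=; rewrite pf.
by apply: measurable_funM => //; exact: measurable_cst.
Qed.

Lemma circle_fun_step u : circle_fun (step u).
Proof.
rewrite /step; elim: (m n) => [|k ih].
  have -> : (fun y => \sum_(1 <= k < 1) `|u (x n k)| *
    \1_(periodize `[x n k, x n k.+1[%classic) y) = (fun=> 0).
    by apply/funext => y; rewrite big_geq.
  exact: CP_circle (CP_cst _).
have mI : measurable (`[x n k.+1, x n k.+2[%classic : set (lebR R)).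
  by apply: sub_caratheodory; exact: measurable_itv.
have := circle_funD ih (circle_funZ `|u (x n k.+1)| (circle_fun_periodize mI)).
by congr circle_fun; apply/funext => y; rewrite [RHS]big_nat_recr.
Qed.

Lemma step_ge0 u y : 0 <= step u y.
Proof. by apply: sumr_ge0 => k _; rewrite mulr_ge0// indicE. Qed.

Lemma X_step u : X (step u).
Proof.
apply: (@X_bounded _ X _ (\sum_(1 <= k < (m n).+1) `|u (x n k)|)).
  exact: circle_fun_step.
move=> y; rewrite ger0_norm ?step_ge0//; apply: ler_sum => k _.
by rewrite indicE ler_piMr//; case: (_ \in _).
Qed.

Lemma node_gap k : (1 <= k <= m n)%N -> x n k <= x n k.+1 <= x n k + g' / n%:R.
Proof.
move=> hk; have [_ /(_ k hk) [_ /andP[h1 h2]]] := hx n0.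
have : 0 < g / n%:R by rewrite divr_gt0// ltr0n.
by move: h1 h2; lra.
Qed.

Lemma node_le k l : (1 <= k)%N -> (k <= l)%N -> (l <= (m n).+1)%N ->
  x n k <= x n l.
Proof.
move=> k1; elim: l => [|l ih] kl lm; first by move: (leq_trans k1 kl).
move: kl; rewrite leq_eqVlt => /orP[/eqP -> //|kl].
apply: le_trans (ih kl (ltnW lm)) _.
by have /andP[] := node_gap (k := l) (introT andP (conj (leq_trans k1 kl) lm)).
Qed.

Lemma no_overlap (a b c d z : R) : b <= c -> a <= z < b -> c <= z < d -> False.
Proof. lra. Qed.

(** The cells lie in the interval from the first node to its translate by one
    period, so equal points modulo the period are equal. *)
Lemma cell_disjoint k l (i j : int) y : (1 <= k <= m n)%N -> (1 <= l <= m n)%N ->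
  x n k <= y + (pi *+ 2) *~ i < x n k.+1 ->
  x n l <= y + (pi *+ 2) *~ j < x n l.+1 -> k = l.
Proof.
move=> /andP[k1 km] /andP[l1 lm] hk hl; have [hm _] := hx n0.
have p0 := pi_gt0 R.
have ij : i = j.
  have a1 := node_le (leqnn 1) k1 (leqW km).
  have b1 := node_le (leqnn 1) l1 (leqW lm).
  have c1 := node_le (isT : (1 <= k.+1)%N) (km : (k.+1 <= (m n).+1)%N) (leqnn _).
  have c2 := node_le (isT : (1 <= l.+1)%N) (lm : (l.+1 <= (m n).+1)%N) (leqnn _).
  have q0 : 0 < pi *+ 2 :> R by rewrite mulrn_wgt0.
  have e1 : (pi *+ 2) *~ i < (pi *+ 2) *~ (j + 1) :> R.
    by rewrite mulrzDr mulr1z; move: hk hl; lra.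
  have e2 : (pi *+ 2) *~ j < (pi *+ 2) *~ (i + 1) :> R.
    by rewrite mulrzDr mulr1z; move: hk hl; lra.
  move: e1 e2; rewrite !ltr_pMz2l// !ltzD1 => h1 h2.
  by apply/eqP; rewrite eq_le h1 h2.
rewrite -{}ij in hl.
have [kl|lk|//] := ltngtP k l.
  by have := no_overlap (node_le (isT : (1 <= k.+1)%N) kl (leqW lm)) hk hl.
by have := no_overlap (node_le (isT : (1 <= l.+1)%N) lk (leqW km)) hl hk.
Qed.

(** The periodized cells are disjoint, so that at most one term of the sum
    differs from zero. *)
Lemma step_le u (H : R -> R) : (forall y, 0 <= H y) -> periodic H (pi *+ 2) ->
  (forall k y, (1 <= k <= m n)%N -> x n k <= y <= x n k + g' / n%:R ->
    `|u (x n k)| <= H y) ->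
  forall y, step u y <= H y.
Proof.
move=> H0 pH hH y.
have [[k [km [j hk]]]|hn] := pselect (exists k, (1 <= k <= m n)%N /\
    periodize `[x n k, x n k.+1[%classic y); last first.
  rewrite /step big_nat big1// => k hk.
  rewrite indicE (_ : (_ \in _) = false) ?mulr0//.
  by apply/negP => /set_mem pk; apply: hn; exists k.
move: hk; rewrite /= in_itv/= => hk.
have ks : k \in index_iota 1 (m n).+1 by rewrite mem_index_iota ltnS.
rewrite /step (bigD1_seq k ks (iota_uniq _ _))/= big_seq_cond big1; last first.
  move=> l /andP[]; rewrite mem_index_iota ltnS => lm lk.
  rewrite indicE (_ : (_ \in _) = false) ?mulr0//.
  apply/negP => /set_mem [i]; rewrite /= in_itv/= => hl.
  by move/eqP: lk; apply; exact: cell_disjoint hl hk.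
rewrite addr0; apply: (@le_trans _ _ `|u (x n k)|).
  by rewrite indicE ler_piMr//; case: (_ \in _).
have -> : H y = H (y + pi *+ 2 *~ j).
  case: j {hk} => i; first by rewrite -pmulrn (periodicz pH i y).1.
  by rewrite NegzE mulrNz -pmulrn (periodicz pH i.+1 y).2.
apply: hH => //; have /andP[_] := node_gap km.
by move: hk => /andP[-> /ltW a] /(le_trans a) ->.
Qed.

Lemma discrete_norm_ge0 u : 0 <= dx u.
Proof. exact: bl_norm_ge0 (X_step u). Qed.

Lemma discrete_normD u v w :
  (forall k, (1 <= k <= m n)%N -> `|u (x n k)| <= `|v (x n k)| + `|w (x n k)|) ->
  dx u <= dx v + dx w.
Proof.
move=> h; apply: le_trans (nx_add (X_step v) (X_step w)).
have [|_ h1] := nx_le_pos (circle_fun_step u) (X_addp (X_step v) (X_step w)); last exact: h1.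
move=> y.
rewrite ger0_norm ?step_ge0// /step -big_split/= !big_nat; apply: ler_sum => k hk.
by rewrite -mulrDl ler_wpM2r ?indicE//; exact: h.
Qed.

Lemma discrete_norm_add u v : dx (fun t => u t + v t) <= dx u + dx v.
Proof. by apply: discrete_normD => k _; exact: ler_normD. Qed.

Lemma discrete_norm_sub u v : dx (fun t => u t - v t) <= dx u + dx v.
Proof. by apply: discrete_normD => k _; exact: ler_normB. Qed.

(** Each point of a cell is within [g' / n] of its node. *)
Lemma discrete_norm_win u v c a : X v -> 0 < a -> 0 <= c ->
  (forall k, (1 <= k <= m n)%N -> `|u (x n k)| <= c * win a v (x n k)) ->
  dx u <= c * (2 * (a + g' / n%:R) * C * nx v).
Proof.
move=> Xv a0 c0 h; have lv := X_locint Xv.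
have b0 : 0 < g' / n%:R by rewrite divr_gt0// ltr0n.
have ab : 0 < a + g' / n%:R by lra.
have [] := @nx_le_win _ _ _ hC _ c (step u) v (circle_fun_step u) Xv ab c0; last by [].
move=> y; rewrite ger0_norm ?step_ge0//; move: y; apply: step_le.
- by move=> y; rewrite mulr_ge0// win_ge0// ltW.
- by move=> y; have [Xw _] := nx_win hC Xv ab; have [-> ] := bl_circle Xw.
- move=> k y hk hy; apply: le_trans (h k hk) _; apply: ler_wpM2l => //.
  by apply: win_mono => //; [exact: ltW|rewrite addrC lerD2l ler_norml; lra].
Qed.

(** A value of an average at a node is dominated by a window, although a value
    of [u] itself is not. *)
Lemma discrete_norm_steklov u : X u ->
  dx (steklov (g / n%:R) u) <= (4 + 2 * g' / g) * C * nx u.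
Proof.
move=> Xu; have nr : 0 < n%:R :> R by rewrite ltr0n.
have h0 : 0 < g / n%:R by rewrite divr_gt0.
have lu := X_locint Xu.
have c0 : 0 <= (g / n%:R)^-1 by rewrite invr_ge0 ltW.
have a0 : 0 < 2 * (g / n%:R) by lra.
apply: le_trans (discrete_norm_win Xu a0 c0 _) _.
  move=> k hk; rewrite steklovE//; apply: le_trans (fav_le_win _ h0 lu) _.
  apply: ler_wpM2l => //; apply: win_mono => //; first exact: ltW.
  rewrite addrAC subrr add0r normrN ger0_norm; lra.
rewrite le_eqVlt; apply/orP; left; apply/eqP.
by field; rewrite !gt_eqF.
Qed.

(** The value at a node differs from the value at a point of its cell by at
    most a window of the derivative. *)
Lemma discrete_norm_dv u v : CP u -> CP v -> dv u v ->
  dx u <= nx u + 2 * g' / n%:R * C * nx v.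
Proof.
move=> cu cv d; have b0 : 0 < g' / n%:R by rewrite divr_gt0// ltr0n.
have [Xw hw] := nx_win hC (X_CP X cv) b0.
have [Xa ea] := X_abs (X_CP X cu).
have pt : forall y, step u y <= `|u y| + win (g' / n%:R) v y.
  apply: step_le.
  - by move=> y; rewrite addr_ge0// win_ge0// ?ltW//; exact: CP_locint.
  - by move=> y; have [-> _] := bl_circle Xw; case: cu => _ ->.
  - move=> k y hk hy; rewrite -[u (x n k)](subrK (u y)) addrC.
    apply: le_trans (ler_normD _ _) _; rewrite lerD2l.
    by apply: dv_win => //; [case: cv|rewrite ler_norml; lra].
have [|_ h1] := nx_le_pos (circle_fun_step u) (X_addp Xa Xw).
  by move=> y; rewrite ger0_norm ?step_ge0.
apply: le_trans h1 _; apply: le_trans (nx_add Xa Xw) _.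
rewrite ea lerD2l; apply: le_trans hw _.
by rewrite le_eqVlt; apply/orP; left; apply/eqP; rewrite mulrA.
Qed.

Lemma chain_diff_steklov h k r G : 0 < h -> chain k G ->
  chain k (fun i => iter_diff (steklov h) r (G i)).
Proof.
move=> h0 cG; elim: r => [//|r ih].
by have := chainB ih (chain_steklov h0 ih).
Qed.

Lemma nx_steklov_diff h r u : X u -> 0 < h -> X (iter_diff (steklov h) r u) /\
  nx (iter_diff (steklov h) r u) <= (1 + C) ^+ r * nx u.
Proof.
move=> Xu h0; elim: r => [|r [Xr ih]]; first by rewrite expr0 mul1r.
have [Xs hs] := hC.2 _ _ Xr h0.
have [X1 h1] := nx_sub_self Xr Xs hs; split; first exact: X1.
apply: le_trans h1 _; rewrite exprS -mulrA; apply: ler_wpM2l => //.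
by have := steklov_bound_gt0 hC; lra.
Qed.

(** [u - (I - A)^(r + 1) u] is [u - (I - A)^r u] plus the average of [(I -
    A)^r u]: only averages occur. *)
Lemma discrete_norm_diff_sub r u : X u ->
  dx (fun t => u t - iter_diff (steklov (g / n%:R)) r u t) <=
  r%:R * ((4 + 2 * g' / g) * C * (1 + C) ^+ r) * nx u.
Proof.
move=> Xu; have h0 : 0 < g / n%:R by rewrite divr_gt0// ltr0n.
have C0 := steklov_bound_gt0 hC; have nu := bl_norm_ge0 Xu.
have q0 : 0 <= (4 + 2 * g' / g) * C.
  by rewrite mulr_ge0 ?(ltW C0)// addr_ge0// divr_ge0 ?mulr_ge0 ?ltW.
elim: r => [|r ih].
  rewrite !mul0r dxE (_ : step _ = fun=> 0) ?nx0//.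
  by apply/funext => y; rewrite /step big1// => k _; rewrite subrr normr0 mul0r.
have [Xr hr] := nx_steklov_diff r Xu h0.
set D := iter_diff _ r u in ih Xr hr.
have e : (fun t => u t - iter_diff (steklov (g / n%:R)) r.+1 u t) =
  (fun t => (u t - D t) + steklov (g / n%:R) D t).
  by apply/funext => t; rewrite iter_diffS -/D; ring.
rewrite e; apply: le_trans (discrete_norm_add _ _) _.
have p1 : (1 + C) ^+ r <= (1 + C) ^+ r.+1 by rewrite ler_weXn2l//; lra.
have pr : 0 <= (1 + C) ^+ r by rewrite exprn_ge0//; lra.
have h1 := discrete_norm_steklov Xr.
rewrite -natr1.
have h2 : (4 + 2 * g' / g) * C * nx D <= (4 + 2 * g' / g) * C * (1 + C) ^+ r.+1 * nx u.
  rewrite -[leRHS]mulrA; apply: ler_wpM2l => //; apply: le_trans hr _.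
  exact: ler_wpM2r.
have h3 : r%:R * ((4 + 2 * g' / g) * C * (1 + C) ^+ r) * nx u <=
    r%:R * ((4 + 2 * g' / g) * C * (1 + C) ^+ r.+1) * nx u.
  by apply: ler_wpM2r => //; apply: ler_wpM2l => //; exact: ler_wpM2l.
apply: le_trans (lerD (le_trans ih h3) (le_trans h1 h2)) _.
by rewrite le_eqVlt; apply/orP; left; apply/eqP; ring.
Qed.

Lemma steklov_diffB r h u v : X u -> X v -> 0 < h ->
  iter_diff (steklov h) r (fun t => u t - v t) =
  (fun t => iter_diff (steklov h) r u t - iter_diff (steklov h) r v t).
Proof.
move=> Xu Xv h0; elim: r => // r ih; rewrite !iter_diffS ih.
have [Xru _] := nx_steklov_diff r Xu h0; have [Xrv _] := nx_steklov_diff r Xv h0.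
apply/funext => t; rewrite !steklovE//;
  [|exact: X_locint Xrv|exact: X_locint Xru|exact: X_locint (X_sub Xru Xrv)].
rewrite favB; [|exact: X_locint Xru|exact: X_locint Xrv].
have e (A B D E : R) : A - B - (D - E) = A - D - (B - E) by ring.
exact: e.
Qed.

(** By [discrete_norm_dv] it suffices to bound in [X] the difference of [T]
    and, with a factor [1 / n], its derivative, which is the difference of
    [T'].  For the former [steklov_diff_le] is used with [s] derivatives, for
    the latter with [s - 1]. *)
Lemma discrete_norm_diff_trig r s T : (0 < s)%N -> (s <= 2 * r)%N -> trigpoly n T ->
  dx (iter_diff (steklov (g / n%:R)) r T) <=
  (1 + 2 * C) ^+ r * (g ^+ s + 2 * g' * C * g ^+ s.-1) *
  (n%:R ^- s * nx (derive1n s T)).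
Proof.
case: s => // s _ sr tT; have nr : 0 < n%:R :> R by rewrite ltr0n.
have h0 : 0 < g / n%:R by rewrite divr_gt0.
have cT := trigpoly_chain s.+1 tT.
have cD := chain_diff_steklov r h0 cT.
have h1 := discrete_norm_dv (cD.1 0%N isT) (cD.1 1%N isT) (cD.2 0%N isT).
have h2 := steklov_diff_le hC h0 sr cT.
have cT' := chain_shift (j := 1) (k := s) cT.
have h3 := steklov_diff_le hC h0 (ltnW sr) cT'.
rewrite add1n in h3.
have k0 : 0 <= 2 * g' / n%:R * C.
  by rewrite mulr_ge0 ?divr_ge0 ?mulr_ge0 ?ltW// (steklov_bound_gt0 hC).
apply: le_trans h1 _; apply: le_trans (lerD h2 (ler_wpM2l k0 h3)) _.
rewrite !expr_div_n; move: ((1 + _) ^+ r) (nx _) => A B.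
rewrite le_eqVlt; apply/orP; left; apply/eqP; rewrite /= !exprS.
have pn : n%:R ^+ s != 0 :> R by rewrite expf_neq0// gt_eqF.
move: (n%:R ^+ s) pn => N pN; move: (g ^+ s) => Gs.
by field; rewrite pN gt_eqF.
Qed.

End discrete.

(** * The two-sided estimate *)

Section realization_bounds.
Context {R : realType}.
Variables (X : banach_lattice R) (C : R).
Hypothesis hC : steklov_bound X C.
Notation nx := (bl_norm X).
Implicit Types (f u v T P : R -> R) (h y : R).

Lemma nx_dot_diff h s u : X u -> 0 < h -> X (iter_diff (steklov_dot h) s u) /\
  nx (iter_diff (steklov_dot h) s u) <= (1 + 2 * C) ^+ s * nx u.
Proof.
move=> Xu h0; rewrite (iter_diff_dot hC)//.
elim: s => [|s [Xr ih]]; first by rewrite expr0 mul1r.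
have [Xs hs] := nx_fav hC Xr h0.
have [X1 h1] := nx_sub_self Xr Xs hs; split; first exact: X1.
apply: le_trans h1 _; rewrite exprS -mulrA; apply: ler_wpM2l => //.
by have := steklov_bound_gt0 hC; lra.
Qed.

Lemma dot_diffD h s u v : X u -> X v -> 0 < h ->
  iter_diff (steklov_dot h) s (fun t => u t + v t) =
  (fun t => iter_diff (steklov_dot h) s u t + iter_diff (steklov_dot h) s v t).
Proof.
move=> Xu Xv h0; rewrite !(iter_diff_dot hC)//; last exact: X_addp.
elim: s => // s ih; rewrite !iter_diffS ih.
have Xs := X_iter_diff hC h0 s Xu; have Xt := X_iter_diff hC h0 s Xv.
rewrite (X_favD h Xs Xt); apply/funext => t.
have e (A B D E : R) : A + B - (D + E) = A - D + (B - E) by ring.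
exact: e.
Qed.

Lemma bernstein_iter n s T : (0 < n)%N -> trigpoly n T ->
  n%:R ^- s * nx (derive1n s T) <= (576 * C) ^+ s * nx T.
Proof.
move=> n0 tT; have nr : 0 < n%:R :> R by rewrite ltr0n.
have c0 : 0 <= 576 * C.
  by apply: mulr_ge0; [exact: ler0n|exact: ltW (steklov_bound_gt0 hC)].
rewrite ler_pdivrMl ?exprn_gt0// mulrA -exprMn.
elim: s => [|s ih]; first by rewrite expr0 mul1r.
rewrite derive1nS; apply: le_trans (bernstein hC n0 (trigpoly_derive s tT)) _.
have -> : 576 * C * n%:R = n%:R * (576 * C) by rewrite mulrC.
rewrite exprS -[leRHS]mulrA; apply: ler_wpM2l; last exact: ih.
by apply: mulr_ge0; [exact: ltW|exact: c0].
Qed.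

Lemma derive1nB n s S T : trigpoly n S -> trigpoly n T ->
  derive1n s (fun t => S t - T t) = (fun t => derive1n s S t - derive1n s T t).
Proof.
by move=> tS tT; exact: chain_derive1n (chainB (trigpoly_chain s tS) (trigpoly_chain s tT)).
Qed.

Variables (g g' : R) (m : nat -> nat) (x : nat -> nat -> R).
Hypotheses (g0 : 0 < g) (g'0 : 0 < g') (hx : sampling_nodes g g' m x).
Variables r s : nat.
Hypotheses (s0 : (0 < s)%N) (sr : (s <= 2 * r)%N).
Notation dx := (discrete_norm X m x).

Definition modulus n f : R :=
  dx n (iter_diff (steklov (g / n%:R)) r f) +
  nx (iter_diff (steklov_dot (g / n%:R)) s f).

Let L : R := r%:R * ((4 + 2 * g' / g) * C * (1 + C) ^+ r).
Let M : R := (1 + 2 * C) ^+ r * (g ^+ s + 2 * g' * C * g ^+ s.-1).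
Let S : R := (1 + 2 * C) ^+ s.

Let C0 : 0 < C. Proof. exact: steklov_bound_gt0 hC. Qed.

Let L0 : 0 <= L.
Proof.
rewrite /L mulr_ge0// mulr_ge0//; last by rewrite exprn_ge0// addr_ge0// ltW.
by rewrite mulr_ge0 ?(ltW C0)// addr_ge0// divr_ge0 ?mulr_ge0 ?ltW.
Qed.

Let M0 : 0 <= M.
Proof.
rewrite /M mulr_ge0//; first by rewrite exprn_ge0// addr_ge0// mulr_ge0// ltW.
by rewrite addr_ge0 ?mulr_ge0 ?exprn_ge0 ?ltW.
Qed.

Let S0 : 0 <= S. Proof. by rewrite exprn_ge0// addr_ge0// mulr_ge0// ltW. Qed.

(** Split [f] as [(f - T) + T]. *)
Lemma modulus_le : exists2 c, 0 < c & forall n f T, (0 < n)%N -> X f ->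
  trigpoly n T -> modulus n f <= c * (nx (fun t => f t - T t) +
    dx n (fun t => f t - T t) + n%:R ^- s * nx (derive1n s T)).
Proof.
exists (1 + L + M + S + S * g ^+ s).
  have : 0 <= S * g ^+ s by rewrite mulr_ge0// exprn_ge0// ltW.
  by have := L0; have := M0; have := S0; lra.
move=> n f T n0 Xf tT; have nr : 0 < n%:R :> R by rewrite ltr0n.
have h0 : 0 < g / n%:R by rewrite divr_gt0.
have XT := X_CP X (trigpoly_CP tT).
set u := fun t => f t - T t; have Xu : X u := X_sub Xf XT.
set d := n%:R ^- s * _.
have ef : f = (fun t => u t + T t) by apply/funext => t; rewrite /u subrK.
have d0 : 0 <= d.
  rewrite mulr_ge0 ?invr_ge0 ?exprn_ge0 ?(ltW nr)//.
  exact: bl_norm_ge0 (X_CP X (trigpoly_CP (trigpoly_derive s tT))).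
have N0 : 0 <= nx u := bl_norm_ge0 Xu.
have D0 : 0 <= dx n u := discrete_norm_ge0 X m x n u.
have h1 : dx n (iter_diff (steklov (g / n%:R)) r f) <= dx n u + L * nx u + M * d.
  have e : iter_diff (steklov (g / n%:R)) r f =
      (fun t => u t - (u t - iter_diff (steklov (g / n%:R)) r u t)
        + iter_diff (steklov (g / n%:R)) r T t).
    rewrite (steklov_diffB hC r Xf XT h0); apply/funext => t.
    by rewrite subKr subrK.
  rewrite e; apply: le_trans (discrete_norm_add _ _ _ _ _ _) _.
  apply: lerD; last exact: discrete_norm_diff_trig.
  apply: le_trans (discrete_norm_sub _ _ _ _ _ _) _; rewrite lerD2l.
  exact: discrete_norm_diff_sub.
have h2 : nx (iter_diff (steklov_dot (g / n%:R)) s f) <= S * nx u + S * g ^+ s * d.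
  rewrite {1}ef dot_diffD//.
  have [X1 b1] := nx_dot_diff s Xu h0; have [X2 _] := nx_dot_diff s XT h0.
  apply: le_trans (nx_add X1 X2) _; apply: lerD => //.
  apply: le_trans (fav_diff_le hC h0 (trigpoly_chain s tT)) _.
  by rewrite /d expr_div_n !mulrA.
rewrite /modulus; apply: le_trans (lerD h1 h2) _.
have Sg : 0 <= S * g ^+ s by rewrite mulr_ge0// exprn_ge0// ltW.
move: L0 M0 S0 Sg N0 D0 d0; clear h1 h2.
move: L M S (S * _) (nx u) (dx n u) d => A B E F N D d A0 B0 E0 F0 N0 D0 d0.
rewrite -subr_ge0.
have -> : (1 + A + B + E + F) * (N + D + d) - (D + A * N + B * d + (E * N + F * d)) =
  N + d + A * (D + d) + B * (N + D) + E * (D + d) + F * (N + D) by ring.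
by rewrite !addr_ge0// mulr_ge0// addr_ge0.
Qed.

Variables (phi : nat -> nat -> R -> R) (K1 K3 : R).
Hypotheses (K10 : 0 < K1) (K30 : 0 < K3).
Notation G := (sampling_op m x phi).
Hypothesis hG : forall n f, (0 < n)%N -> X f -> trigpoly n (G n f).
Hypothesis hbound : forall n f, (0 < n)%N -> X f -> nx (G n f) <= K1 * dx n f.
Hypothesis happrox : forall n T, (0 < n)%N -> trigpoly n T ->
  nx (fun t => T t - G n T t) <= K3 * n%:R ^- s * nx (derive1n s T).

Lemma sampling_opB n f v : G n (fun t => f t - v t) = (fun t => G n f t - G n v t).
Proof.
apply/funext => y; rewrite /sampling_op -sumrB; apply: eq_bigr => k _.
by rewrite mulrBl.
Qed.

Lemma discrete_norm_trig n T : (0 < n)%N -> trigpoly n T ->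
  dx n T <= (1 + 2 * g' * C * (576 * C)) * nx T.
Proof.
move=> n0 tT; have nr : 0 < n%:R :> R by rewrite ltr0n.
have c := trigpoly_chain 1 tT.
apply: le_trans (discrete_norm_dv hC g0 g'0 hx n0 (c.1 0%N isT) (c.1 1%N isT) (c.2 0%N isT)) _.
have k0 : 0 <= 2 * g' / n%:R * C.
  by rewrite mulr_ge0 ?divr_ge0 ?mulr_ge0 ?ltW.
rewrite [leRHS]mulrDl mul1r; apply: lerD; first exact: lexx.
apply: le_trans (ler_wpM2l k0 (bernstein hC n0 tT)) _.
rewrite le_eqVlt; apply/orP; left; apply/eqP.
by field; rewrite gt_eqF.
Qed.

(** An intermediate polynomial [T], close to [f], is supplied by
    [trig_approx]; [T - G f = (T - G T) - G (f - T)] is controlled by the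
    hypotheses on [G] and by [bernstein]. *)
Lemma le_modulus : exists2 c, 0 < c & forall n f, (0 < n)%N -> X f ->
  nx (fun t => f t - G n f t) + dx n (fun t => f t - G n f t) +
    n%:R ^- s * nx (derive1n s (G n f)) <= c * modulus n f.
Proof.
have [K K0 hK] := trig_approx hC s0 g0.
pose b : R := 2 * g' * C * (576 * C).
have C576 : 0 <= 576 * C by apply: mulr_ge0; [exact: ler0n|exact: ltW].
have b0 : 0 <= b.
  by apply: mulr_ge0 => //; apply: mulr_ge0; [exact: mulr_ge0 (ltW _)|exact: ltW].
pose B : R := (576 * C) ^+ s.
have B0 : 0 <= B by exact: exprn_ge0.
pose Q := 2 + b + B; have Q0 : 0 <= Q by rewrite /Q; lra.
have QK1 : 0 <= Q * K1 by rewrite mulr_ge0// ltW.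
have QK3 : 0 <= Q * K3 by rewrite mulr_ge0// ltW.
have MLK : 0 <= (M + L) * K by rewrite mulr_ge0 ?addr_ge0// ltW.
exists ((1 + Q * K1) * (1 + (M + L) * K) + (2 + Q * K3) * K).
  by rewrite addr_gt0// mulr_gt0//; lra.
move=> n f n0 Xf; have nr : 0 < n%:R :> R by rewrite ltr0n.
have h0 : 0 < g / n%:R by rewrite divr_gt0.
have [T [tT hN hd]] := hK n f Xf n0.
have XT := X_CP X (trigpoly_CP tT).
have tG := hG n0 Xf; have XG := X_CP X (trigpoly_CP tG).
rewrite /modulus; set E := dx n (iter_diff _ r f); set om := nx (iter_diff _ s f) in hN hd *.
have E0 : 0 <= E := discrete_norm_ge0 X m x n _.
have om0 : 0 <= om by apply: bl_norm_ge0; have [] := nx_dot_diff s Xf h0.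
set u := fun t => f t - T t in hN; have Xu : X u := X_sub Xf XT.
set d := n%:R ^- s * nx (derive1n s T) in hd.
pose P t := T t - G n f t; have tP : trigpoly n P := trigpolyB tT tG.
have XP := X_CP X (trigpoly_CP tP).
have hD : dx n u <= E + M * d + L * nx u.
  have e : u = (fun t => iter_diff (steklov (g / n%:R)) r f t
      - iter_diff (steklov (g / n%:R)) r T t
      + (u t - iter_diff (steklov (g / n%:R)) r u t)).
    rewrite (steklov_diffB hC r Xf XT h0); apply/funext => t.
    by rewrite addrC subrK.
  rewrite {1}e; apply: le_trans (discrete_norm_add _ _ _ _ _ _) _.
  apply: lerD; last exact: discrete_norm_diff_sub.
  apply: le_trans (discrete_norm_sub _ _ _ _ _ _) _; rewrite lerD2l.
  exact: discrete_norm_diff_trig.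
have hP : nx P <= K3 * d + K1 * dx n u.
  have XGT := X_CP X (trigpoly_CP (hG n0 XT)); have XGu := X_CP X (trigpoly_CP (hG n0 Xu)).
  have -> : P = (fun t => (T t - G n T t) - G n u t).
    by rewrite sampling_opB; apply/funext => t; rewrite /P opprB addrA subrK.
  apply: le_trans (nx_sub (X_sub XT XGT) XGu) _.
  by apply: lerD; [rewrite /d mulrA; exact: happrox|exact: hbound].
have ef : (fun t => f t - G n f t) = (fun t => u t + P t).
  by apply/funext => t; rewrite /u /P addrA subrK.
have r1 : nx (fun t => f t - G n f t) <= nx u + nx P.
  by rewrite ef; exact: nx_add.
have r2 : dx n (fun t => f t - G n f t) <= dx n u + (1 + b) * nx P.
  rewrite ef; apply: le_trans (discrete_norm_add _ _ _ _ _ _) _.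
  by rewrite lerD2l; exact: discrete_norm_trig.
have r3 : n%:R ^- s * nx (derive1n s (G n f)) <= d + B * nx P.
  have eG : G n f = (fun t => T t - P t) by apply/funext => t; rewrite /P subKr.
  rewrite eG (derive1nB s tT tP).
  have X1 := X_CP X (trigpoly_CP (trigpoly_derive s tT)).
  have X2 := X_CP X (trigpoly_CP (trigpoly_derive s tP)).
  have i0 : 0 <= n%:R ^- s :> R by rewrite invr_ge0 exprn_ge0// ltW.
  apply: le_trans (ler_wpM2l i0 (nx_sub X1 X2)) _.
  by rewrite mulrDr lerD2l; exact: bernstein_iter.
apply: le_trans (lerD (lerD r1 r2) r3) _.
have D0 : 0 <= dx n u := discrete_norm_ge0 X m x n u.
have d0 : 0 <= d.
  rewrite mulr_ge0 ?invr_ge0 ?exprn_ge0 ?(ltW nr)//.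
  exact: bl_norm_ge0 (X_CP X (trigpoly_CP (trigpoly_derive s tT))).
have q1 : Q * nx P <= Q * (K3 * d + K1 * dx n u) by exact: ler_wpM2l.
have q2 : M * d <= M * (K * om) by exact: ler_wpM2l.
have q3 : L * nx u <= L * (K * om) by exact: ler_wpM2l.
have q4 : (1 + Q * K1) * dx n u <= (1 + Q * K1) * (E + (M + L) * K * om).
  apply: ler_wpM2l; first by apply: addr_ge0.
  rewrite -mulrA mulrDl addrA; apply: le_trans hD _.
  by apply: lerD => //; rewrite lerD2l.
have q5 : Q * K3 * d <= Q * K3 * (K * om) by exact: ler_wpM2l.
clear r1 r2 r3 hP hD; apply: (@le_trans _ _ ((1 + Q * K1) * (E + (M + L) * K * om) + (2 + Q * K3) * K * om)).
  have e : nx u + nx P + (dx n u + (1 + b) * nx P) + (d + B * nx P) =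
    nx u + dx n u + d + Q * nx P by rewrite /Q; ring.
  rewrite e; have -> : (2 + Q * K3) * K * om = K * om + K * om + Q * K3 * (K * om) by ring.
  have q1' : Q * nx P <= Q * K3 * d + Q * (K1 * dx n u).
    by apply: le_trans q1 _; rewrite mulrDr mulrA.
  have q4' : dx n u + Q * (K1 * dx n u) <= (1 + Q * K1) * (E + (M + L) * K * om).
    by apply: le_trans q4; rewrite [leRHS]mulrDl mul1r mulrA.
  move: q1' q4' q5 hN hd d0; clear q1 q2 q4 e.
  move: (nx u) (dx n u) d (Q * nx P) (Q * K3) (Q * (K1 * _)) ((1 + Q * K1) * _) (K * om).
  move=> v1 v2 v3 v4 v5 v6 v7 v8; move: (v5 * v3) (v5 * v8) => v9 v10.
  lra.
have -> : ((1 + Q * K1) * (1 + (M + L) * K) + (2 + Q * K3) * K) * (E + om) =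
  (1 + Q * K1) * (E + (M + L) * K * om) + (2 + Q * K3) * K * om +
  ((1 + Q * K1) * (om + (M + L) * K * E) + (2 + Q * K3) * K * E).
  by move: (Q * K1) (Q * K3) ((M + L) * K) => a1 a3 a2; ring.
rewrite lerDl; have Q1 : 0 <= 1 + Q * K1 by lra.
have Q3 : 0 <= (2 + Q * K3) * K by apply: mulr_ge0; [lra|exact: ltW].
apply: addr_ge0; apply: mulr_ge0 => //; apply: addr_ge0 => //; exact: mulr_ge0.
Qed.

End realization_bounds.
Theorem theorem3p5 (R : realType) (X : banach_lattice R)
    (hA : assumptionA X)
    (r s : nat) (hr : (0 < r)%N) (hs : (0 < s)%N) (hrs : (s <= 2 * r)%N)
    (Phi : nat -> set (R -> R)) (hPhi : bernstein_spaces X Phi)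
    (g g' : R) (hg : 0 < g) (hg' : 0 < g')
    (m : nat -> nat) (x : nat -> nat -> R) (hx : sampling_nodes g g' m x)
    (phi : nat -> nat -> R -> R)
    (hphi : forall n k, (0 < n)%N -> (1 <= k <= m n)%N -> Phi n (phi n k))
    (hG : forall n f, (0 < n)%N -> X f -> trigpoly n (sampling_op m x phi n f))
    (K1 K3 : R) (hK1 : 0 < K1) (hK3 : 0 < K3)
    (hbound : forall n f, (0 < n)%N -> X f ->
      bl_norm X (sampling_op m x phi n f) <= K1 * discrete_norm X m x n f)
    (happrox : forall n T, (0 < n)%N -> trigpoly n T ->
      bl_norm X (T \- sampling_op m x phi n T)
        <= K3 * (n%:R : R) ^- s * bl_norm X (derive1n s T)) :
  exists c C : R, [/\ 0 < c, 0 < C &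
    forall f n, X f -> (0 < n)%N ->
      let rhs := discrete_norm X m x n (iter_diff (steklov (g / n%:R)) r f) +
                 bl_norm X (iter_diff (steklov_dot (g / n%:R)) s f) in
      c * rhs <= realization X m x phi s n f (n%:R^-1) <= C * rhs].
Proof.
have [C hC] := exists_steklov_bound hA.
have happrox' n T : (0 < n)%N -> trigpoly n T ->
    bl_norm X (fun t => T t - sampling_op m x phi n T t)
      <= K3 * (n%:R : R) ^- s * bl_norm X (derive1n s T) by exact: happrox.
have [c c0 hc] := modulus_le hC hg hg' hx hs hrs.
have [c' c'0 hc'] := le_modulus hC hg hg' hx hs hrs hK1 hK3 hG hbound happrox'.
exists c^-1, c'; split; [by rewrite invr_gt0|exact: c'0|].
move=> f n Xf n0; rewrite /realization exprVn; apply/andP; split.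
  by rewrite ler_pdivrMl//; exact: (hc n f _ n0 Xf (hG n f n0 Xf)).
exact: (hc' n f n0 Xf).
Qed.
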